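(* There exists an absolute constant $c>0$ and, for every $p>4$ and $\kappa<\infty$, a constant $C(\kappa,p)$ depending only on $\kappa$ and $p$, such that the following holds. Let $X\in\mathbb{R}^d$ be a random vector such that $\mathbb{E}X=0$ and $\mathbb{E}XX^\top=\boldsymbol{\Sigma}$, and let $X_1,\dots,X_n\in\mathbb{R}^d$ be i.i.d. copies of $X$. Assume that $\frac{r(\boldsymbol{\Sigma})}{n}\le c$ and that for some $p>4$ $$\sup_{\|v\|_2=1}\frac{\big(\mathbb{E}|\langle X,v\rangle|^p\big)^{1/p}}{\big(\mathbb{E}\langle X,v\rangle^2\big)^{1/2}}=\kappa<\infty.$$ Then $$\left(\mathbb{E}\left\|\frac1n\sum_{k=1}^nX_kX_k^\top-\boldsymbol{\Sigma}\right\|^2\right)^{1/2}\le C(\kappa,p)\left(\|\boldsymbol{\Sigma}\|\sqrt{\frac{r(\boldsymbol{\Sigma})}{n}}+\frac{\big(\mathbb{E}\max_{1\le k\le n}\|X_k\|_2^p\big)^{2/p}}{n}\right).$$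
   Context: $\|\cdot\|$ is the operator (spectral) norm of a matrix, $\|\cdot\|_2$ and $\langle\cdot,\cdot\rangle$ are the Euclidean norm and inner product on $\mathbb{R}^d$. For a nonnegative definite matrix $\mathbf{A}$, the effective rank is $r(\mathbf{A})=\mathrm{trace}(\mathbf{A})/\|\mathbf{A}\|$, with the convention $r(\mathbf{0}_{d\times d})=0$. Directions $v$ with $\mathbb{E}\langle X,v\rangle^2=0$ (where the ratio is $0/0$) impose no condition in the supremum. *)

(* Defs.v *)
From HB Require Import structures.
From mathcomp Require Import all_boot all_order all_algebra.
From mathcomp Require Import all_classical all_reals all_analysis.
Set Implicit Arguments.
Unset Strict Implicit.
Unset Printing Implicit Defensive.
Import Order.TTheory GRing.Theory Num.Theory.
Import numFieldNormedType.Exports.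
Local Open Scope classical_set_scope.
Local Open Scope ring_scope.

Definition dotp (R : realType) (m : nat) (u v : 'cV[R]_m) : R :=
  \sum_i u i 0 * v i 0.

(* The library norm on matrices is the sup norm, hence this definition. *)
Definition norm2 (R : realType) (m : nat) (v : 'cV[R]_m) : R :=
  Num.sqrt (dotp v v).

Definition opnorm (R : realType) (m k : nat) (A : 'M[R]_(m, k)) : R :=
  sup [set norm2 (A *m v) | v in [set v : 'cV[R]_k | norm2 v = 1]].

(* effrank 0 = 0, since x / 0 = 0 in a field. *)
Definition effrank (R : realType) (m : nat) (A : 'M[R]_m) : R :=
  \tr A / opnorm A.

(* A random vector of R^m is a measurable map to [m.-tuple R], which carries
   the product (= Borel) sigma-algebra; matrices have none in the library. *)
Definition vec (R : realType) (m : nat) (x : m.-tuple R) : 'cV[R]_m :=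
  \col_i tnth x i.

Section Probability.
Context (disp : measure_display) (T : measurableType disp) (R : realType).
Variable P : probability T R.
Local Open Scope ereal_scope.

Definition independent disp' (U : measurableType disp') (n : nat)
    (X : 'I_n -> {RV P >-> U}) : Prop :=
  forall (J : {set 'I_n}) (B : 'I_n -> set U), (forall k, measurable (B k)) ->
    P (\bigcap_(k in [set` J]) (X k @^-1` B k)) =
    \prod_(k in J) P (X k @^-1` B k).

(* [distribution] is only meaningful on measurable sets. *)
Definition same_distribution disp' (U : measurableType disp')
    (X Y : {RV P >-> U}) : Prop :=
  forall B, measurable B -> distribution P X B = distribution P Y B.

Definition iid_copies disp' (U : measurableType disp') (n : nat)
    (X : {RV P >-> U}) (Xs : 'I_n -> {RV P >-> U}) : Prop :=
  independent Xs /\ forall k, same_distribution (Xs k) X.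

Definition centered (m : nat) (X : {RV P >-> m.-tuple R}) : Prop :=
  forall i, 'E_P[fun w => vec (X w) i 0%R] = 0.

(* E X X^T = S, entrywise.  The diagonal entries force the coordinates of X to
   be square integrable, so every expectation here and in [centered] is an
   absolutely convergent integral. *)
Definition has_second_moment (m : nat) (X : {RV P >-> m.-tuple R})
    (S : 'M[R]_m) : Prop :=
  forall i j, 'E_P[fun w => (vec (X w) *m (vec (X w))^T)%R i j] = (S i j)%:E.

(* Computed in [0, +oo].  As 0^-1 = +oo and 0 * +oo = 0 in \bar R, a direction
   with E <X, v>^2 = 0 gives the ratio 0 and so imposes no condition. *)
Definition moment_ratio (m : nat) (p : R) (X : {RV P >-> m.-tuple R})
    (v : 'cV[R]_m) : \bar R :=
  ('E_P[fun w => (`|dotp (vec (X w)) v| `^ p)%R]) `^ p^-1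
  / ('E_P[fun w => (dotp (vec (X w)) v ^+ 2)%R]) `^ 2^-1.

Definition sup_moment_ratio (m : nat) (p : R) (X : {RV P >-> m.-tuple R}) :
    \bar R :=
  ereal_sup [set moment_ratio p X v | v in [set v : 'cV[R]_m | norm2 v = 1%R]].

End Probability.

Definition sample_cov (R : realType) (m n : nat) (x : 'I_n -> m.-tuple R) :
    'M[R]_m :=
  n%:R^-1 *: \sum_(k < n) vec (x k) *m (vec (x k))^T.

(* Main.v *)
(**
Write [L] for the operator norm of Sigma, [x_i = X_i / sqrt L], [r] for the
effective rank, [eps = sqrt (r / n)] and [M = max |x_i|].  For a unit vector
[v] the error [sum <x_i, v>^2 - n E <x, v>^2] is split at the height
[<x_i, v>^2 = T] with [T] of order [1 / eps].

Below that height a PAC-Bayesian argument applies.  The vector [v] is smoothed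
into the endpoint of a biased [+-1] random walk on the coordinate axes, whose
relative entropy with respect to the unbiased walk is at most [r]; since the
unbiased walk does not depend on [v], the Donsker-Varadhan inequality bounds
the truncated sums for all [v] simultaneously, by [n eps] plus the logarithm of
one random variable of mean at most 1.

Above that height the operator norm of [sum_(i in I) x_i x_i^T] is bounded for
all index sets [I] at once.  The coefficients [a_i = <x_i, v>] are cut into
dyadic levels [t <= |a_i| < 2t], treated from the top down.  An index [i] of a
level is a hit if [x_i] is strongly correlated with the combination built so
far.  By Maurey's empirical method, many hits give a short signed sum [u] of
the [x_j] with [|<x_i, u>| >= c t |u|] for many other [i], and this is
impossible except for a number of hits controlled by an exponential moment:
conditionally on the [x_j] occurring in [u], each such event has probability
at most [C t^-p].  Once the hits are discarded, the cross terms between the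
levels are small compared with the operator norm, which closes the estimate.
*)
Require Import Defs.
From HB Require Import structures.
From mathcomp Require Import all_boot all_order all_algebra.
From mathcomp Require Import ring lra.
From mathcomp Require Import all_classical all_reals all_analysis measurable_realfun.
Set Implicit Arguments.
Unset Strict Implicit.
Unset Printing Implicit Defensive.
Import Order.TTheory GRing.Theory Num.Theory.
Import numFieldNormedType.Exports.
Local Open Scope classical_set_scope.
Local Open Scope ring_scope.

(** * Euclidean norm and operator norm *)

(** Smoothing is not free: it adds to each <x_i, v>^2 a noise of about |x_i|^2 / r, of mean 1. The
    truncated square is therefore expanded with the coefficient of this noise kept equal to 1, so
    that only sum (|x_i|^2 / r - 1) survives; it does not involve v and has variance O(n). Entropy r
    against a tilt of order eps costs r / eps = n eps, while the fourth moments cost n eps in the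
    other direction: this fixes T. The exponent 4 comes from the count of hits at height t. A drawn
    vector is penalised by t^-4 and a hit rewarded by t^(p-4), a true reward only if p > 4; the
    expected excess is then of order n t^-4. Weighted by t^2 and summed over the levels above t0,
    with t0^2 of order 1 / eps, it gives n t0^-2, again of order n eps, while the remaining cost per
    level adds up to a multiple of M^2. All exceptional events enter through logarithms of variables
    of mean at most 1. Two of them stand alone and are squared by ln^2 (1 + y) <= 4 y. The third
    multiplies M^2, and Young's inequality splits the product into the p-th moment of M and a
    variable of finite mean. *)

Lemma sqr_le_norm (R : realDomainType) (a b : R) : `|a| <= b -> a ^+ 2 <= b ^+ 2.
Proof.
move=> ab; rewrite -(real_normK (num_real a)) ler_pXn2r ?nnegrE //.
exact: le_trans ab.
Qed.

Section Euclid.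
Context (R : realType) (m : nat).
Implicit Types (u v w : 'cV[R]_m) (a : R).

Lemma dotpC u v : dotp u v = dotp v u.
Proof. by apply: eq_bigr => i _; rewrite mulrC. Qed.

Lemma dotpDl u v w : dotp (u + v) w = dotp u w + dotp v w.
Proof. by rewrite -big_split; apply: eq_bigr => i _; rewrite mxE mulrDl. Qed.

Lemma dotpZl a u w : dotp (a *: u) w = a * dotp u w.
Proof. by rewrite mulr_sumr; apply: eq_bigr => i _; rewrite mxE mulrA. Qed.

Lemma dotpDr u v w : dotp u (v + w) = dotp u v + dotp u w.
Proof. by rewrite dotpC dotpDl !(dotpC u). Qed.

Lemma dotpZr a u w : dotp u (a *: w) = a * dotp u w.
Proof. by rewrite dotpC dotpZl dotpC. Qed.

Lemma dotpNl u w : dotp (- u) w = - dotp u w.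
Proof. by rewrite -scaleN1r dotpZl mulN1r. Qed.

Lemma dotpNr u w : dotp u (- w) = - dotp u w.
Proof. by rewrite dotpC dotpNl dotpC. Qed.

Lemma dotpBr u v w : dotp u (v - w) = dotp u v - dotp u w.
Proof. by rewrite dotpDr dotpNr. Qed.

Lemma dotpBl u v w : dotp (u - v) w = dotp u w - dotp v w.
Proof. by rewrite dotpDl dotpNl. Qed.

Lemma dotp0l w : dotp 0 w = 0.
Proof. by rewrite -(scale0r (0 : 'cV_m)) dotpZl mul0r. Qed.

Lemma dotp0r w : dotp w 0 = 0.
Proof. by rewrite dotpC dotp0l. Qed.

Lemma dotp_suml (I : Type) (s : seq I) (P : pred I) (F : I -> 'cV[R]_m) w :
  dotp (\sum_(i <- s | P i) F i) w = \sum_(i <- s | P i) dotp (F i) w.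
Proof. by apply: (big_morph (fun u => dotp u w)) => [u v|]; rewrite ?dotpDl ?dotp0l. Qed.

Lemma dotp_sumr (I : Type) (s : seq I) (P : pred I) (F : I -> 'cV[R]_m) w :
  dotp w (\sum_(i <- s | P i) F i) = \sum_(i <- s | P i) dotp w (F i).
Proof. by rewrite dotpC dotp_suml; apply: eq_bigr => i _; rewrite dotpC. Qed.

Lemma dotpvv_ge0 u : 0 <= dotp u u.
Proof. by apply: sumr_ge0 => i _; rewrite -expr2 sqr_ge0. Qed.

Lemma norm2_ge0 u : 0 <= norm2 u.
Proof. exact: sqrtr_ge0. Qed.

Lemma sqr_norm2 u : norm2 u ^+ 2 = dotp u u.
Proof. by rewrite sqr_sqrtr // dotpvv_ge0. Qed.

Lemma dotp_eq0 u : dotp u u = 0 -> u = 0.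
Proof.
move=> u0; apply/colP => i; rewrite mxE; apply/eqP.
have /psumr_eq0P P0 : \sum_j u j 0 * u j 0 = 0 by [].
have /eqP : u i 0 * u i 0 = 0 by apply: P0 => // j _; rewrite -expr2 sqr_ge0.
by rewrite mulf_eq0 orbb.
Qed.

Lemma norm2_eq0 u : norm2 u = 0 -> u = 0.
Proof. by move=> u0; apply: dotp_eq0; rewrite -sqr_norm2 u0 expr0n. Qed.

Lemma norm2Z a u : norm2 (a *: u) = `|a| * norm2 u.
Proof.
by rewrite /norm2 dotpZl dotpZr mulrA -expr2 sqrtrM ?sqr_ge0 // sqrtr_sqr.
Qed.

Lemma cauchy_schwarz_sqr u v : dotp u v ^+ 2 <= dotp u u * dotp v v.
Proof.
have [/dotp_eq0 ->|v0] := eqVneq (dotp v v) 0; first by rewrite !dotp0r expr0n mulr0.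
have vp : 0 < dotp v v by rewrite lt_def v0 dotpvv_ge0.
have := dotpvv_ge0 (dotp v v *: u - dotp u v *: v).
rewrite !(dotpBl, dotpBr, dotpZl, dotpZr) (dotpC v u) => h.
rewrite -(ler_pM2l vp); nra.
Qed.

Lemma ler_abs_dotp u v : `|dotp u v| <= norm2 u * norm2 v.
Proof.
rewrite -(@ler_pXn2r _ 2) ?nnegrE ?mulr_ge0 ?norm2_ge0 //.
by rewrite exprMn !sqr_norm2 real_normK ?num_real // cauchy_schwarz_sqr.
Qed.

Lemma ler_dotp u v : dotp u v <= norm2 u * norm2 v.
Proof. exact: le_trans (ler_norm _) (ler_abs_dotp _ _). Qed.

Lemma ler_norm2D u v : norm2 (u + v) <= norm2 u + norm2 v.
Proof.
rewrite -(@ler_pXn2r _ 2) ?nnegrE ?addr_ge0 ?norm2_ge0 //.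
rewrite sqr_norm2 !(dotpDl, dotpDr) (dotpC v u) sqrrD !sqr_norm2.
have := ler_dotp u v; lra.
Qed.

End Euclid.

Section Operator_norm.
Context (R : realType).

Lemma dotp_mulmx m k (A : 'M[R]_(m, k)) u v :
  dotp u (A *m v) = \sum_i \sum_j u i 0 * A i j * v j 0.
Proof.
apply: eq_bigr => i _; rewrite mxE mulr_sumr; apply: eq_bigr => j _.
by rewrite mulrA.
Qed.

Lemma sum_quad_delta m (A : 'M[R]_m) :
  \sum_j dotp (delta_mx j 0) (A *m delta_mx j 0) = \tr A.
Proof.
apply: eq_bigr => j _; rewrite dotp_mulmx (bigD1 j) //= (bigD1 j) //=.
rewrite !mxE !eqxx mul1r mulr1 !big1 ?addr0 // => i ij; last by rewrite !mxE (negbTE ij) mulr0.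
by apply: big1 => k _; rewrite mxE (negbTE ij) !mul0r.
Qed.

(** The Frobenius norm is a crude bound, but some bound is indispensable: [sup] of an unbounded set
    is the default value 0. *)
Lemma opnorm_set_ubound m k (A : 'M[R]_(m, k)) :
  ubound [set norm2 (A *m v) | v in [set v : 'cV[R]_k | norm2 v = 1]]
    (Num.sqrt (\sum_i norm2 (row i A)^T ^+ 2)).
Proof.
move=> _ [v /= v1 <-]; rewrite /norm2 ler_wsqrtr // {1}/dotp.
apply: ler_sum => i _; rewrite -expr2.
have -> : (A *m v) i 0 = dotp (row i A)^T v.
  by rewrite mxE; apply: eq_bigr => j _; rewrite !mxE.
rewrite (le_trans (cauchy_schwarz_sqr _ _)) // -(sqr_norm2 v) v1.
by rewrite expr1n mulr1 -/(norm2 _) sqr_norm2.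
Qed.

Lemma norm2_mulmx_le_opnorm m k (A : 'M[R]_(m, k)) v :
  norm2 (A *m v) <= opnorm A * norm2 v.
Proof.
have [v0|v0] := eqVneq (norm2 v) 0.
  by rewrite v0 mulr0 (norm2_eq0 v0) mulmx0 /norm2 dotp0l sqrtr0.
have vp : 0 < norm2 v by rewrite lt_def v0 norm2_ge0.
have Ev : norm2 (A *m ((norm2 v)^-1 *: v)) = norm2 (A *m v) / norm2 v.
  by rewrite -scalemxAr norm2Z normfV ger0_norm ?norm2_ge0 // mulrC.
rewrite -ler_pdivrMr // -Ev; apply: ub_le_sup; first by eexists; exact: opnorm_set_ubound.
by exists ((norm2 v)^-1 *: v) => //=; rewrite norm2Z normfV ger0_norm ?norm2_ge0 // mulVf.
Qed.

Lemma opnorm_ge0 m k (A : 'M[R]_(m, k)) : 0 <= opnorm A.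
Proof.
rewrite /opnorm; set S := [set _ | _ in _].
(* For k = 0 there is no unit vector, and the supremum of the empty set is 0. *)
have [->|/set0P[x Sx]] := eqVneq S set0; last first.
  rewrite (le_trans _ (ub_le_sup _ Sx)) //; last by eexists; exact: opnorm_set_ubound.
  by case: Sx => v _ <-; exact: norm2_ge0.
by rewrite sup0.
Qed.

Lemma opnorm_le m k (A : 'M[R]_(m, k)) c : 0 <= c ->
  (forall v, norm2 v = 1 -> norm2 (A *m v) <= c) -> opnorm A <= c.
Proof.
move=> c0 Ac; rewrite /opnorm; set S := [set _ | _ in _].
have [->|/set0P S0] := eqVneq S set0; first by rewrite sup0.
by apply: ge_sup => // _ [v v1 <-]; exact: Ac.
Qed.

Lemma quad_le_opnorm m (A : 'M[R]_m) v :
  dotp v (A *m v) <= opnorm A * dotp v v.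
Proof.
rewrite (le_trans (ler_dotp _ _)) // -sqr_norm2 expr2 mulrA mulrC ler_wpM2r ?norm2_ge0 //.
exact: norm2_mulmx_le_opnorm.
Qed.

(* Polarisation: the operator norm of a symmetric matrix is attained on its quadratic form. *)
Lemma opnorm_sym_le m (A : 'M[R]_m) c : A^T = A -> 0 <= c ->
  (forall v, norm2 v = 1 -> `|dotp v (A *m v)| <= c) -> opnorm A <= c.
Proof.
move=> symA c0 Ac.
have symE u v : dotp u (A *m v) = dotp v (A *m u).
  rewrite !dotp_mulmx exchange_big; apply: eq_bigr => i _; apply: eq_bigr => j _ /=.
  by rewrite -{1}symA mxE mulrAC (mulrC (u j 0)) mulrAC.
have Aq v : `|dotp v (A *m v)| <= c * dotp v v.
  have [v0|v0] := eqVneq (norm2 v) 0.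
    by rewrite (norm2_eq0 v0) !dotp0l mulr0 normr0.
  have vp : 0 < norm2 v by rewrite lt_def v0 norm2_ge0.
  have := Ac ((norm2 v)^-1 *: v); rewrite norm2Z normfV ger0_norm ?norm2_ge0 // mulVf //.
  move=> /(_ erefl); rewrite -scalemxAr dotpZl dotpZr mulrA -expr2 normrM.
  by rewrite ger0_norm ?sqr_ge0 // exprVn -sqr_norm2 mulrC ler_pdivrMr // exprn_gt0.
apply: opnorm_le => // v v1.
have [w0|w0] := eqVneq (norm2 (A *m v)) 0; first by rewrite w0.
have wp : 0 < norm2 (A *m v) by rewrite lt_def w0 norm2_ge0.
pose u := (norm2 (A *m v))^-1 *: (A *m v).
have u1 : dotp u u = 1.
  by rewrite -sqr_norm2 norm2Z normfV ger0_norm ?norm2_ge0 // mulVf // expr1n.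
have v1' : dotp v v = 1 by rewrite -sqr_norm2 v1 expr1n.
have -> : norm2 (A *m v) = dotp u (A *m v).
  by rewrite dotpZl -sqr_norm2 expr2 mulrA mulVf // mul1r.
have := Aq (u + v); have := Aq (u - v).
rewrite !mulmxDr mulmxN !(dotpDl, dotpDr, dotpNl, dotpNr) (symE v u) (dotpC v u) u1 v1'.
rewrite !ler_norml => /andP[h1 h2] /andP[h3 h4]; nra.
Qed.

End Operator_norm.

(** * Biased random walks and smoothing of a direction *)

Section Biased_walk.
Context (R : realType).

(* Expectation of [F (th + \sum_e eta_e b_e)] for independent signs [eta_e] of
   mean [s_e], the list [L] containing the pairs [(b_e, s_e)]. *)
Fixpoint walk (V : zmodType) (L : seq (V * R)) (F : V -> R) (th : V) : R :=
  if L is e :: L' then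
    (1 + e.2) / 2 * walk L' F (th + e.1) + (1 - e.2) / 2 * walk L' F (th - e.1)
  else F th.

Definition bias_ok (V : zmodType) (L : seq (V * R)) := all (fun e => `|e.2| < 1) L.

Definition unbias (V : zmodType) (L : seq (V * R)) := [seq (e.1, 0 : R) | e <- L].

Section General.
Context (V : zmodType).
Implicit Types (L : seq (V * R)) (F G : V -> R).

Lemma bias_ok_unbias L : bias_ok (unbias L).
Proof. by rewrite /bias_ok all_map; apply/allP => e _ /=; rewrite normr0. Qed.

Lemma walk_le L F G th : bias_ok L -> (forall y, F y <= G y) ->
  walk L F th <= walk L G th.
Proof.
move=> + FG; elim: L th => [|[b s] L IH] th /=; first by rewrite FG.
rewrite ltr_norml -andbA => /and3P[s1 s2 Ls].
by apply: lerD; apply: ler_wpM2l => //; try (exact: IH); lra.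
Qed.

Lemma walkD L F G th : walk L (fun y => F y + G y) th = walk L F th + walk L G th.
Proof. by elim: L th => [|[b s] L IH] th //=; rewrite !IH; ring. Qed.

Lemma walkZ L F c th : walk L (fun y => c * F y) th = c * walk L F th.
Proof. by elim: L th => [|[b s] L IH] th //=; rewrite !IH; ring. Qed.

Lemma walk_cst L c th : walk L (fun=> c) th = c.
Proof. by elim: L th => [|[b s] L IH] th //=; rewrite !IH; field. Qed.

Lemma walk_sum (I : Type) (r : seq I) L (F : I -> V -> R) th :
  walk L (fun y => \sum_(i <- r) F i y) th = \sum_(i <- r) walk L (F i) th.
Proof.
elim: r => [|i r IH].
  rewrite big_nil -[RHS](walk_cst L 0 th); congr walk; apply/funext => y.
  by rewrite big_nil.
rewrite big_cons -IH -walkD; congr walk; apply/funext => y.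
by rewrite big_cons.
Qed.

Lemma walk_min_le L F G th : bias_ok L ->
  walk L (fun y => Num.min (F y) (G y)) th <= Num.min (walk L F th) (walk L G th).
Proof.
move=> Lok; rewrite le_min; apply/andP; split; apply: walk_le => // y.
  by rewrite ge_min lexx.
by rewrite ge_min lexx orbT.
Qed.

Lemma walk_gt0 L F th : bias_ok L -> (forall y, 0 < F y) -> 0 < walk L F th.
Proof.
move=> + F0; elim: L th => [|[b s] L IH] th //=.
rewrite ltr_norml -andbA => /and3P[s1 s2 Ls].
by apply: addr_gt0; apply: mulr_gt0; rewrite ?IH //; lra.
Qed.

Lemma walk_comp (W : zmodType) (l : V -> W) L (F : W -> R) th :
  (forall x y, l (x + y) = l x + l y) -> (forall x y, l (x - y) = l x - l y) ->
  walk L (fun y => F (l y)) th = walk [seq (l e.1, e.2) | e <- L] F (l th).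
Proof.
by move=> lD lB; elim: L th => [|[b s] L IH] th //=; rewrite !IH lD lB.
Qed.

(** The one-coin case of the entropy inequality. The relative entropy of a coin of mean s with
    respect to the fair coin is at most s^2, by ln (1 + z) <= z at z = s and z = - s; the same
    inequality at D / (C (1 + z)) - 1 gives the Gibbs part, whose right-hand sides add up to 0. *)
Lemma ln_two_point (A B s : R) : 0 < A -> 0 < B -> `|s| < 1 ->
  (1 + s) / 2 * ln A + (1 - s) / 2 * ln B <= ln (2^-1 * A + 2^-1 * B) + s ^+ 2.
Proof.
move=> A0 B0; rewrite ltr_norml => /andP[s1 s2].
set C := 2^-1 * A + 2^-1 * B.
have C0 : 0 < C by rewrite /C; lra.
have key D z : 0 < D -> -1 < z -> (1 + z) / 2 * (ln D - ln C) <= D / (2 * C) - (1 + z) / 2 + (1 + z) / 2 * z.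
  move=> D0 z1; have z0 : 0 < 1 + z by lra.
  have lnq : ln (D / (C * (1 + z))) <= D / (C * (1 + z)) - 1.
    have q0 : 0 < D / (C * (1 + z)) by rewrite divr_gt0 // mulr_gt0.
    have q1 : -1 < D / (C * (1 + z)) - 1 by lra.
    by have := le_ln1Dx q1; rewrite addrC subrK.
  have lnz : ln (1 + z) <= z by exact: le_ln1Dx.
  rewrite ln_div ?posrE ?mulr_gt0 // lnM ?posrE // in lnq.
  have {lnq lnz} : ln D - ln C <= D / (C * (1 + z)) - 1 + z by lra.
  move=> /(ler_wpM2l (_ : 0 <= (1 + z) / 2)) h.
  apply: le_trans (h _) _; first lra.
  rewrite le_eqVlt; apply/orP; left; apply/eqP; field.
  by rewrite !gt_eqF.
have := key A s A0 s1; have := key B (- s) B0 ltac:(lra).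
have -> : B / (2 * C) = 1 - A / (2 * C).
  by rewrite /C; field; rewrite gt_eqF // /C; lra.
lra.
Qed.

(* The Donsker-Varadhan inequality: the squared biases bound the relative entropy
   of the biased walk with respect to the unbiased one. *)
Lemma walk_entropy L F th : bias_ok L ->
  walk L F th <= ln (walk (unbias L) (fun y => expR (F y)) th) + \sum_(e <- L) e.2 ^+ 2.
Proof.
elim: L th => [|[b s] L IH] th /=; first by rewrite big_nil addr0 expRK.
move=> /andP[s1 Lok]; rewrite big_cons /= addr0 subr0.
have w0 y : 0 < walk (unbias L) (fun y => expR (F y)) y.
  by apply: walk_gt0 => [|z]; rewrite ?bias_ok_unbias ?expR_gt0.
have := ln_two_point (w0 (th + b)) (w0 (th - b)) s1.
have := IH (th + b) Lok; have := IH (th - b) Lok.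
move: s1; rewrite ltr_norml !div1r => /andP[s1 s2].
set X := walk L F _; set Y := walk L F _; set S := \sum_(e <- L) _.
set lX := ln _; set lY := ln _ => h1 h2 h3.
have h4 : (1 - s) / 2 * X <= (1 - s) / 2 * (lX + S) by apply: ler_wpM2l => //; lra.
have h5 : (1 + s) / 2 * Y <= (1 + s) / 2 * (lY + S) by apply: ler_wpM2l => //; lra.
nra.
Qed.

End General.

Section Moments.
Implicit Types (L : seq (R * R)).

(** Mean and central moments of the total displacement, from those of a centred sign of mean s: 1 -
    s^2, -2 s (1 - s^2) and (1 - s^2)(1 + 3 s^2). The third moment is carried along because the
    fourth moment is computed about an arbitrary centre. [wlen] is the variance without the
    reduction due to the bias. *)
Fixpoint wmean L : R := if L is e :: L' then e.2 * e.1 + wmean L' else 0.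
Fixpoint wvar L : R := if L is e :: L' then e.1 ^+ 2 * (1 - e.2 ^+ 2) + wvar L' else 0.
Fixpoint wm3 L : R :=
  if L is e :: L' then - 2 * e.2 * e.1 ^+ 3 * (1 - e.2 ^+ 2) + wm3 L' else 0.
Fixpoint wm4 L : R :=
  if L is e :: L' then
    e.1 ^+ 4 * (1 - e.2 ^+ 2) * (1 + 3 * e.2 ^+ 2)
      + 6 * (e.1 ^+ 2 * (1 - e.2 ^+ 2)) * wvar L' + wm4 L'
  else 0.
Fixpoint wlen L : R := if L is e :: L' then e.1 ^+ 2 + wlen L' else 0.

Lemma walk_moment2 L c th :
  walk L (fun y => (y - c) ^+ 2) th = (th + wmean L - c) ^+ 2 + wvar L.
Proof.
elim: L th => [|[b s] L IH] th /=; first by rewrite !addr0.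
by rewrite !IH; field.
Qed.

Lemma walk_moment4 L c th :
  walk L (fun y => (y - c) ^+ 4) th =
  (th + wmean L - c) ^+ 4 + 6 * (th + wmean L - c) ^+ 2 * wvar L
    + 4 * (th + wmean L - c) * wm3 L + wm4 L.
Proof.
elim: L th => [|[b s] L IH] th /=; first by rewrite !addr0 !mulr0 !addr0.
by rewrite !IH; field.
Qed.

Lemma wvar_bounds L : bias_ok L -> 0 <= wvar L <= wlen L.
Proof.
elim: L => [|[b s] L IH] /=; first by rewrite lexx.
rewrite ltr_norml -andbA => /and3P[s1 s2 /IH /andP[h1 h2]].
have b2 := sqr_ge0 b; have s2' := sqr_ge0 s.
have h : 0 <= 1 - s ^+ 2 by nra.
by apply/andP; split; nra.
Qed.

Lemma wm4_le L : bias_ok L -> wm4 L <= 4 * wlen L ^+ 2.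
Proof.
elim: L => [|[b s] L IH] /=; first by rewrite expr0n mulr0.
rewrite ltr_norml -andbA => /and3P[s1 s2 Lok].
have /andP[v0 vl] := wvar_bounds Lok; have {IH} := IH Lok.
have -> : b ^+ 4 = (b ^+ 2) ^+ 2 by rewrite -exprM.
set B := b ^+ 2; have B0 : 0 <= B := sqr_ge0 b.
have S1 : s ^+ 2 <= 1 by nra.
move: S1; have := sqr_ge0 s; set S := s ^+ 2 => S0 S1.
have h1 : B ^+ 2 * (1 - S) * (1 + 3 * S) <= 4 * B ^+ 2.
  rewrite -mulrA mulrC; apply: ler_wpM2r; [exact: sqr_ge0|nra].
have h2 : 6 * (B * (1 - S)) * wvar L <= 6 * B * wlen L.
  have h : (1 - S) * wvar L <= wlen L by nra.
  have := ler_wpM2l B0 h; lra.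
have h3 : 0 <= B * wlen L by apply: mulr_ge0 => //; lra.
move=> h4; nra.
Qed.

End Moments.

Section Smoothing.
Context (d : nat) (N : nat) (delta sigma : R) (v : 'cV[R]_d).

(* The endpoint of this walk started at 0 has mean [v] when [N * delta * sigma = 1]. *)
Definition smooth : seq ('cV[R]_d * R) :=
  flatten [seq nseq N (delta *: delta_mx j 0, sigma * v j 0) | j <- enum 'I_d].

Lemma smooth_sum (f : 'cV[R]_d * R -> R) :
  \sum_(e <- smooth) f e = \sum_j N%:R * f (delta *: delta_mx j 0, sigma * v j 0).
Proof.
rewrite /smooth big_flatten big_map big_enum /=; apply: eq_bigr => j _.
by rewrite big_nseq iter_addr_0 mulr_natl.
Qed.

Lemma dotp_smooth (x : 'cV[R]_d) j : dotp x (delta *: delta_mx j 0) = delta * x j 0.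
Proof.
rewrite dotpZr; congr (_ * _); rewrite /dotp (bigD1 j) //= big1 ?addr0.
  by rewrite mxE !eqxx mulr1.
by move=> i ij; rewrite mxE (negbTE ij) mulr0.
Qed.

End Smoothing.

Lemma unbias_smooth d N delta sigma (v : 'cV[R]_d) :
  unbias (smooth N delta sigma v) = smooth N delta sigma 0.
Proof.
rewrite /unbias /smooth map_flatten -map_comp; congr flatten; apply: eq_map => j /=.
by rewrite map_nseq /= mxE mulr0.
Qed.

Lemma wmean_sum L : wmean L = \sum_(e <- L) e.2 * e.1.
Proof. by elim: L => [|e L IH] /=; rewrite ?big_nil // big_cons IH. Qed.

Lemma wvar_sum L : wvar L = \sum_(e <- L) e.1 ^+ 2 * (1 - e.2 ^+ 2).
Proof. by elim: L => [|e L IH] /=; rewrite ?big_nil // big_cons IH. Qed.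

Lemma wlen_sum L : wlen L = \sum_(e <- L) e.1 ^+ 2.
Proof. by elim: L => [|e L IH] /=; rewrite ?big_nil // big_cons IH. Qed.

Section Smoothing_moments.
Context (d : nat) (N : nat) (beta delta sigma : R) (v : 'cV[R]_d).
Hypothesis v1 : norm2 v = 1.
Hypothesis (N0 : (0 < N)%N) (sigma0 : 0 <= sigma) (sigma1 : sigma < 1) (beta0 : 0 < beta).
Hypothesis Nds : N%:R * delta * sigma = 1.
Hypothesis Ndd : N%:R * delta ^+ 2 = beta^-1.
Hypothesis Nss : N%:R * sigma ^+ 2 = beta.

Let L := smooth N delta sigma v.

Lemma coord_le1 j : `|v j 0| <= 1.
Proof.
rewrite -(@ler_pXn2r _ 2) ?nnegrE // expr1n real_normK ?num_real //.
rewrite -(expr1n _ 2) -v1 sqr_norm2 /dotp (bigD1 j) //= -expr2 lerDl.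
by apply: sumr_ge0 => i _; rewrite -expr2 sqr_ge0.
Qed.

Lemma smooth_ok : bias_ok L.
Proof.
rewrite /bias_ok /L /smooth; apply/allP => e /flattenP [s /mapP[j _ ->]].
move=> /nseqP[-> _] /=; rewrite normrM ger0_norm //.
by rewrite (le_lt_trans _ sigma1) // ler_piMr // coord_le1.
Qed.

Lemma smooth_entropy : \sum_(e <- L) e.2 ^+ 2 = beta.
Proof.
rewrite /L smooth_sum /= -Nss -[RHS]mulr1 -(expr1n _ 2) -v1 sqr_norm2.
rewrite mulr_sumr; apply: eq_bigr => j _ /=; ring.
Qed.

(** The exact variance of <x, y> at the endpoint y of the walk. The subtracted term is the effect of
    the bias; it is of order 1 / N, so that many short steps make it negligible. *)
Definition noise (x : 'cV[R]_d) := beta^-1 * dotp x x - N%:R^-1 * \sum_j (x j 0 * v j 0) ^+ 2.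

Let Lx x := [seq (dotp x e.1, e.2) | e <- L].

Lemma smooth_walk_dotp x (F : R -> R) :
  walk L (fun y => F (dotp x y)) 0 = walk (Lx x) F 0.
Proof.
rewrite (walk_comp (l := dotp x)); first by rewrite dotp0r.
  by move=> a b; rewrite dotpDr.
by move=> a b; rewrite dotpBr.
Qed.

Let Lx_ok x : bias_ok (Lx x).
Proof. by move: smooth_ok; rewrite /bias_ok all_map => /allP h; apply/allP => e /h. Qed.

Let mean_Lx x : wmean (Lx x) = dotp x v.
Proof.
rewrite wmean_sum /Lx big_map /L (smooth_sum _ _ _ _ (fun e => e.2 * dotp x e.1)) /=.
apply: eq_bigr => j _; rewrite dotp_smooth.
transitivity (N%:R * delta * sigma * (x j 0 * v j 0)); first ring.
by rewrite Nds mul1r.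
Qed.

Let len_Lx x : wlen (Lx x) = beta^-1 * dotp x x.
Proof.
rewrite wlen_sum /Lx big_map /L (smooth_sum _ _ _ _ (fun e => dotp x e.1 ^+ 2)) /= /dotp mulr_sumr.
apply: eq_bigr => j _; rewrite -/(dotp _ _) dotp_smooth -Ndd; ring.
Qed.

Let var_Lx x : wvar (Lx x) = noise x.
Proof.
rewrite wvar_sum /Lx big_map /L (smooth_sum _ _ _ _ (fun e => dotp x e.1 ^+ 2 * (1 - e.2 ^+ 2))) /=.
rewrite /noise /dotp !mulr_sumr -sumrB.
apply: eq_bigr => j _; rewrite -/(dotp _ _) dotp_smooth.
have -> : N%:R^-1 = N%:R * delta ^+ 2 * sigma ^+ 2 :> R.
  apply: (@mulfI _ N%:R); rewrite ?pnatr_eq0 -?lt0n // divff ?pnatr_eq0 -?lt0n //.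
  transitivity ((N%:R * delta * sigma) ^+ 2); last ring.
  by rewrite Nds expr1n.
rewrite -Ndd; ring.
Qed.

Lemma noise_bounds x : 0 <= noise x <= beta^-1 * dotp x x.
Proof. by rewrite -var_Lx -len_Lx wvar_bounds. Qed.

Lemma noise_ge x : beta^-1 * dotp x x - N%:R^-1 * dotp x x <= noise x.
Proof.
rewrite lerD2l lerN2 ler_wpM2l ?invr_ge0 ?ler0n //; apply: ler_sum => j _.
rewrite exprMn -expr2 ler_piMr ?sqr_ge0 //.
by rewrite -real_normK ?num_real // expr_le1 ?coord_le1.
Qed.

Lemma smooth_moment2 x c :
  walk L (fun y => (dotp x y - c) ^+ 2) 0 = (dotp x v - c) ^+ 2 + noise x.
Proof.
by rewrite (smooth_walk_dotp x (fun y => (y - c) ^+ 2)) walk_moment2 mean_Lx var_Lx add0r.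
Qed.

Lemma smooth_moment4_centered x :
  walk L (fun y => (dotp x y - dotp x v) ^+ 4) 0 <= 4 * (beta^-1 * dotp x x) ^+ 2.
Proof.
rewrite (smooth_walk_dotp x (fun y => (y - dotp x v) ^+ 4)) walk_moment4 mean_Lx add0r subrr.
rewrite !expr0n /= !(mul0r, mulr0, add0r) -len_Lx.
exact: wm4_le.
Qed.

Lemma smooth_moment4 x :
  walk L (fun y => dotp x y ^+ 4) 0 <=
  8 * dotp x v ^+ 4 + 32 * (beta^-1 * dotp x x) ^+ 2.
Proof.
have := smooth_moment4_centered x.
set a := dotp x v => h.
have : walk L (fun y => dotp x y ^+ 4) 0 <=
       walk L (fun y => 8 * a ^+ 4 + 8 * (dotp x y - a) ^+ 4) 0.
  apply: walk_le; first exact: smooth_ok.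
  move=> y; set z := dotp x y - a; have -> : dotp x y = a + z by rewrite /z; ring.
  have -> : 8 * a ^+ 4 + 8 * z ^+ 4 = (a + z) ^+ 4 + (a - z) ^+ 2 * (7 * a ^+ 2 + 10 * a * z + 7 * z ^+ 2).
    ring.
  rewrite lerDl; apply: mulr_ge0; first exact: sqr_ge0.
  have := sqr_ge0 (a + z); have := sqr_ge0 a; have := sqr_ge0 z; nra.
rewrite walkD walk_cst walkZ; lra.
Qed.

End Smoothing_moments.

End Biased_walk.

(** * Operator norm of a sparse sum *)

Section Maurey.
Context (R : realType).

Lemma exists_le_mean (I : finType) (q f : I -> R) (c : R) :
  (forall j, 0 <= q j) -> \sum_j q j = 1 -> \sum_j q j * f j <= c ->
  exists j, f j <= c.
Proof.
move=> q0 q1 qf; apply/existsP; apply: contraT; rewrite negb_exists => /forallP fc.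
have fc' j : c < f j by have := fc j; rewrite -ltNge.
have : 0 <= \sum_j q j * (f j - c) by apply: sumr_ge0 => j _; rewrite mulr_ge0 // subr_ge0 ltW.
have -> : \sum_j q j * (f j - c) = \sum_j q j * f j - c.
  rewrite -[in RHS](mul1r c) -q1 mulr_suml -sumrB; apply: eq_bigr => j _; ring.
move=> h; have {h} /eqP : \sum_j q j * f j - c = 0 by apply/eqP; rewrite eq_le h subr_le0 qf.
have -> : \sum_j q j * f j - c = \sum_j q j * (f j - c).
  rewrite -[in LHS](mul1r c) -q1 mulr_suml -sumrB; apply: eq_bigr => j _; ring.
rewrite psumr_eq0 => [/allP z|j _]; last by rewrite mulr_ge0 // subr_ge0 ltW.
have q0' j : q j = 0.
  have /eqP := z j (mem_index_enum _); move/eqP; rewrite mulf_eq0 => /orP[/eqP//|].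
  by rewrite subr_eq0 gt_eqF.
by move: q1; rewrite big1 ?(eq_sym 0) => [/eqP|j _]; rewrite ?q0' // eq_sym oner_eq0.
Qed.

(* Maurey's empirical method, derandomised: drawing the points one at a time,
   some choice does not exceed the conditional expectation of the cost. *)
Lemma maurey (I K : finType) (q : I -> R) (y : I -> K -> R) (A : K -> R)
    (b : I -> R) (N : nat) :
  (forall j, 0 <= q j) -> \sum_j q j = 1 -> (forall k, 0 <= A k) ->
  exists s : seq I, size s = N /\
    \sum_k A k * (\sum_(j <- s) y j k - N%:R * \sum_j q j * y j k) ^+ 2
      + \sum_(j <- s) b j
    <= N%:R * \sum_j q j * (\sum_k A k * y j k ^+ 2 + b j).
Proof.
move=> q0 q1 A0; elim: N => [|N [s [sN IH]]].
  exists [::]; split=> //; rewrite big_nil addr0 mul0r big1 // => k _.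
  by rewrite big_nil mul0r subr0 expr0n mulr0.
pose m k := \sum_j q j * y j k.
pose S k := \sum_(j <- s) y j k - N%:R * m k.
pose E := \sum_j q j * (\sum_k A k * y j k ^+ 2 + b j).
pose f j := \sum_k A k * (S k + (y j k - m k)) ^+ 2 + (b j + \sum_(i <- s) b i).
have [|j fj] := @exists_le_mean I q f (N.+1%:R * E) q0 q1; last first.
  exists (j :: s); split; first by rewrite /= sN.
  apply: le_trans fj; rewrite /f big_cons lerD2r; apply: ler_sum => k _.
  rewrite big_cons /S -/(m k) le_eqVlt; apply/orP; left; apply/eqP.
  by rewrite -natr1; ring.
apply: (@le_trans _ _ (\sum_k A k * S k ^+ 2 + \sum_(i <- s) b i + E)); last first.
  by rewrite -natr1 mulrDl mul1r lerD2r.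
(* Under the weights q the increments y j - m have mean 0, so the cross terms with S vanish and one
   more draw adds only their variance. *)
have -> : \sum_j q j * f j = \sum_k A k * S k ^+ 2 + \sum_(i <- s) b i + E - \sum_k A k * m k ^+ 2.
  transitivity (\sum_j \sum_k q j * (A k * (S k + (y j k - m k)) ^+ 2) +
                (\sum_j q j * b j + \sum_(i <- s) b i)).
    rewrite -[X in _ + (_ + X)]mul1r -q1 mulr_suml -!big_split /=; apply: eq_bigr => j _.
    by rewrite /f -mulr_sumr; ring.
  have -> : E = \sum_j \sum_k q j * (A k * y j k ^+ 2) + \sum_j q j * b j.
    rewrite -big_split /=; apply: eq_bigr => j _; rewrite mulrDr mulr_sumr //.
  rewrite [\sum_j \sum_k q j * (A k * y j k ^+ 2)]exchange_big /=.
  rewrite [\sum_j \sum_k q j * _]exchange_big /=.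
  set B := \sum_j _ * b j; set B' := \sum_(i <- s) _.
  have -> : \sum_k \sum_j q j * (A k * (S k + (y j k - m k)) ^+ 2) =
    \sum_k A k * S k ^+ 2 + \sum_k \sum_j q j * (A k * y j k ^+ 2) - \sum_k A k * m k ^+ 2.
    rewrite -big_split -sumrB; apply: eq_bigr => k _ /=.
    transitivity (\sum_j (q j * (A k * (S k - m k) ^+ 2) + q j * (A k * y j k ^+ 2)
                    + q j * y j k * (2 * A k * (S k - m k)))).
      by apply: eq_bigr => j _; ring.
    rewrite !big_split /= -!mulr_suml q1 -/(m k); ring.
  ring.
by rewrite gerBl; apply: sumr_ge0 => k _; rewrite mulr_ge0 ?sqr_ge0.
Qed.

End Maurey.

(** * Short signed sums correlated with many vectors *)

Section Sparse.
Import mathcomp.boot.fintype mathcomp.boot.finset.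
Context (R : realType) (d n : nat) (x : 'I_n -> 'cV[R]_d) (I : {set 'I_n}).
Context (lam M2 : R).
Hypothesis lam0 : 0 < lam.
Hypothesis xM : forall i, dotp (x i) (x i) <= M2.
Hypothesis frame : forall u, \sum_(i in I) dotp (x i) u ^+ 2 <= lam * dotp u u.

Let M20 (i : 'I_n) : 0 <= M2.
Proof. by rewrite (le_trans _ (xM i)) // dotpvv_ge0. Qed.

Lemma frame_sub (J : {set 'I_n}) u : J \subset I ->
  \sum_(i in J) dotp (x i) u ^+ 2 <= lam * dotp u u.
Proof.
move=> JI; apply: le_trans (frame u); rewrite [leRHS](big_setID J) /=.
rewrite (setIidPr JI) lerDl; apply: sumr_ge0 => i _; exact: sqr_ge0.
Qed.

(** The map from c to the sum of the c i *: x i is adjoint to the map from u to the (<x_i, u>)_i, so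
    both have the norm given by [frame]. Young's inequality applied to each c i * <x_i, w> proves it
    without square roots. *)
Lemma synthesis_le (J : {set 'I_n}) (c : 'I_n -> R) : J \subset I ->
  dotp (\sum_(i in J) c i *: x i) (\sum_(i in J) c i *: x i) <= lam * \sum_(i in J) c i ^+ 2.
Proof.
move=> JI; set w := \sum_(i in J) _.
have h : 2 * dotp w w <= lam * \sum_(i in J) c i ^+ 2 + lam^-1 * \sum_(i in J) dotp (x i) w ^+ 2.
  rewrite {1}/w dotp_suml !mulr_sumr -big_split /=; apply: ler_sum => i _.
  rewrite dotpZl; set z := dotp (x i) w.
  have -> : lam * c i ^+ 2 + lam^-1 * z ^+ 2 = 2 * (c i * z) + lam^-1 * (lam * c i - z) ^+ 2.
    by field; rewrite gt_eqF.
  by rewrite lerDl; apply: mulr_ge0; [rewrite invr_ge0 ltW|exact: sqr_ge0].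
have h2 : lam^-1 * \sum_(i in J) dotp (x i) w ^+ 2 <= dotp w w.
  by rewrite mulrC ler_pdivrMr // mulrC frame_sub.
lra.
Qed.

Definition signed_sum (s : seq 'I_n) (sg : 'I_n -> bool) : 'cV[R]_d :=
  \sum_(j <- s) (-1) ^+ sg j *: x j.

(** Indices occurring in [s] are excluded because only the vectors absent from the signed sum are
    independent of it. *)
Definition large_set (tau : R) s sg : {set 'I_n} :=
  [set i | (i \notin s) && (tau * norm2 (signed_sum s sg) < `|dotp (x i) (signed_sum s sg)|)].

Section Sampling.
Context (J H : {set 'I_n}) (c : 'I_n -> R) (theta : R) (N : nat).
Hypothesis (JI : J \subset I) (HJ : H \subset J).
Let C1 := \sum_(j in J) `|c j|.
Let w := \sum_(j in J) c j *: x j.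
Hypothesis C1_gt0 : 0 < C1.
Hypothesis N_gt0 : (0 < N)%N.
Hypothesis theta0 : 0 < theta.
Hypothesis w_le : dotp w w <= 4 * lam ^+ 2.
Hypothesis H_gt : forall i, i \in H -> theta < `|dotp (x i) (w - c i *: x i)|.
Hypothesis H_gt0 : (0 < #|H|)%N.
Hypothesis noise1 : 32 * (C1 ^+ 2 * lam * M2) <= #|H|%:R * (N%:R * theta ^+ 2).
Hypothesis noise2 : 8 * (C1 ^+ 2 * M2) <= N%:R * lam ^+ 2.
Hypothesis few : 8 * (N%:R * \sum_(j in H) `|c j|) <= #|H|%:R * C1.

(** Drawing j with probability |c j| / C1 and the sign of c j makes N draws approximate N w / C1. A
    single cost controls three things at once: the correlations with the x i for i in H, the length
    of the sum, and the number of draws that fall in H. The hypotheses [noise1], [noise2] and [few]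
    bound each contribution by |H| / 8, so at most 3/8 of H is spoiled. *)
Lemma sampling : exists s : seq 'I_n, exists sg : 'I_n -> bool,
  size s = N /\ #|H|%:R / 2 <= #|large_set (theta / (6 * lam)) s sg|%:R :> R.
Proof.
pose sg j := c j < 0.
have sgE j : `|c j| * (-1) ^+ sg j = c j.
  rewrite /sg; case: ltP => c0; rewrite ?(ltr0_norm c0) ?(ger0_norm c0) ?expr1 ?expr0; ring.
pose q j := if j \in J then `|c j| / C1 else 0.
have qE (F : 'I_n -> R) : \sum_j q j * F j = C1^-1 * \sum_(j in J) `|c j| * F j.
  rewrite mulr_sumr [RHS]big_mkcond /=; apply: eq_bigr => j _.
  by rewrite /q; case: ifP => _; rewrite ?mul0r //; ring.
have q0 j : 0 <= q j by rewrite /q; case: ifP => // _; rewrite divr_ge0 // ltW.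
have q1 : \sum_j q j = 1.
  under eq_bigr do rewrite -[q _]mulr1.
  by rewrite qE; under eq_bigr do rewrite mulr1; rewrite mulVf // gt_eqF.
pose hh : R := #|H|%:R.
have hh0 : 0 < hh by rewrite ltr0n.
have NR : 0 < N%:R :> R by rewrite ltr0n.
(* Left indices record the correlation with x i, right ones the coordinates of the sum. The diagonal
   j = i is removed so that the mean is <x_i, w - c_i x_i>; for an index that is not drawn nothing
   is lost. *)
pose y (j : 'I_n) (k : 'I_n + 'I_d) : R :=
  match k with
  | inl i => if (i \in H) && (j != i) then C1 * ((-1) ^+ sg j * dotp (x i) (x j)) else 0
  | inr m => C1 * ((-1) ^+ sg j * x j m 0) end.
(* The weights are normalised so that a deviation of N theta / 2 at one index costs 1, and a
   deviation of N lam in Euclidean length costs |H|. *)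
pose A (k : 'I_n + 'I_d) : R :=
  match k with inl _ => 4 / (N%:R ^+ 2 * theta ^+ 2) | inr _ => hh / (N%:R ^+ 2 * lam ^+ 2) end.
pose b (j : 'I_n) : R := (j \in H)%:R.
have A0 k : 0 <= A k.
  by case: k => k /=; rewrite divr_ge0 ?mulr_ge0 ?sqr_ge0 // ltW.
have [s [sN]] := maurey y b N q0 q1 A0.
have C1n : C1 != 0 by rewrite gt_eqF.
have meanl i : i \in H -> \sum_j q j * y j (inl i) = dotp (x i) (w - c i *: x i).
  move=> iH; rewrite qE /= iH /=.
  have -> : w - c i *: x i = \sum_(j in J | j != i) c j *: x j.
    by rewrite /w (bigD1 i (subsetP HJ _ iH)) /= addrAC subrr add0r.
  rewrite dotp_sumr mulr_sumr big_mkcondr; apply: eq_bigr => j _.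
  case: ifP => _; last by rewrite !mulr0.
  by rewrite dotpZr -[in RHS](sgE j); field.
have meanr m : \sum_j q j * y j (inr m) = w m 0.
  rewrite qE /= /w summxE mulr_sumr; apply: eq_bigr => j _.
  by rewrite mxE -[in RHS](sgE j); field.
have sq_sg j : ((-1) ^+ sg j : R) ^+ 2 = 1 by rewrite sqrr_sign.
have cost_le : \sum_j q j * (\sum_k A k * y j k ^+ 2 + b j) <=
   4 / (N%:R ^+ 2 * theta ^+ 2) * (C1 ^+ 2 * lam * M2)
   + hh / (N%:R ^+ 2 * lam ^+ 2) * (C1 ^+ 2 * M2) + C1^-1 * \sum_(j in H) `|c j|.
  rewrite qE.
  have term j : j \in J -> \sum_k A k * y j k ^+ 2 <=
      4 / (N%:R ^+ 2 * theta ^+ 2) * (C1 ^+ 2 * lam * M2)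
      + hh / (N%:R ^+ 2 * lam ^+ 2) * (C1 ^+ 2 * M2).
    move=> jJ; rewrite big_sumType /= -!mulr_sumr.
    apply: lerD; apply: ler_wpM2l; [exact: (A0 (inl j))| |by rewrite divr_ge0 ?mulr_ge0 ?sqr_ge0 // ltW|].
      apply: (@le_trans _ _ (\sum_(i in H) C1 ^+ 2 * dotp (x i) (x j) ^+ 2)).
        rewrite [leRHS]big_mkcond /=; apply: ler_sum => i _.
        case: ifP => [/andP[-> _]|]; first by rewrite !exprMn sq_sg mul1r.
        by case: ifP => _ _; rewrite expr0n //= mulr_ge0 ?sqr_ge0.
      rewrite -mulr_sumr -mulrA ler_wpM2l ?sqr_ge0 //.
      apply: le_trans (frame_sub _ (subset_trans HJ JI)) _.
      by rewrite ler_wpM2l ?xM // ltW.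
    under eq_bigr do rewrite !exprMn sq_sg mul1r.
    rewrite -mulr_sumr ler_wpM2l ?sqr_ge0 //.
    by under eq_bigr do rewrite expr2; exact: xM.
  have -> : C1^-1 * \sum_(j in H) `|c j| = C1^-1 * \sum_(j in J) `|c j| * b j.
    congr (_ * _); rewrite [RHS](big_setID H) /= (setIidPr HJ) [X in _ = _ + X]big1 ?addr0.
      by apply: eq_bigr => j jH; rewrite /b jH mulr1.
    by move=> j; rewrite inE /b => /andP[/negbTE -> _]; rewrite mulr0.
  set D := _ + _ * (C1 ^+ 2 * M2).
  have -> : D = C1^-1 * \sum_(j in J) `|c j| * D by rewrite -mulr_suml -/C1; field.
  rewrite -mulrDr ler_wpM2l ?invr_ge0 ?(ltW C1_gt0) // -big_split /=.
  apply: ler_sum => j jJ; rewrite mulrDr lerD2r ler_wpM2l //; exact: term.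
set D := _ + _ in cost_le.
have ND : N%:R * D <= 3 / 8 * hh.
  have e1 : N%:R * (4 / (N%:R ^+ 2 * theta ^+ 2) * (C1 ^+ 2 * lam * M2)) <= hh / 8.
    have -> : N%:R * (4 / (N%:R ^+ 2 * theta ^+ 2) * (C1 ^+ 2 * lam * M2)) =
      4 * (C1 ^+ 2 * lam * M2) / (N%:R * theta ^+ 2) by field; rewrite !gt_eqF.
    rewrite ler_pdivrMr ?mulr_gt0 ?exprn_gt0 //; move: noise1; rewrite -/hh; lra.
  have e2 : N%:R * (hh / (N%:R ^+ 2 * lam ^+ 2) * (C1 ^+ 2 * M2)) <= hh / 8.
    have -> : N%:R * (hh / (N%:R ^+ 2 * lam ^+ 2) * (C1 ^+ 2 * M2)) =
      hh * (C1 ^+ 2 * M2 / (N%:R * lam ^+ 2)) by field; rewrite !gt_eqF.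
    apply: (ler_wpM2l (ltW hh0)); rewrite ler_pdivrMr ?mulr_gt0 ?exprn_gt0 //; move: noise2; lra.
  have e3 : N%:R * (C1^-1 * \sum_(j in H) `|c j|) <= hh / 8.
    have -> : N%:R * (C1^-1 * \sum_(j in H) `|c j|) = N%:R * (\sum_(j in H) `|c j|) / C1.
      by field.
    rewrite ler_pdivrMr //; move: few; rewrite -/hh; lra.
  rewrite /D !mulrDr; lra.
move=> h; have {h} cost : \sum_k A k * (\sum_(j <- s) y j k - N%:R * \sum_j q j * y j k) ^+ 2 +
    \sum_(j <- s) b j <= 3 / 8 * hh.
  by apply: (le_trans h); apply: le_trans ND; rewrite ler_pM2l.
exists s, sg; split=> //.
pose u := signed_sum s sg.
have uE m : \sum_(j <- s) y j (inr m) = C1 * u m 0.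
  by rewrite /u /signed_sum summxE mulr_sumr; apply: eq_bigr => j _; rewrite mxE.
have iE i : i \in H -> i \notin s -> \sum_(j <- s) y j (inl i) = C1 * dotp (x i) u.
  move=> iH iNs; rewrite /u /signed_sum dotp_sumr mulr_sumr.
  apply: eq_big_seq => j js; rewrite /= iH dotpZr.
  by case: eqVneq => [ji|//]; rewrite -ji js in iNs.
have A10 : 0 <= 4 / (N%:R ^+ 2 * theta ^+ 2) by rewrite divr_ge0 // mulr_ge0 ?sqr_ge0.
have A20 : 0 <= hh / (N%:R ^+ 2 * lam ^+ 2) by rewrite divr_ge0 ?(ltW hh0) // mulr_ge0 ?sqr_ge0.
pose Z1 i := (\sum_(j <- s) y j (inl i) - N%:R * \sum_j q j * y j (inl i)) ^+ 2.
pose Z2 m := (\sum_(j <- s) y j (inr m) - N%:R * \sum_j q j * y j (inr m)) ^+ 2.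
pose S1 := \sum_i 4 / (N%:R ^+ 2 * theta ^+ 2) * Z1 i.
pose S2 := \sum_m hh / (N%:R ^+ 2 * lam ^+ 2) * Z2 m.
pose S3 := \sum_(j <- s) b j.
have {}cost : S1 + S2 + S3 <= 3 / 8 * hh by move: cost; rewrite big_sumType.
have Z10 i : 0 <= Z1 i := sqr_ge0 _.
have S10 : 0 <= S1 by apply: sumr_ge0 => i _; rewrite mulr_ge0.
have S20 : 0 <= S2 by apply: sumr_ge0 => m _; rewrite mulr_ge0 // sqr_ge0.
have S30 : 0 <= S3 by apply: sumr_ge0 => i _; rewrite ler0n.
have S2E : S2 = hh / (N%:R ^+ 2 * lam ^+ 2) * dotp (C1 *: u - N%:R *: w) (C1 *: u - N%:R *: w).
  rewrite /S2 -mulr_sumr; congr (_ * _); apply: eq_bigr => m _.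
  by rewrite /Z2 uE meanr !mxE expr2.
have u_le : C1 * norm2 u <= 3 * (N%:R * lam).
  have dev : norm2 (C1 *: u - N%:R *: w) <= N%:R * lam.
    rewrite -(@ler_pXn2r _ 2) ?nnegrE ?norm2_ge0 ?mulr_ge0 ?(ltW NR) ?(ltW lam0) // sqr_norm2.
    have : S2 <= hh by lra.
    rewrite S2E mulrAC ler_pdivrMr ?mulr_gt0 ?exprn_gt0 // ler_pM2l // exprMn //.
  have Nw : norm2 (N%:R *: w) <= 2 * (N%:R * lam).
    rewrite norm2Z ger0_norm ?ler0n // mulrCA ler_pM2l //.
    rewrite -(@ler_pXn2r _ 2) ?nnegrE ?norm2_ge0 ?mulr_ge0 ?(ltW lam0) // sqr_norm2 exprMn; move: w_le; lra.
  have := ler_norm2D (C1 *: u - N%:R *: w) (N%:R *: w).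
  rewrite subrK (norm2Z C1) (gtr0_norm C1_gt0); lra.
pose bad := [set i in H | (i \in s) || (N%:R * theta / 2 <= `|C1 * dotp (x i) u - N%:R * dotp (x i) (w - c i *: x i)|)].
have bad_le : #|bad|%:R <= S1 + S3.
  have S3E : S3 = \sum_(i in H) (count_mem i s)%:R.
    rewrite /S3 /b; elim: (s) => [|j s' IH]; first by rewrite big_nil big1.
    rewrite big_cons IH; under [RHS]eq_bigr do rewrite /= natrD.
    rewrite big_split /=; congr (_ + _).
    case: (boolP (j \in H)) => jH.
      rewrite (bigD1 j) //= eqxx big1 ?addr0 // => i /andP[_ /negbTE].
      by rewrite eq_sym => ->.
    by rewrite big1 // => i iH; case: eqVneq => // ji; rewrite ji iH in jH.
  apply: (@le_trans _ _ (\sum_(i in H) (4 / (N%:R ^+ 2 * theta ^+ 2) * Z1 i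
      + (count_mem i s)%:R))); last first.
    rewrite big_split /= S3E lerD2r /S1 [leRHS](bigID (mem H)) /= lerDl.
    by apply: sumr_ge0 => i _; rewrite mulr_ge0.
  rewrite -sum1_card natr_sum [leRHS](big_setID bad) /=.
  have -> : H :&: bad = bad by apply/setIidPr/subsetP => i; rewrite inE => /andP[].
  rewrite -[leLHS]addr0; apply: lerD; last first.
    by apply: sumr_ge0 => i _; exact: addr_ge0 (mulr_ge0 A10 (Z10 i)) (ler0n _ _).
  apply: ler_sum => i; rewrite inE => /andP[iH ibad].
  have [is_|iNs] := boolP (i \in s).
    apply: (@le_trans _ _ (count_mem i s)%:R).
      by rewrite ler1n -has_count has_pred1.
    by rewrite lerDr mulr_ge0.
  move: ibad; rewrite (negbTE iNs) /= => ibad.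
  apply: ler_wpDr; first by rewrite ler0n.
  rewrite /Z1 meanl // iE // mulrAC ler_pdivlMr ?mulr_gt0 ?exprn_gt0 // mul1r.
  have Nt : 0 <= N%:R * theta / 2 by rewrite divr_ge0 ?mulr_ge0 ?(ltW theta0) ?(ltW NR).
  move: ibad; rewrite -(@ler_pXn2r _ 2) ?nnegrE // real_normK ?num_real //; lra.
have good : H :\: bad \subset large_set (theta / (6 * lam)) s sg.
  apply/subsetP => i; rewrite !inE => /andP[+ iH]; rewrite iH /= negb_or -ltNge => /andP[iNs idev].
  rewrite iNs /= -/u.
  (* Half of theta survives, whereas C1 |u| <= 3 N lam: their ratio is theta / (6 lam). *)
  have tc : N%:R * theta / 2 < C1 * `|dotp (x i) u|.
    have := H_gt iH; rewrite -(ltr_pM2l NR) => h1.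
    rewrite -(gtr0_norm C1_gt0) -normrM.
    have : `|N%:R * dotp (x i) (w - c i *: x i)| <= `|C1 * dotp (x i) u| +
      `|C1 * dotp (x i) u - N%:R * dotp (x i) (w - c i *: x i)|.
      rewrite -[X in `|X| <= _](subKr (C1 * dotp (x i) u)).
      exact: ler_normB.
    rewrite [`|N%:R * _|]normrM (gtr0_norm NR); lra.
  rewrite -(ltr_pM2l C1_gt0); apply: le_lt_trans tc.
  rewrite mulrCA mulrAC ler_pdivrMr ?mulr_gt0 //.
  have := ler_wpM2l (ltW theta0) u_le; lra.
apply: (@le_trans _ _ #|H :\: bad|%:R); last by rewrite ler_nat subset_leq_card.
have := cardsID bad H; have -> : H :&: bad = bad by apply/setIidPr/subsetP => i; rewrite inE => /andP[].
move=> /(congr1 (fun k : nat => k%:R : R)); rewrite natrD -/hh; lra.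
Qed.

End Sampling.

(** * Discarding the hits, level by level *)

Section Levels.
Context (a : 'I_n -> R) (e0 : R).
Hypothesis energy : \sum_(i in I) a i ^+ 2 <= lam.
Hypothesis e00 : 0 <= e0.

Section One_level.
Context (t e1 alpha delta c : R) (G : {set 'I_n}).
Hypothesis (t0 : 0 < t) (e10 : 0 <= e1) (alpha0 : 0 < alpha) (delta0 : 0 < delta) (c0 : 0 < c).
Hypothesis alpha1 : alpha <= 1 / 32.
Hypothesis snr1 : 32 * M2 <= delta * alpha * c ^+ 2 * lam.
Hypothesis snr2 : 16 * M2 <= alpha * lam.
Hypothesis (GI : G \subset I) (G_large : forall i, i \in G -> 2 * t <= `|a i|).
Let B := [set i in I | (t <= `|a i|) && (`|a i| < 2 * t)].
Let w := 2 *: (\sum_(i in G) a i *: x i) + \sum_(i in B) a i *: x i.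
Let H := [set i in B | c * t * lam < `|dotp (x i) (w - a i *: x i)|].
Hypothesis hits : forall s sg, (size s <= n)%N ->
  #|large_set (c * t / 6) s sg|%:R <= e0 * (size s)%:R + e1.

(** Either |H| is small for a trivial reason (alpha C1 < t, more than n draws would be required, or
    |H| t < delta C1), or about alpha C1 / t draws produce a large set of size |H| / 2, and [hits]
    bounds |H| by 2 (e0 N + e1). With alpha <= 1/32 this number of draws is low enough for the
    expected number falling in H to be at most |H| / 8. *)
Lemma level_hits :
  #|H|%:R * t <= ((4 + 8 * e0) * alpha + 2 * delta) * \sum_(i in I | t <= `|a i|) `|a i|
                 + (2 * e1 + alpha^-1) * t.
Proof.
set A := \sum_(i in I | _) _.
have A0 : 0 <= A by apply: sumr_ge0.
pose J := G :|: B.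
pose cc i := if i \in G then 2 * a i else a i.
pose C1 := \sum_(j in J) `|cc j|.
have GB i : i \in G -> i \notin B.
  by move=> /G_large iG; rewrite !inE; apply/negP => /and3P[_ _]; rewrite ltNge iG.
have JG : J :&: G = G by apply/setIidPr; exact: subsetUl.
have JB : J :\: G = B.
  apply/setP => i; rewrite in_setD in_setU; case: (boolP (i \in G)) => //= iG.
  by apply/esym/negbTE/GB.
have splitJ (V : nmodType) (F : 'I_n -> V) :
    \sum_(i in J) F i = \sum_(i in G) F i + \sum_(i in B) F i.
  by rewrite (big_setID G) /= JG JB.
have ccB i : i \in B -> cc i = a i.
  by move=> iB; rewrite /cc; case: ifP => // /GB; rewrite iB.
have JI : J \subset I.
  rewrite subUset GI /=; apply/subsetP => i; rewrite inE => /andP[] //.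
have Jt i : i \in J -> t <= `|a i|.
  rewrite in_setU => /orP[/G_large|]; first by move: t0; lra.
  by rewrite inE => /and3P[].
have wE : w = \sum_(j in J) cc j *: x j.
  rewrite splitJ /w scaler_sumr; congr (_ + _); apply: eq_bigr => i iG.
    by rewrite /cc iG scalerA.
  by rewrite ccB.
have cc_le i : `|cc i| <= 2 * `|a i|.
  rewrite /cc; case: ifP => _; first by rewrite normrM ger0_norm.
  by have := normr_ge0 (a i); lra.
have C1A : C1 <= 2 * A.
  rewrite mulr_sumr /C1 big_mkcond [leRHS]big_mkcond /=; apply: ler_sum => i _.
  case: (boolP (i \in J)) => iJ; last by case: ifP => // _; rewrite mulr_ge0.
  by rewrite (subsetP JI _ iJ) Jt.
have C1t : C1 * t <= 2 * lam.
  apply: (le_trans (ler_wpM2r (ltW t0) C1A)); rewrite -mulrA ler_pM2l //.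
  apply: le_trans energy; rewrite mulr_suml big_mkcondr /=.
  apply: ler_sum => i iI; case: ifP => [ti|_]; last exact: sqr_ge0.
  by rewrite -(real_normK (num_real (a i))) expr2 ler_wpM2l.
have HB : H \subset B by apply/subsetP => i; rewrite inE => /andP[].
have HJ : H \subset J by apply: subset_trans HB _; exact: subsetUr.
have hC1 : #|H|%:R * t <= C1.
  rewrite -sum1_card natr_sum mulr_suml /C1 [leRHS](big_setID H) /= (setIidPr HJ).
  apply: ler_wpDr; first by apply: sumr_ge0.
  apply: ler_sum => i iH; rewrite mul1r ccB ?(subsetP HB) //.
  by apply: Jt; apply: (subsetP HJ).
have h0 : 0 <= #|H|%:R :> R by rewrite ler0n.
have aA : 0 <= alpha * A by rewrite mulr_ge0 // ltW.
have eaA : 0 <= e0 * (alpha * A) by rewrite mulr_ge0.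
have dA : 0 <= delta * A by rewrite mulr_ge0 // ltW.
have e1t : 0 <= e1 * t by rewrite mulr_ge0 // ltW.
have at0 : 0 <= alpha^-1 * t by rewrite mulr_ge0 ?invr_ge0 // ltW.
have [H0|Hn0] := posnP #|H|; first by rewrite H0 mul0r; nra.
have C1_gt0 : 0 < C1.
  by apply: lt_le_trans hC1; rewrite mulr_gt0 // ltr0n.
have aC1 : alpha * C1 <= 2 * (alpha * A) by rewrite mulrCA ler_pM2l.
have [small|big] := ltP (alpha * C1) t.
  have : #|H|%:R * t <= alpha^-1 * t.
    by apply: le_trans hC1 _; rewrite mulrC ler_pdivlMr // mulrC ltW.
  nra.
pose z := alpha * C1 / t.
have z1 : 1 <= z by rewrite /z ler_pdivlMr // mul1r.
pose N := (Num.truncn z).+1.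
have /andP[Nz1 Nz2] := truncn_itv (le_trans ler01 z1).
have NR : z < N%:R := Nz2.
have N2z : N%:R <= 2 * z.
  by rewrite /N -natr1; lra.
have ztE : z * t = alpha * C1 by rewrite /z divfK // gt_eqF.
have Nt : N%:R * t <= 2 * (alpha * C1) by rewrite -ztE mulrA ler_pM2r.
have NRt : alpha * C1 <= N%:R * t by rewrite -ztE ler_pM2r // ltW.
have [Nn|nN] := leqP N n; last first.
  have : #|H|%:R * t <= N%:R * t.
    rewrite ler_pM2r // ler_nat ltnW // (leq_ltn_trans _ nN) //.
    by rewrite (leq_trans (max_card _)) // card_ord.
  nra.
have [few|many] := ltP (#|H|%:R * t) (delta * C1).
  have dC1 : delta * C1 <= 2 * (delta * A) by rewrite mulrCA ler_pM2l.
  nra.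
have C1l : C1 <= C1 by [].
have cl0 : 0 < c * t * lam by rewrite !mulr_gt0.
have wl : dotp w w <= 4 * lam ^+ 2.
  rewrite wE; apply: le_trans (synthesis_le _ JI) _.
  have : \sum_(i in J) cc i ^+ 2 <= 4 * lam.
    apply: le_trans (ler_wpM2l _ energy) => //.
    rewrite mulr_sumr [leRHS](big_setID J) /= (setIidPr JI).
    apply: ler_wpDr; first by apply: sumr_ge0 => i _; rewrite mulr_ge0 ?sqr_ge0.
    apply: ler_sum => i _; have := sqr_le_norm (cc_le i).
    rewrite exprMn real_normK ?num_real //; lra.
  move=> h; apply: le_trans (ler_wpM2l (ltW lam0) h) _; lra.
have M2p i : i \in H -> 0 <= M2 by move=> _; exact: M20 i.
have M2p' : 0 <= M2 by have /card_gt0P[i iH] := Hn0; exact: M2p iH.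
have [s [sg [sN good]]] : exists s : seq 'I_n, exists sg : 'I_n -> bool,
    size s = N /\ #|H|%:R / 2 <= #|large_set (c * t * lam / (6 * lam)) s sg|%:R :> R.
  apply: (@sampling J H cc (c * t * lam) N JI HJ) => //.
  - by rewrite -wE.
  - move=> i iH; rewrite -wE ccB ?(subsetP HB) //.
    by move: iH; rewrite inE => /andP[].
  - rewrite -/C1.
    have h1 : delta * C1 * (alpha * C1) <= (#|H|%:R * t) * (N%:R * t).
      by apply: ler_pM => //; apply: mulr_ge0; exact: ltW.
    have h2 : 32 * (C1 ^+ 2 * lam * M2) <= (delta * C1 * (alpha * C1)) * (c ^+ 2 * lam ^+ 2).
      have -> : delta * C1 * (alpha * C1) * (c ^+ 2 * lam ^+ 2) = (C1 ^+ 2 * lam) * (delta * alpha * c ^+ 2 * lam) by ring.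
      have -> : 32 * (C1 ^+ 2 * lam * M2) = (C1 ^+ 2 * lam) * (32 * M2) by ring.
      by apply: ler_wpM2l => //; rewrite mulr_ge0 ?sqr_ge0 // ltW.
    apply: le_trans h2 _.
    have -> : #|H|%:R * (N%:R * (c * t * lam) ^+ 2) = (#|H|%:R * t) * (N%:R * t) * (c ^+ 2 * lam ^+ 2) by ring.
    by apply: ler_wpM2r => //; rewrite mulr_ge0 ?sqr_ge0.
  - rewrite -/C1 -(ler_pM2r t0) -(ler_pM2r alpha0).
    have h1 : (alpha * C1) * lam ^+ 2 <= (N%:R * t) * lam ^+ 2 by rewrite ler_wpM2r ?sqr_ge0.
    have h2 : 8 * (C1 * M2) * (C1 * t) <= 8 * (C1 * M2) * (2 * lam).
      by apply: ler_wpM2l => //; rewrite !mulr_ge0 // ltW.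
    have h3 : (C1 * lam) * (16 * M2) <= (C1 * lam) * (alpha * lam).
      by apply: ler_wpM2l => //; rewrite mulr_ge0 // ltW.
    have h4 := ler_wpM2l (ltW alpha0) h1.
    have h5 := ler_wpM2l (ltW alpha0) h2.
    have h6 := ler_wpM2l (ltW alpha0) h3.
    nra.
  - rewrite -/C1.
    have h1 : \sum_(j in H) `|cc j| <= #|H|%:R * (2 * t).
      rewrite -sum1_card natr_sum mulr_suml; apply: ler_sum => i iH.
      rewrite ccB ?(subsetP HB) // mul1r ltW //.
      by move: (subsetP HB _ iH); rewrite inE => /and3P[].
    have h2 := ler_wpM2l (ler0n R N) h1.
    have h3 : #|H|%:R * (N%:R * t) <= #|H|%:R * (2 * (alpha * C1)) by rewrite ler_wpM2l.
    have h4 : #|H|%:R * C1 * alpha <= #|H|%:R * C1 * (1 / 32).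
      by apply: ler_wpM2l => //; rewrite mulr_ge0 // ltW.
    nra.
have := @hits s sg; rewrite sN => /(_ Nn).
have -> : c * t / 6 = c * t * lam / (6 * lam) by field; rewrite gt_eqF.
move=> hit; have : #|H|%:R / 2 <= e0 * N%:R + e1 by apply: le_trans good hit.
move=> /(ler_wpM2r (ltW t0)).
have := ler_wpM2l e00 Nt; nra.
Qed.

End One_level.

Context (t0 : R) (m : nat) (e1 : nat -> R).
Hypothesis t00 : 0 < t0.
Hypothesis e10 : forall j, 0 <= e1 j.
Hypothesis a_le : forall i, `|a i| < t0 * 2 ^+ m.
Let tt j := t0 * 2 ^+ j.
(** Both (4 + 8 e0) alpha and 2 delta are at most 1/2048. As the sum of the [tt j * Ab j] is at most
    2 lam, this part of the discarded energy is at most 4 (2 lam) / 1024 = lam / 128. *)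
Let alpha : R := (128 * 128 * (1 + e0))^-1.
Let delta : R := (64 * 64)^-1.
Let c : R := 32^-1.
Hypothesis snr : 32 * 1024 / (delta * alpha) * M2 <= lam.
Hypothesis hits : forall j s sg, (j < m)%N -> (size s <= n)%N ->
  #|large_set (c * tt j / 6) s sg|%:R <= e0 * (size s)%:R + e1 j.

Let tt0 j : 0 < tt j. Proof. by rewrite mulr_gt0 // exprn_gt0. Qed.
Let alpha0 : 0 < alpha. Proof. by rewrite invr_gt0 !mulr_gt0 //; move: e00; lra. Qed.
Let delta0 : 0 < delta. Proof. by rewrite invr_gt0 mulr_gt0. Qed.
Let Lv k := [set i in I | tt k <= `|a i|].
Let Ab j := \sum_(i in I | tt j <= `|a i|) `|a i|.
Let cost j := ((4 + 8 * e0) * alpha + 2 * delta) * (tt j * Ab j) + (2 * e1 j + alpha^-1) * tt j ^+ 2.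

Let M2_le : 32 * M2 <= delta * alpha * c ^+ 2 * lam.
Proof.
have da : 0 < delta * alpha by rewrite mulr_gt0.
have h : 32 * 1024 * M2 <= delta * alpha * lam.
  have -> : 32 * 1024 * M2 = delta * alpha * (32 * 1024 / (delta * alpha) * M2).
    by field; rewrite !gt_eqF.
  by rewrite ler_pM2l.
have -> : delta * alpha * c ^+ 2 * lam = (delta * alpha * lam) / 1024 by rewrite /c; field.
lra.
Qed.

Let alpha_le : alpha <= 1 / 32.
Proof.
rewrite /alpha div1r lef_pV2 ?posrE //; last by rewrite !mulr_gt0 //; move: e00; lra.
move: e00; lra.
Qed.

Let M2_le' : 16 * M2 <= alpha * lam.
Proof.
have al : 0 < alpha * lam by rewrite mulr_gt0.
move: M2_le; rewrite /delta /c.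
move: al; set u := alpha * lam => u0 h.
have : (64 * 64)^-1 * alpha * 32^-1 ^+ 2 * lam <= 1 / 1024 * u by rewrite /u; move: u0; rewrite /u; lra.
lra.
Qed.

(** The factor 2 in w = 2 W + X + XH, with W the part kept above, X the kept part of the level and
    XH its hits, is explained by |W + X|^2 = |W|^2 + <X, w> - <X, XH>. As X consists of indices that
    are no hits, <X, w> is at most (lam / 32 + M2) times the energy of the level; the last product
    is charged to the discarded energy, up to lam / 8 times that of the level. Hence 5/32 = 1/32 +
    1/8. *)
Lemma kept_part k : (k <= m)%N -> exists G : {set 'I_n},
  [/\ G \subset Lv k,
      \sum_(i in Lv k :\: G) a i ^+ 2 <= 4 * \sum_(k <= j < m) cost j &
      dotp (\sum_(i in G) a i *: x i) (\sum_(i in G) a i *: x i) <=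
      (5 / 32 * lam + M2) * \sum_(i in Lv k) a i ^+ 2
      + 2 * lam * \sum_(i in Lv k :\: G) a i ^+ 2].
Proof.
move=> km; rewrite -(subnKC km); move: (m - k)%N (subnKC km) => q.
elim: q k {km} => [|q IH] k kq.
  rewrite addn0 in kq *; exists set0; rewrite big_geq // mulr0.
  have -> : Lv k = set0.
    by apply/setP => i; rewrite !inE kq leNgt a_le andbF.
  by rewrite setD0 !big_set0 !mulr0 addr0 dotp0l.
have km : (k < m)%N by rewrite -kq addnS ltnS leq_addr.
have [|G [GL EG WG]] := IH k.+1; first by rewrite addSnnS.
pose B := [set i in I | (tt k <= `|a i|) && (`|a i| < 2 * tt k)].
have ttS : tt k.+1 = 2 * tt k by rewrite /tt exprS mulrCA.
have GI : G \subset I by apply: subset_trans GL _; apply/subsetP => i; rewrite inE => /andP[].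
have Gl i : i \in G -> 2 * tt k <= `|a i|.
  by move=> /(subsetP GL); rewrite inE ttS => /andP[].
pose W := \sum_(i in G) a i *: x i.
pose w := 2 *: W + \sum_(i in B) a i *: x i.
pose H := [set i in B | c * tt k * lam < `|dotp (x i) (w - a i *: x i)|].
have c0 : 0 < c by rewrite invr_gt0.
have hb := @level_hits (tt k) (e1 k) alpha delta c G (tt0 k) (e10 k) alpha0 delta0 c0
  alpha_le M2_le M2_le' GI Gl (fun s sg => @hits k s sg km).
rewrite -/B -/W -/w -/H -/(Ab k) in hb.
have HB : H \subset B by apply/subsetP => i; rewrite inE => /andP[].
have EH : \sum_(i in H) a i ^+ 2 <= 4 * cost k.
  apply: (@le_trans _ _ (4 * (tt k * (#|H|%:R * tt k)))).
    rewrite -sum1_card natr_sum mulr_suml !mulr_sumr; apply: ler_sum => i /(subsetP HB).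
    rewrite inE => /and3P[_ _ /ltW /sqr_le_norm]; lra.
  rewrite ler_pM2l //; apply: le_trans (ler_wpM2l (ltW (tt0 k)) hb) _.
  rewrite le_eqVlt; apply/orP; left; apply/eqP; rewrite /cost; ring.
pose G' := G :|: (B :\: H).
have GB i : i \in G -> i \notin B.
  by move=> /Gl iG; rewrite !inE; apply/negP => /and3P[_ _]; rewrite ltNge iG.
have LvE i : (i \in Lv k) = (i \in Lv k.+1) || (i \in B).
  rewrite !inE ttS; case: (i \in I) => //=; case: (ltP `|a i| (2 * tt k)) => h /=.
    by rewrite andbT.
  by rewrite (le_trans _ h) //; have := tt0 k; lra.
have LB i : i \in Lv k.+1 -> i \notin B.
  rewrite !inE ttS => /andP[_ h]; apply/negP => /and3P[_ _]; by rewrite ltNge h.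
exists G'; rewrite addnS.
have E1 : \sum_(i in Lv k :\: G') a i ^+ 2 = \sum_(i in Lv k.+1 :\: G) a i ^+ 2 + \sum_(i in H) a i ^+ 2.
  rewrite (big_setID H) /= addrC; congr (_ + _); apply: eq_bigl => i.
    rewrite !in_setD LvE in_setU in_setD.
    case: (boolP (i \in H)) => iH /=.
      by have := LB i; rewrite (subsetP HB _ iH); case: (i \in Lv _) => [/(_ isT)|]; rewrite ?andbF.
    case: (boolP (i \in B)) => iB /=; first by rewrite orbT /=; apply/esym/negbTE; apply/negP => /andP[_ /LB]; rewrite iB.
    by rewrite !orbF.
  rewrite in_setI in_setD LvE in_setU in_setD.
  case: (boolP (i \in H)) => iH /=; last by rewrite andbF.
  rewrite (subsetP HB _ iH) orbT orbF !andbT; apply/negP => /GB.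
  by rewrite (subsetP HB _ iH).
have E2 : \sum_(i in Lv k) a i ^+ 2 = \sum_(i in Lv k.+1) a i ^+ 2 + \sum_(i in B) a i ^+ 2.
  rewrite (big_setID B) /= addrC; congr (_ + _); apply: eq_bigl => i.
    by rewrite in_setD LvE; case: (boolP (i \in Lv k.+1)) => [/LB ->//|_]; case: (i \in B).
  by rewrite in_setI LvE; case: (i \in B); rewrite ?orbT ?andbF.
have W'E : \sum_(i in G') a i *: x i = W + \sum_(i in B :\: H) a i *: x i.
  rewrite (big_setID G) /=; congr (_ + _); apply: eq_bigl => i.
    by rewrite in_setI in_setU; case: (i \in G); rewrite ?andbF.
  rewrite in_setD in_setU in_setD; case: (boolP (i \in G)) => //= /GB /negbTE ->.
  by rewrite andbF.
split.
- apply/subsetP => i; rewrite LvE in_setU in_setD => /orP[/(subsetP GL) ->//|/andP[_ ->]].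
  by rewrite orbT.
- rewrite E1 big_ltn ?ltnS ?leq_addr // mulrDr [leRHS]addrC.
  by rewrite addSn in EG; exact: lerD.
pose X := \sum_(i in B :\: H) a i *: x i.
pose XH := \sum_(i in H) a i *: x i.
have BI : B \subset I by apply/subsetP => i; rewrite inE => /andP[].
have BHI : B :\: H \subset I by apply: subset_trans (subsetDl _ _) BI.
have wE : w = 2 *: W + X + XH.
  rewrite /w -addrA; congr (_ + _); rewrite (big_setID H) /= (setIidPr HB) addrC //.
set sB := \sum_(i in B) a i ^+ 2 in E2.
set sH := \sum_(i in H) a i ^+ 2 in E1 EH.
have sBH : \sum_(i in B :\: H) a i ^+ 2 <= sB.
  rewrite /sB [leRHS](big_setID H) /= (setIidPr HB) lerDr.
  by apply: sumr_ge0 => i _; exact: sqr_ge0.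
have XX : dotp X X <= lam * sB.
  by apply: le_trans (synthesis_le _ BHI) _; rewrite ler_pM2l.
have XHH : dotp XH XH <= lam * sH.
  by apply: synthesis_le; apply: subset_trans HB BI.
have Xw : dotp X w <= (c * lam + M2) * sB.
  rewrite /X dotp_suml; apply: (@le_trans _ _ (\sum_(i in B :\: H) (c * lam + M2) * a i ^+ 2)).
    apply: ler_sum => i; rewrite in_setD inE => /andP[+ iB]; rewrite iB /= -leNgt => hi.
    rewrite dotpZl; have -> : dotp (x i) w = dotp (x i) (w - a i *: x i) + a i * dotp (x i) (x i).
      by rewrite dotpBr dotpZr subrK.
    have ti : tt k <= `|a i| by move: iB; rewrite inE => /and3P[].
    rewrite mulrDr mulrDl; apply: lerD.
      apply: le_trans (ler_norm _) _; rewrite normrM -real_normK ?num_real // expr2.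
      rewrite [leRHS]mulrCA ler_wpM2l //; apply: le_trans hi _.
      rewrite mulrAC; apply: ler_wpM2l ti; apply: ltW; exact: mulr_gt0.
    rewrite mulrA -expr2 mulrC ler_wpM2r ?sqr_ge0 //.
  rewrite -mulr_sumr; have [B0|[i _]] := set_0Vmem B.
    by rewrite /sB B0 set0D !big_set0.
  by rewrite ler_wpM2l // addr_ge0 ?(M20 i) // mulr_ge0 ?(ltW c0) ?(ltW lam0).
rewrite W'E -/X E1 E2.
have -> : dotp (W + X) (W + X) = dotp W W + dotp X w - dotp X XH.
  rewrite wE !(dotpDl, dotpDr, dotpZl, dotpZr) (dotpC W X); ring.
have cross : - dotp X XH <= 1 / 8 * dotp X X + 2 * dotp XH XH.
  have := dotpvv_ge0 (1 / 4 *: X + XH); rewrite !(dotpDl, dotpDr, dotpZl, dotpZr) (dotpC XH X); lra.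
rewrite -/W in WG.
have cE : c = 32^-1 by [].
rewrite cE in Xw; nra.
Qed.

Let sum_levels_le y k : 0 <= y ->
  \sum_(0 <= j < k | tt j <= y) tt j <= 2 * y /\ \sum_(0 <= j < k | tt j <= y) tt j <= tt k.
Proof.
move=> y0; elim: k => [|k [IH1 IH2]].
  by rewrite big_geq // mulr_ge0 // ltW.
have ttS : tt k.+1 = 2 * tt k by rewrite /tt exprS mulrCA.
rewrite big_mkcond big_nat_recr //= -big_mkcond /= ttS.
have := tt0 k; case: ifP => h tk; split; lra.
Qed.

Let sum_levels_energy : \sum_(0 <= j < m) tt j * Ab j <= 2 * lam.
Proof.
have -> : \sum_(0 <= j < m) tt j * Ab j =
    \sum_(i in I) `|a i| * \sum_(0 <= j < m | tt j <= `|a i|) tt j.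
  under eq_bigr do rewrite mulr_sumr big_mkcondr /=.
  rewrite exchange_big /=; apply: eq_bigr => i iI.
  rewrite mulr_sumr [RHS]big_mkcond /=; apply: eq_bigr => j _.
  by case: ifP => // _; rewrite mulrC.
apply: le_trans (ler_wpM2l _ energy) => //; rewrite mulr_sumr; apply: ler_sum => i _.
have [h _] := sum_levels_le m (normr_ge0 (a i)).
apply: le_trans (ler_wpM2l (normr_ge0 _) h) _.
by rewrite mulrCA -expr2 real_normK ?num_real.
Qed.

(** The kept part has norm at most lam / 2; the discarded hits and the coefficients below t0
    together have energy at most lam / 64, hence norm at most lam / 8. What matters is that 5/8 <
    1. *)
Lemma synthesis_contract :
  4 * (\sum_(0 <= j < m) (2 * e1 j + alpha^-1) * tt j ^+ 2) + #|I|%:R * t0 ^+ 2 <= lam / 128 ->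
  norm2 (\sum_(i in I) a i *: x i) <= 5 / 8 * lam.
Proof.
move=> small; have [G [GL EG WG]] := kept_part (leq0n m).
set E := \sum_(i in Lv 0 :\: G) _ in EG WG.
have GI : G \subset I by apply: subset_trans GL _; apply/subsetP => i; rewrite inE => /andP[].
have LI : Lv 0 \subset I by apply/subsetP => i; rewrite inE => /andP[].
have rate : (4 + 8 * e0) * alpha + 2 * delta <= 1 / 1024.
  have -> : (4 + 8 * e0) * alpha = (4 + 8 * e0) / (1 + e0) / (128 * 128).
    by rewrite /alpha; field; apply/negP => /eqP h; move: e00; lra.
  have h : (4 + 8 * e0) / (1 + e0) <= 8 by rewrite ler_pdivrMr; move: e00; lra.
  rewrite /delta; lra.
have E_le : E <= lam / 128 + 4 * (\sum_(0 <= j < m) (2 * e1 j + alpha^-1) * tt j ^+ 2).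
  apply: (le_trans EG); rewrite /cost big_split /= -mulr_sumr.
  have h : ((4 + 8 * e0) * alpha + 2 * delta) * (\sum_(0 <= j < m) tt j * Ab j) <= 1 / 1024 * (2 * lam).
    apply: ler_pM => //; last by apply: sumr_ge0 => j _; rewrite mulr_ge0 ?(ltW (tt0 _)) // sumr_ge0.
    by rewrite addr_ge0 ?mulr_ge0 ?(ltW alpha0) ?(ltW delta0) ?addr_ge0 ?mulr_ge0.
  lra.
have low : \sum_(i in I :\: Lv 0) a i ^+ 2 <= #|I|%:R * t0 ^+ 2.
  apply: (@le_trans _ _ (\sum_(i in I) t0 ^+ 2)); last by rewrite sumr_const mulr_natl.
  rewrite [leRHS](big_setID (Lv 0)) /=; apply: ler_wpDl.
    by apply: sumr_ge0 => i _; exact: sqr_ge0.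
  apply: ler_sum => i; rewrite inE => /andP[+ iI]; rewrite inE iI /= -ltNge.
  by rewrite /tt expr0 mulr1 => /ltW; exact: sqr_le_norm.
have rest : dotp (\sum_(i in I :\: G) a i *: x i) (\sum_(i in I :\: G) a i *: x i) <= lam * (lam / 64).
  apply: le_trans (synthesis_le a (subsetDl _ _)) _; rewrite ler_pM2l //.
  have -> : \sum_(i in I :\: G) a i ^+ 2 = E + \sum_(i in I :\: Lv 0) a i ^+ 2.
    rewrite (big_setID (Lv 0)) /=; congr (_ + _); apply: eq_bigl => i.
      rewrite !in_setI !in_setD; case: (boolP (i \in Lv 0)) => [/(subsetP LI) ->|_]; last by rewrite !andbF.
      by rewrite !andbT.
    rewrite !in_setD; case: (boolP (i \in Lv 0)) => //= iL.
    by case: (boolP (i \in G)) => // /(subsetP GL); rewrite (negbTE iL).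
  lra.
have E0 : 0 <= E by apply: sumr_ge0 => i _; exact: sqr_ge0.
have low0 : 0 <= #|I|%:R * t0 ^+ 2 by rewrite mulr_ge0 ?sqr_ge0.
have kept : dotp (\sum_(i in G) a i *: x i) (\sum_(i in G) a i *: x i) <= (lam / 2) ^+ 2.
  apply: (le_trans WG).
  have sL : \sum_(i in Lv 0) a i ^+ 2 <= lam.
    apply: le_trans energy; rewrite [leRHS](big_setID (Lv 0)) /= (setIidPr LI) lerDl.
    by apply: sumr_ge0 => i _; exact: sqr_ge0.
  have sL0 : 0 <= \sum_(i in Lv 0) a i ^+ 2 by apply: sumr_ge0 => i _; exact: sqr_ge0.
  have M2l : 32 * M2 <= lam.
    have := M2_le'; have := alpha_le; move: lam0 => l0 al.
    have : alpha * lam <= 1 / 32 * lam by rewrite ler_pM2r.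
    lra.
  have h1 : (5 / 32 * lam + M2) * \sum_(i in Lv 0) a i ^+ 2 <= (6 / 32 * lam) * lam.
    apply: (@le_trans _ _ (6 / 32 * lam * \sum_(i in Lv 0) a i ^+ 2)).
      by apply: ler_wpM2r => //; lra.
    by apply: ler_wpM2l => //; move: lam0; lra.
  have h2 : 2 * lam * E <= 2 * lam * (lam / 64).
    by apply: ler_wpM2l; [move: lam0; lra|lra].
  nra.
have -> : \sum_(i in I) a i *: x i = \sum_(i in G) a i *: x i + \sum_(i in I :\: G) a i *: x i.
  by rewrite (big_setID G) /= (setIidPr GI).
apply: le_trans (ler_norm2D _ _) _.
have k1 : norm2 (\sum_(i in G) a i *: x i) <= lam / 2.
  rewrite -(@ler_pXn2r _ 2) ?nnegrE ?norm2_ge0 ?sqr_norm2 //; move: lam0; lra.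
have k2 : norm2 (\sum_(i in I :\: G) a i *: x i) <= lam / 8.
  rewrite -(@ler_pXn2r _ 2) ?nnegrE ?norm2_ge0 ?sqr_norm2 //; move: rest lam0; lra.
lra.
Qed.

End Levels.

End Sparse.

(** * Operator norm of a partial Gram sum *)

Section Sparse_opnorm.
Context (R : realType) (d n : nat) (x : 'I_n -> 'cV[R]_d).

Lemma mulmx_outer (u v : 'cV[R]_d) : u *m u^T *m v = dotp u v *: u.
Proof.
rewrite -mulmxA; have -> : u^T *m v = (dotp u v)%:M.
  apply/matrixP => i j; rewrite !ord1 !mxE mulr1n; apply: eq_bigr => k _.
  by rewrite !mxE.
by rewrite mul_mx_scalar.
Qed.

Lemma mulmx_gram (I : {set 'I_n}) v :
  (\sum_(i in I) x i *m (x i)^T) *m v = \sum_(i in I) dotp (x i) v *: x i.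
Proof. by rewrite mulmx_suml; apply: eq_bigr => i _; exact: mulmx_outer. Qed.

Lemma dotp_gram (I : {set 'I_n}) v :
  dotp v ((\sum_(i in I) x i *m (x i)^T) *m v) = \sum_(i in I) dotp (x i) v ^+ 2.
Proof.
rewrite mulmx_gram dotp_sumr; apply: eq_bigr => i _.
by rewrite dotpZr (dotpC v) expr2.
Qed.

Definition rate (e0 : R) : R := (128 * 128 * (1 + e0))^-1.

Definition snr (e0 : R) : R := 32 * 1024 / ((64 * 64)^-1 * rate e0).

Lemma rate_gt0 e0 : 0 <= e0 -> 0 < rate e0.
Proof. by move=> h; rewrite invr_gt0; apply: mulr_gt0; [exact: mulr_gt0|lra]. Qed.

Lemma snr_ge0 e0 : 0 <= e0 -> 0 <= snr e0.
Proof.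
move=> h; rewrite /snr; apply: divr_ge0; first by apply: mulr_ge0; exact: ler0n.
apply: mulr_ge0; last exact: ltW (rate_gt0 h).
by rewrite invr_ge0; apply: mulr_ge0; exact: ler0n.
Qed.

(** By contradiction, with lam the operator norm itself: if it exceeded the bound, the contraction
    would apply to every unit vector and give lam <= 5/8 lam. The condition on m leaves no
    coefficient above the top level. *)
Lemma sparse_opnorm (I : {set 'I_n}) (M2 e0 t0 : R) (m : nat) (e1 : nat -> R) :
  0 <= M2 -> (forall i, dotp (x i) (x i) <= M2) -> 0 <= e0 -> 0 < t0 ->
  (forall j, 0 <= e1 j) -> M2 < (t0 * 2 ^+ m) ^+ 2 ->
  (forall j s sg, (j < m)%N -> (size s <= n)%N ->
    #|large_set x (32^-1 * (t0 * 2 ^+ j) / 6) s sg|%:R <= e0 * (size s)%:R + e1 j) ->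
  opnorm (\sum_(i in I) x i *m (x i)^T) <=
    snr e0 * M2 +
    128 * (4 * (\sum_(0 <= j < m) (2 * e1 j + (rate e0)^-1) * (t0 * 2 ^+ j) ^+ 2)
           + #|I|%:R * t0 ^+ 2).
Proof.
move=> M20 xM e00 t00 e10 Mm hits.
set S := \sum_(i in I) _; set b1 := _ * M2; set b2 := 4 * _ + _.
have r0 := rate_gt0 e00.
have b10 : 0 <= b1 by exact: mulr_ge0 (snr_ge0 e00) M20.
have b20 : 0 <= b2.
  apply: addr_ge0; last by apply: mulr_ge0; rewrite ?sqr_ge0.
  apply: mulr_ge0 => //; apply: sumr_ge0 => j _.
  by apply: mulr_ge0; rewrite ?sqr_ge0 // addr_ge0 ?mulr_ge0 // invr_ge0 ltW.
rewrite leNgt; apply/negP => big.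
have lam0 : 0 < opnorm S by lra.
have frame u : \sum_(i in I) dotp (x i) u ^+ 2 <= opnorm S * dotp u u.
  by rewrite -dotp_gram; exact: quad_le_opnorm.
have : opnorm S <= 5 / 8 * opnorm S.
  apply: opnorm_le => [|v v1]; first by lra.
  have vv : dotp v v = 1 by rewrite -sqr_norm2 v1 expr1n.
  rewrite mulmx_gram; apply: (@synthesis_contract R d n x I (opnorm S) M2 lam0 xM frame
    (fun i => dotp (x i) v) e0 _ e00 t0 m e1 t00 e10) => //.
  - by have := frame v; rewrite vv mulr1.
  - move=> i; rewrite -(@ltr_pXn2r _ 2) ?nnegrE ?mulr_ge0 ?(ltW t00) ?exprn_ge0 //.
    apply: le_lt_trans Mm; rewrite real_normK ?num_real //.
    by rewrite (le_trans (cauchy_schwarz_sqr _ _)) // vv mulr1.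
  - by move: big; rewrite -/(rate e0) -/(snr e0) -/b1; lra.
  - by move: big; rewrite -/(rate e0) -/b2; lra.
lra.
Qed.

End Sparse_opnorm.

(** * Conditioning on all copies but one *)

Section Independence.
Local Open Scope ereal_scope.
Context d d' (T : measurableType d) (U : measurableType d') (R : realType).
Context (P : probability T R) (n : nat) (X : {RV P >-> U}) (Xs : 'I_n -> {RV P >-> U}).
Hypothesis iid : iid_copies X Xs.

Definition sample (w : T) : n.-tuple U := [tuple Xs j w | j < n].

Lemma measurable_sample : measurable_fun setT sample.
Proof.
apply/measurable_fun_tnthP => j.
have -> : (@tnth n U)^~ j \o sample = Xs j.
  by apply/funext => w /=; rewrite tnth_mktuple.
exact: measurable_funPT.
Qed.

Section One_coordinate.
Context (u0 : U) (k : 'I_n).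

(** Overwriting the coordinate instead of deleting it keeps the type, so that a function of the
    whole sample can be evaluated on the remaining copies. *)
Definition forget (z : n.-tuple U) : n.-tuple U :=
  [tuple if j == k then u0 else tnth z j | j < n].

Lemma measurable_forget : measurable_fun setT forget.
Proof.
apply/measurable_fun_tnthP => j; case: (eqVneq j k) => jk.
  rewrite (_ : _ \o _ = cst u0); first exact: measurable_cst.
  by apply/funext => z /=; rewrite tnth_mktuple jk eqxx.
rewrite (_ : _ \o _ = (@tnth n U)^~ j); first exact: measurable_tnth.
by apply/funext => z /=; rewrite tnth_mktuple (negbTE jk).
Qed.

Definition others (w : T) : n.-tuple U := forget (sample w).

Lemma measurable_others : measurable_fun setT others.
Proof. exact: measurableT_comp measurable_forget measurable_sample. Qed.

HB.instance Definition _ := isMeasurableFun.Build _ _ _ _ others measurable_others.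

Definition others_and (w : T) : n.-tuple U * U := (others w, Xs k w).

Lemma measurable_others_and : measurable_fun setT others_and.
Proof.
apply: measurable_fun_pair; [exact: measurable_others|exact: measurable_funPT].
Qed.

HB.instance Definition _ := isMeasurableFun.Build _ _ _ _ others_and measurable_others_and.

Definition boxes : set (set (n.-tuple U)) :=
  [set A | exists B : 'I_n -> set U, (forall j, measurable (B j)) /\
     A = [set z | forall j, B j (tnth z j)]].

Lemma boxes_measurable : boxes `<=` measurable.
Proof.
move=> _ [B [mB ->]].
rewrite (_ : [set z | _] = \bigcap_(j in [set` finset.setT]) ((@tnth n U)^~ j @^-1` B j)).
  apply: fin_bigcap_measurable => [|j _]; first exact: finite_finset.
  by rewrite -[X in measurable X]setTI; apply: measurable_tnth.
by apply/seteqP; split => z /= h j //; have := h j; rewrite /= inE; exact.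
Qed.

Lemma boxes_generate : measurable = <<s boxes >> :> set (set (n.-tuple U)).
Proof.
apply/seteqP; split; last first.
  by apply: smallest_sub; [exact: sigma_algebra_measurable|exact: boxes_measurable].
apply: smallest_sub; first exact: smallest_sigma_algebra.
move=> A; rewrite -bigcup_seq => -[j _ [B mB <-]].
apply: sub_sigma_algebra; exists (fun i => if i == j then B else setT); split.
  by move=> i; case: ifP.
rewrite setTI; apply/seteqP; split => z /= h.
  by move=> i; case: ifP => // /eqP ->.
by have := h j; rewrite eqxx.
Qed.

Lemma boxes_setI : setI_closed boxes.
Proof.
move=> _ _ [B [mB ->]] [C [mC ->]]; exists (fun j => B j `&` C j); split.
  by move=> j; exact: measurableI.
by apply/seteqP; split => z /=; [move=> [h1 h2] j; split|move=> h; split=> j; have [] := h j].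
Qed.

Lemma same_law j B : measurable B -> P (Xs j @^-1` B) = distribution P X B.
Proof. by move=> mB; have [_ /(_ j B mB)] := iid. Qed.

Lemma others_box (B : 'I_n -> set U) C : (forall j, measurable (B j)) -> measurable C ->
  P ((others @^-1` [set z | forall j, B j (tnth z j)]) `&` Xs k @^-1` C) =
  P (others @^-1` [set z | forall j, B j (tnth z j)]) * distribution P X C.
Proof.
move=> mB mC; have [indep _] := iid.
have [Bu|nBu] := pselect (B k u0); last first.
  rewrite (_ : others @^-1` _ = set0) ?set0I ?measure0 ?mul0e //.
  by apply/seteqP; split => w //= /(_ k); rewrite tnth_mktuple eqxx.
pose B1 j := if j == k then C else B j.
have mB1 j : measurable (B1 j) by rewrite /B1; case: ifP.
have E1 : (others @^-1` [set z | forall j, B j (tnth z j)]) `&` Xs k @^-1` C =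
    \bigcap_(j in [set` finset.setT]) (Xs j @^-1` B1 j).
  apply/seteqP; split => w /=.
    move=> [h hC] j _; rewrite /= /B1; case: eqVneq => [->//|jk].
    by have := h j; rewrite !tnth_mktuple (negbTE jk).
  move=> h; split; last by have := h k; rewrite /= /B1 eqxx; apply; rewrite inE.
  move=> j; rewrite !tnth_mktuple; case: eqVneq => [->//|jk].
  by have := h j; rewrite /= /B1 (negbTE jk); apply; rewrite inE.
have E2 : others @^-1` [set z | forall j, B j (tnth z j)] =
    \bigcap_(j in [set` (finset.setT :\ k)%SET]) (Xs j @^-1` B1 j).
  apply/seteqP; split => w /=.
    move=> h j; rewrite /= !inE andbT => jk; have := h j.
    by rewrite !tnth_mktuple (negbTE jk) /= /B1 (negbTE jk).
  move=> h j; rewrite !tnth_mktuple; case: eqVneq => [->//|jk].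
  by have := h j; rewrite /= /B1 (negbTE jk) !inE jk; exact.
rewrite E1 E2 !indep // (big_setD1 k) /= ?inE // muleC; congr (_ * _).
by rewrite /B1 eqxx same_law.
Qed.

(** Both sides are finite measures in A that agree on the boxes, a generating system stable under
    intersection. *)
Lemma others_indep A C : measurable A -> measurable C ->
  P ((others @^-1` A) `&` Xs k @^-1` C) = P (others @^-1` A) * distribution P X C.
Proof.
move=> mA mC.
have mXC : measurable (Xs k @^-1` C) by rewrite -[X in measurable X]setTI; exact: measurable_funPT.
have lawC : distribution P X C \is a fin_num by rewrite fin_num_measure.
have lawC0 : (0 <= fine (distribution P X C))%R by apply: fine_ge0.
pose m1 := pushforward (mrestr P mXC) others.
pose m2 := mscale (NngNum lawC0) (distribution P others).
have m2E E : m2 E = distribution P X C * P (others @^-1` E) by rewrite /m2 /mscale /= fineK.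
have := @g_sigma_algebra_measure_unique _ R (n.-tuple U) boxes boxes_measurable (fun=> setT) _ _
  m1 m2 boxes_setI.
have bT : boxes setT.
  by exists (fun=> setT); split => //; apply/seteqP; split.
move=> /(_ (fun=> bT) _ _ _ _ A).
move=> h; transitivity (m1 A); first by [].
transitivity (m2 A); last by rewrite m2E muleC.
apply: h.
- by rewrite bigcup_const.
- move=> _ [B [mB ->]]; apply: etrans (others_box mB mC) _.
  by rewrite muleC; exact: esym (m2E _).
- move=> _; rewrite /m1 /pushforward /mrestr; apply: le_lt_trans (probability_le1 P _) (ltry _).
  by apply: measurableI => //; rewrite -[X in measurable X]setTI; exact: measurable_others.
- by rewrite -boxes_generate.
Qed.

Let V : measurableType _ := n.-tuple U.

Lemma integral_others (g : (V * U)%type -> \bar R) :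
  measurable_fun setT g -> (forall z, 0 <= g z) ->
  \int[P]_w g (others w, Xs k w) = \int[P]_w \int[distribution P X]_x g (others w, x).
Proof.
move=> mg g0.
have -> : \int[P]_w g (others w, Xs k w) = \int[distribution P others_and]_z g z.
  by rewrite ge0_integral_distribution.
have -> : \int[distribution P others_and]_z g z =
    \int[distribution P others \x distribution P X]_z g z.
  apply: eq_measure_integral => A mA _; apply/esym; apply: product_measure_unique => // B C mB mC.
  by rewrite -others_indep //.
rewrite fubini_tonelli1 //.
by rewrite ge0_integral_distribution //; [exact: measurable_fun_fubini_tonelli_F|move=> z; exact: integral_ge0].
Qed.

End One_coordinate.

Let V : measurableType _ := n.-tuple U.

Lemma measurable_prod_pred d0 (W : measurableType d0) (A : {set 'I_n}) (f : 'I_n -> W -> R) :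
  (forall k, measurable_fun setT (f k)) ->
  measurable_fun setT (fun w => (\prod_(k in A) f k w)%R).
Proof.
move=> mf; rewrite (_ : (fun w => _) = (fun w => \prod_(k <- enum A) f k w)%R).
  elim: (enum A) => [|k s IH].
    by rewrite (_ : (fun w => _) = cst 1%R); [exact: measurable_cst|apply/funext => w; rewrite big_nil].
  rewrite (_ : (fun w => _) = (fun w => f k w * \prod_(k <- s) f k w)%R).
    exact: measurable_funM.
  by apply/funext => w; rewrite big_cons.
by apply/funext => w; rewrite big_enum.
Qed.

(* If [g k z x] only depends on the coordinates of [z] outside [A], conditioning
   on these makes the factors independent. *)
Lemma integral_prod_le (u0 : U) (A : {set 'I_n}) (g : 'I_n -> V -> U -> R) (c : 'I_n -> R) :
  (forall k, measurable_fun setT (fun p : V * U => g k p.1 p.2)) ->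
  (forall k z x, 0 <= g k z x)%R -> (forall k, 0 <= c k)%R ->
  (forall k j z x, k \in A -> j \in A -> g k (forget u0 j z) x = g k z x) ->
  (forall k z, k \in A -> \int[distribution P X]_x (g k z x)%:E <= (c k)%:E) ->
  \int[P]_w (\prod_(k in A) g k (sample w) (Xs k w))%:E <= (\prod_(k in A) c k)%:E.
Proof.
move=> mg g0 c0 gA gc.
have mgz k : measurable_fun setT (fun z : V => g k z (tnth z k)).
  apply: (@measurableT_comp _ _ _ _ _ _ (fun p : V * U => g k p.1 p.2) _ (fun z : V => (z, tnth z k))) => //.
  by apply: measurable_fun_pair; [exact: measurable_id|exact: measurable_tnth].
have msub (B : {set 'I_n}) : measurable_fun setT (fun z : V => (\prod_(j in B) g j z (tnth z j))%R).
  exact: measurable_prod_pred.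
have : forall B : {set 'I_n}, B \subset A ->
    \int[P]_w (\prod_(k in B) g k (sample w) (Xs k w))%:E <= (\prod_(k in B) c k)%:E.
  (* Induction on the number of factors. Overwriting coordinate k does not affect any g j with j in
     A, so the k-th copy can be integrated out alone, which costs the factor c k. *)
  move=> B; move: {-2}B (erefl #|B|); elim: #|B| => [|b IH] {}B Bb BA.
    have -> : B = finset.set0 by apply/eqP; rewrite -finset.cards_eq0 Bb.
    rewrite finset.big_set0; under eq_integral do rewrite finset.big_set0.
    by rewrite (integral_cst P measurableT 1%:E) mul1e; exact: probability_le1.
  have /card_gt0P[k kB] : (0 < #|B|)%N by rewrite Bb.
  have kA := fintype.subsetP BA _ kB.
  have DA : (B :\ k)%SET \subset A by apply: fintype.subset_trans BA; exact: finset.subsetDl.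
  pose G (p : V * U) := ((\prod_(j in (B :\ k)%SET) g j p.1 (tnth p.1 j)) * g k p.1 p.2)%:E.
  have forgetE w : (\prod_(j in B) g j (sample w) (Xs j w))%:E = G (others u0 k w, Xs k w).
    rewrite /G (finset.big_setD1 k) //= mulrC; congr (_ * _)%:E.
      apply: eq_bigr => j; rewrite !inE => /andP[jk jB].
      rewrite /others gA ?(fintype.subsetP BA) // /forget tnth_mktuple (negbTE jk).
      by rewrite tnth_mktuple.
    by rewrite /others gA.
  have G0 z : 0 <= G z by rewrite lee_fin mulr_ge0 // prodr_ge0.
  have mG : measurable_fun setT G.
    apply/measurable_EFinP; apply: measurable_funM => //.
    exact: (measurableT_comp (msub (B :\ k)%SET) (@measurable_fst _ _ V U)).
  under eq_integral do rewrite forgetE.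
  rewrite integral_others //.
  have mgk z : measurable_fun setT (fun x => (g k z x)%:E).
    apply/measurable_EFinP.
    apply: (@measurableT_comp _ _ _ _ _ _ (fun p : V * U => g k p.1 p.2) _ (fun x : U => (z, x))) => //.
    by apply: measurable_fun_pair; [exact: measurable_cst|exact: measurable_id].
  apply: (@le_trans _ _ (\int[P]_w ((\prod_(j in (B :\ k)%SET) g j (sample w) (Xs j w))%:E * (c k)%:E))).
    apply: ge0_le_integral => //.
    - by move=> w _; apply: integral_ge0.
    - apply: (@measurableT_comp _ _ _ _ _ _ (fun z : V => \int[distribution P X]_x G (z, x)) _ (others u0 k)).
        exact: (measurable_fun_fubini_tonelli_F (m2 := distribution P X)).
      exact: measurable_others.
    - apply: emeasurable_funM; last exact: measurable_cst.
      apply/measurable_EFinP.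
      have := measurableT_comp (msub (B :\ k)%SET) measurable_sample.
      congr measurable_fun; apply/funext => w /=; apply: eq_bigr => j _.
      by rewrite tnth_mktuple.
    move=> w _; rewrite /G /=; under eq_integral do rewrite EFinM.
    rewrite ge0_integralZl //; last 2 first.
    - by move=> x _; rewrite lee_fin.
    - by rewrite lee_fin prodr_ge0.
    apply: lee_pmul => //; [by rewrite lee_fin prodr_ge0|by apply: integral_ge0 => x _; rewrite lee_fin| |exact: gc].
    rewrite lee_fin le_eqVlt; apply/orP; left; apply/eqP; apply: eq_bigr => j.
    rewrite !inE => /andP[jk jB].
    rewrite /others gA ?(fintype.subsetP BA) // /forget tnth_mktuple (negbTE jk).
    by rewrite tnth_mktuple.
  rewrite ge0_integralZr //; last 3 first.
  - apply/measurable_EFinP.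
    have := measurableT_comp (msub (B :\ k)%SET) measurable_sample.
    congr measurable_fun; apply/funext => w /=; apply: eq_bigr => j _.
    by rewrite tnth_mktuple.
  - by move=> w _; rewrite lee_fin prodr_ge0.
  - by rewrite lee_fin.
  rewrite (finset.big_setD1 k) //= mulrC EFinM lee_wpmul2r ?lee_fin //.
  apply: IH => //.
  by apply/eqP; rewrite -eqSS -Bb (finset.cardsD1 k B) kB.
exact.
Qed.

End Independence.

(** * Expectations of nonnegative functions *)

Section Nonneg_expectation.
Context d0 (U : measurableType d0) (R : realType) (mu : probability U R).
Implicit Types f g : U -> R.

Definition nnint f :=
  [/\ measurable_fun setT f, forall x, 0 <= f x & (\int[mu]_x (f x)%:E < +oo)%E].

Definition Ex f : R := fine (\int[mu]_x (f x)%:E)%E.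

Lemma ExE f : nnint f -> (Ex f)%:E = (\int[mu]_x (f x)%:E)%E.
Proof.
move=> [mf f0 ff]; rewrite fineK // ge0_fin_numE //.
by apply: integral_ge0 => x _; rewrite lee_fin.
Qed.

Lemma Ex_ge0 f : nnint f -> 0 <= Ex f.
Proof. by move=> ff; rewrite -lee_fin ExE //; case: ff => _ f0 _; apply: integral_ge0 => x _; rewrite lee_fin. Qed.

Lemma nnint_bound f c : measurable_fun setT f -> (forall x, 0 <= f x) ->
  (\int[mu]_x (f x)%:E <= c%:E)%E -> nnint f /\ Ex f <= c.
Proof.
move=> mf f0 fc; have ff : nnint f by split=> //; rewrite (le_lt_trans fc) ?ltry.
by split=> //; rewrite -lee_fin ExE.
Qed.

Lemma Ex_le f g : nnint g -> measurable_fun setT f -> (forall x, 0 <= f x) ->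
  (forall x, f x <= g x) -> nnint f /\ Ex f <= Ex g.
Proof.
move=> gg mf f0 fg; apply: nnint_bound => //; rewrite ExE //.
by case: gg => mg g0 _; apply: ge0_le_integral => //= [x _|||x _]; rewrite ?lee_fin //;
  apply/measurable_EFinP.
Qed.

Lemma ExD f g : nnint f -> nnint g ->
  nnint (fun x => f x + g x) /\ Ex (fun x => f x + g x) = Ex f + Ex g.
Proof.
move=> ff gg; have [mf f0 _] := ff; have [mg g0 _] := gg.
have E : (\int[mu]_x (f x + g x)%:E)%E = (Ex f + Ex g)%:E.
  rewrite EFinD !ExE //; under eq_integral do rewrite EFinD.
  by apply: ge0_integralD => //; first [by move=> x _; rewrite lee_fin|exact/measurable_EFinP].
split; last by rewrite /Ex E.
by split; [exact: measurable_funD|move=> x; exact: addr_ge0|rewrite E ltry].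
Qed.

Lemma ExZ c f : 0 <= c -> nnint f ->
  nnint (fun x => c * f x) /\ Ex (fun x => c * f x) = c * Ex f.
Proof.
move=> c0 ff; have [mf f0 _] := ff.
have E : (\int[mu]_x (c * f x)%:E)%E = (c * Ex f)%:E.
  rewrite EFinM ExE //; under eq_integral do rewrite EFinM.
  by apply: ge0_integralZl_EFin => //; first [by move=> x _; rewrite lee_fin|exact/measurable_EFinP].
split; last by rewrite /Ex E.
by split; [exact: measurable_funM|move=> x; exact: mulr_ge0|rewrite E ltry].
Qed.

Lemma Ex_cst c : 0 <= c -> nnint (fun=> c) /\ Ex (fun=> c) = c.
Proof.
move=> c0; have E : (\int[mu]_x c%:E)%E = c%:E.
  rewrite (integral_cst mu measurableT c%:E) -[RHS]mule1; congr (_ * _)%E.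
  exact: probability_setT.
split; last by rewrite /Ex E.
by split; [exact: measurable_cst|move=> _|rewrite E ltry].
Qed.

Lemma Ex_sum (I : Type) (s : seq I) (f : I -> U -> R) : (forall i, nnint (f i)) ->
  nnint (fun x => \sum_(i <- s) f i x) /\
  Ex (fun x => \sum_(i <- s) f i x) = \sum_(i <- s) Ex (f i).
Proof.
move=> ff; elim: s => [|i s [IH1 IH2]].
  rewrite big_nil (_ : (fun x => _) = fun=> 0); first exact: Ex_cst.
  by apply/funext => x; rewrite big_nil.
rewrite big_cons -IH2 (_ : (fun x => _) = fun x => f i x + \sum_(i <- s) f i x).
  exact: ExD.
by apply/funext => x; rewrite big_cons.
Qed.

Lemma Ex_walk (V : zmodType) (L : seq (V * R)) (F : V -> U -> R) th :
  bias_ok L -> (forall y, nnint (F y)) ->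
  nnint (fun x => walk L (fun y => F y x) th) /\
  Ex (fun x => walk L (fun y => F y x) th) = walk L (fun y => Ex (F y)) th.
Proof.
move=> + FF; elim: L th => [|[b s] L IH] th /=; first by move=> _; split.
rewrite ltr_norml -andbA => /and3P[s1 s2 Lok].
have [n1 <-] := IH (th + b) Lok; have [n2 <-] := IH (th - b) Lok.
have p1 : 0 <= (1 + s) / 2 by lra.
have p2 : 0 <= (1 - s) / 2 by lra.
have [m1 <-] := ExZ p1 n1; have [m2 <-] := ExZ p2 n2.
exact: ExD.
Qed.

End Nonneg_expectation.

(** * Fourth moments of the projections and of the norm *)

Section Feature.
Context d0 (U : measurableType d0) (R : realType) (mu : probability U R) (d : nat).
Variable (nv : U -> 'cV[R]_d).
Hypothesis mnv : forall j, measurable_fun setT (fun x => nv x j 0).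

Lemma measurable_dotp u : measurable_fun setT (fun x => dotp (nv x) u).
Proof.
apply: measurable_sum => j; apply: measurable_funM => //; exact: measurable_cst.
Qed.

Lemma measurable_dotp_self : measurable_fun setT (fun x => dotp (nv x) (nv x)).
Proof. by apply: measurable_sum => j; apply: measurable_funM. Qed.

Context (p Kp : R) (Q : 'cV[R]_d -> R).
Hypothesis (p4 : 4 < p) (Kp0 : 0 <= Kp) (Q0 : forall u, 0 <= Q u).
Hypothesis EQ : forall u, nnint mu (fun x => dotp (nv x) u ^+ 2) /\ Ex mu (fun x => dotp (nv x) u ^+ 2) = Q u.
Hypothesis EP : forall u, (\int[mu]_x (`|dotp (nv x) u| `^ p)%:E <= (Kp * Q u `^ (p / 2))%:E)%E.

(** Above s, the factor (|y| / s)^(p - 4) is at least 1. The scale s is left free, so that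
    directions of variance 0 need no separate treatment. *)
Lemma pow4_le_powR (y s : R) : 0 < s -> y ^+ 4 <= s ^+ 4 + s `^ (4 - p) * `|y| `^ p.
Proof.
move=> s0; have -> : y ^+ 4 = `|y| ^+ 4.
  by rewrite -[4%N]/(2 * 2)%N !exprM real_normK ?num_real.
have [ys|sy] := leP `|y| s.
  apply: ler_wpDr; first by rewrite mulr_ge0 ?powR_ge0.
  by rewrite lerXn2r ?nnegrE // ltW.
apply: ler_wpDl; first by rewrite exprn_ge0 // ltW.
have y0 : 0 < `|y| by apply: lt_trans sy.
rewrite -(powR_mulrn 4 (ltW y0)).
have -> : `|y| `^ p = `|y| `^ 4%:R * `|y| `^ (p - 4).
  by rewrite -powRD ?(gt_eqF y0) ?implybT // addrC subrK.
rewrite mulrCA -[leLHS]mulr1 ler_wpM2l ?powR_ge0 //.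
have -> : 4 - p = - (p - 4) by rewrite opprB.
rewrite powRN mulrC ler_pdivlMr ?powR_gt0 // mul1r.
by apply: ge0_ler_powR; rewrite ?nnegrE ?subr_ge0 ?(ltW s0) ?(ltW sy) ?(ltW p4) ?(ltW y0).
Qed.

Lemma moment4 u s : 0 < s -> Q u <= s ^+ 2 ->
  nnint mu (fun x => dotp (nv x) u ^+ 4) /\
  Ex mu (fun x => dotp (nv x) u ^+ 4) <= (1 + Kp) * s ^+ 4.
Proof.
move=> s0 Qs.
have mp : measurable_fun setT (fun x => `|dotp (nv x) u| `^ p).
  apply: (measurableT_comp (measurable_powR p)).
  by apply: measurableT_comp => //; exact: measurable_dotp.
have [nP EPu] := nnint_bound mp (fun x => powR_ge0 _ _) (EP u).
have [nS ES] := ExZ (powR_ge0 s (4 - p)) nP.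
have [nc Ec] := @Ex_cst _ _ _ mu (s ^+ 4) (exprn_ge0 4 (ltW s0)).
have [nD ED] := ExD nc nS.
have mf : measurable_fun setT (fun x => dotp (nv x) u ^+ 4).
  by apply: measurable_funX; exact: measurable_dotp.
have f0 x : 0 <= dotp (nv x) u ^+ 4 by rewrite -[4%N]/(2 * 2)%N exprM sqr_ge0.
have [nf Ef] := Ex_le nD mf f0 (fun x => pow4_le_powR _ s0).
split=> //; apply: (le_trans Ef); rewrite ED Ec ES mulrDl mul1r lerD2l.
have h : Kp * Q u `^ (p / 2) <= Kp * s `^ p.
  rewrite ler_wpM2l //; apply: (@le_trans _ _ ((s ^+ 2) `^ (p / 2))).
    by apply: ge0_ler_powR; rewrite ?nnegrE ?sqr_ge0 // divr_ge0 // ltW // (lt_trans _ p4).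
  rewrite -(powR_mulrn 2 (ltW s0)) -powRrM mulrC divfK //.
apply: (le_trans (ler_wpM2l (powR_ge0 _ _) (le_trans EPu h))).
rewrite mulrCA -powRD ?(gt_eqF s0) ?implybT // subrK powR_mulrn // ltW //.
Qed.

Context (r : R).
Hypothesis r1 : 1 <= r.
Hypothesis rE : r = \sum_j Q (delta_mx j 0).

Lemma dotp_delta (x : 'cV[R]_d) j : dotp x (delta_mx j 0) = x j 0.
Proof. by rewrite -[delta_mx _ _]scale1r dotp_smooth mul1r. Qed.

Lemma moment2_norm : nnint mu (fun x => dotp (nv x) (nv x)) /\
  Ex mu (fun x => dotp (nv x) (nv x)) = r.
Proof.
have [n1 E1] := @Ex_sum _ _ _ mu _ (index_enum 'I_d) (fun j x => dotp (nv x) (delta_mx j 0) ^+ 2)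
  (fun j => (EQ (delta_mx j 0)).1).
rewrite (_ : (fun x => dotp (nv x) (nv x)) = fun x => \sum_j dotp (nv x) (delta_mx j 0) ^+ 2).
  by split=> //; rewrite E1 rE; apply: eq_bigr => j _; have [] := EQ (delta_mx j 0).
by apply/funext => x; apply: eq_bigr => j _; rewrite dotp_delta expr2.
Qed.

Lemma moment4_norm : nnint mu (fun x => dotp (nv x) (nv x) ^+ 2) /\
  Ex mu (fun x => dotp (nv x) (nv x) ^+ 2) <= 4 * (1 + Kp) * r ^+ 2.
Proof.
have r0 : 0 < r by apply: lt_le_trans r1.
have d0' : (0 < d)%N.
  rewrite lt0n; apply/negP => /eqP dz; move: r0; rewrite rE big1 ?ltxx // => j _.
  by exfalso; have := leq_ltn_trans (leq0n j) (ltn_ord j); rewrite dz.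
(* Adding r / d makes every weight invertible, even on a coordinate of variance 0, and only doubles
   their sum. *)
pose q j := Q (delta_mx j 0) + r / d%:R.
have dR : 0 < d%:R :> R by rewrite ltr0n.
have q0 j : 0 < q j by apply: ltr_wpDl; rewrite ?Q0 ?divr_gt0.
have sq : \sum_j q j = 2 * r.
  rewrite big_split /= -rE sumr_const card_ord -[_ *+ d]mulr_natr divfK ?gt_eqF //; lra.
have m4 j : nnint mu (fun x => (q j)^-1 * dotp (nv x) (delta_mx j 0) ^+ 4) /\
    Ex mu (fun x => (q j)^-1 * dotp (nv x) (delta_mx j 0) ^+ 4) <= (1 + Kp) * q j.
  have s0 : 0 < Num.sqrt (q j) by rewrite sqrtr_gt0.
  have [|n4 E4] := @moment4 (delta_mx j 0) _ s0.
    by rewrite sqr_sqrtr ?(ltW (q0 j)) // lerDl divr_ge0 ?(ltW r0) ?ler0n.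
  have qi : 0 <= (q j)^-1 by rewrite invr_ge0 ltW.
  have [nz Ez] := ExZ qi n4; split=> //; rewrite Ez.
  apply: (le_trans (ler_wpM2l qi E4)).
  rewrite -[4%N]/(2 * 2)%N exprM sqr_sqrtr ?(ltW (q0 j)) //.
  by rewrite le_eqVlt; apply/orP; left; apply/eqP; field; rewrite gt_eqF.
have [n1 E1] := @Ex_sum _ _ _ mu _ (index_enum 'I_d) _ (fun j => (m4 j).1).
have r20 : 0 <= 2 * r by rewrite mulr_ge0 // ltW.
have [n2 E2] := ExZ r20 n1.
have mf : measurable_fun setT (fun x => dotp (nv x) (nv x) ^+ 2).
  by apply: measurable_funX; exact: measurable_dotp_self.
have [||nf Ef] := Ex_le n2 mf _ _; [by move=> x; exact: sqr_ge0| |].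
  move=> x; rewrite -sq.
  (* Cauchy-Schwarz with the weights q j *)
  have := @cauchy_schwarz_sqr R d (\col_j Num.sqrt (q j)) (\col_j (nv x j 0 ^+ 2 / Num.sqrt (q j))).
  rewrite (_ : dotp _ _ = dotp (nv x) (nv x)); last first.
    by apply: eq_bigr => j _; rewrite !mxE mulrCA mulfV ?mulr1 ?expr2 // gt_eqF // sqrtr_gt0.
  move=> h; apply: (le_trans h); rewrite le_eqVlt; apply/orP; left; apply/eqP.
  congr (_ * _); apply: eq_bigr => j _; rewrite !mxE -expr2 ?sqr_sqrtr ?(ltW (q0 j)) //.
  by rewrite dotp_delta expr_div_n sqr_sqrtr ?(ltW (q0 j)) // -exprM mulrC.
split=> //; apply: (le_trans Ef); rewrite E2 E1.
have : \sum_j Ex mu (fun x => (q j)^-1 * dotp (nv x) (delta_mx j 0) ^+ 4) <= (1 + Kp) * (2 * r).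
  by rewrite -sq mulr_sumr; apply: ler_sum => j _; exact: (m4 j).2.
move=> /(ler_wpM2l r20); lra.
Qed.

End Feature.

(** * The truncated quadratic form *)

Section Truncation.
Context (R : realType).

Lemma pow4E (y : R) : y ^+ 4 = (y ^+ 2) ^+ 2.
Proof. by rewrite -exprM. Qed.

Definition trunc_sqr (B y : R) : R := Num.min (y ^+ 2) B.

Lemma trunc_sqr_ge0 B y : 0 <= B -> 0 <= trunc_sqr B y.
Proof. by move=> B0; rewrite /trunc_sqr le_min sqr_ge0. Qed.

(** Both entries of the minimum are at least g^2 / 16. The factor 25 leaves enough room to absorb
    every quadratic term when the perturbation is large. *)
Lemma min_quartic_ge (q g : R) : 0 < q -> q / 4 < `|g| ->
  25 * g ^+ 2 <= 400 * Num.min (g ^+ 2) (g ^+ 4 / q ^+ 2).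
Proof.
move=> q0 gq; have q2 : 0 < q ^+ 2 by rewrite exprn_gt0.
have g2 : q ^+ 2 <= 16 * g ^+ 2.
  have : (q / 4) ^+ 2 <= g ^+ 2.
    rewrite -(real_normK (num_real g)) lerXn2r ?nnegrE ?(ltW gq) // divr_ge0 // ltW //.
  rewrite expr_div_n; lra.
have : g ^+ 2 / 16 <= Num.min (g ^+ 2) (g ^+ 4 / q ^+ 2); last lra.
rewrite le_min; apply/andP; split; first by have := sqr_ge0 g; lra.
rewrite ler_pdivlMr // pow4E.
have := ler_wpM2l (sqr_ge0 g) g2; lra.
Qed.

(* A Taylor-like lower bound of the truncated square at [a], with slope [m]. *)
Lemma trunc_sqr_lower (q a : R) : 0 < q -> exists m, forall g,
  trunc_sqr (q ^+ 2) a + 2 * m * g + g ^+ 2 - 400 * Num.min (g ^+ 2) (g ^+ 4 / q ^+ 2)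
  <= trunc_sqr (4 * q ^+ 2) (a + g).
Proof.
move=> q0; rewrite /trunc_sqr.
have q2 : 0 < q ^+ 2 by rewrite exprn_gt0.
have err0 (g : R) : 0 <= Num.min (g ^+ 2) (g ^+ 4 / q ^+ 2).
  by rewrite le_min sqr_ge0 divr_ge0 ?(ltW q2) // pow4E sqr_ge0.
have pos (b : R) : 0 <= Num.min (b ^+ 2) (4 * q ^+ 2) by rewrite le_min sqr_ge0 mulr_ge0 // ltW.
(* The slope is a clamped to [-q, q]. The coefficient of g^2 has to be exactly 1: averaged over the
   walk, g^2 becomes the noise, which is later compared with its mean. *)
have [aq|qa] := leP `|a| q.
  exists a => g; have -> : Num.min (a ^+ 2) (q ^+ 2) = a ^+ 2.
    by apply/min_idPl; rewrite -(real_normK (num_real a)) lerXn2r ?nnegrE // ltW.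
  have [small|large] := leP ((a + g) ^+ 2) (4 * q ^+ 2); first by have := err0 g; lra.
  have gq : q < `|g|.
    have h : 2 * q < `|a + g|.
      rewrite -(@ltr_pXn2r _ 2) ?nnegrE ?mulr_ge0 ?(ltW q0) // real_normK ?num_real //; lra.
    have := ler_normD a g; lra.
  have := min_quartic_ge q0 (_ : q / 4 < `|g|) => /(_ ltac:(lra)) h.
  have ag : a ^+ 2 <= g ^+ 2.
    by rewrite -(real_normK (num_real a)) -(real_normK (num_real g)) lerXn2r ?nnegrE //; lra.
  have := sqr_ge0 (a - g); lra.
have main (b g : R) : q < b ->
    q ^+ 2 + 2 * q * g + g ^+ 2 - 400 * Num.min (g ^+ 2) (g ^+ 4 / q ^+ 2)
    <= Num.min ((b + g) ^+ 2) (4 * q ^+ 2).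
  move=> qb; have [gq|qg] := leP `|g| (q / 4).
    move: gq; rewrite ler_norml => /andP[g1 g2]; apply: (@le_trans _ _ ((q + g) ^+ 2)).
      by have := err0 g; lra.
    have h0 : 0 <= q + g by lra.
    rewrite le_min; apply/andP; split; first by rewrite lerXn2r ?nnegrE //; lra.
    apply: (@le_trans _ _ ((2 * q) ^+ 2)); last by rewrite exprMn; lra.
    by rewrite lerXn2r ?nnegrE //; lra.
  apply: le_trans (pos _); have h := min_quartic_ge q0 qg.
  have : 0 <= (q / 4) ^+ 2 <= g ^+ 2.
    by rewrite sqr_ge0 -(real_normK (num_real g)) lerXn2r ?nnegrE ?(ltW qg) // divr_ge0 // ltW.
  rewrite expr_div_n => /andP[_ h2].
  have := sqr_ge0 (4 * g - q); have := sqr_ge0 (4 * g + q); lra.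
have -> : Num.min (a ^+ 2) (q ^+ 2) = q ^+ 2.
  by apply/min_idPr; rewrite -(real_normK (num_real a)) lerXn2r ?nnegrE ?(ltW q0) // ltW.
have [a0|a0] := leP 0 a.
  exists q => g; apply: main; by rewrite -(ger0_norm a0).
exists (- q) => g; have := main (- a) (- g); rewrite -(ltr0_norm a0) => /(_ qa).
rewrite (ltr0_norm a0) -opprD !sqrrN !pow4E sqrrN.
by have -> : 2 * q * - g = 2 * - q * g by ring.
Qed.

End Truncation.

(** * PAC-Bayesian bounds below the truncation height *)

Section Bulk.
Context d0 d1 (T : measurableType d0) (U : measurableType d1) (R : realType).
Context (P : probability T R) (n : nat) (X : {RV P >-> U}) (Xs : 'I_n -> {RV P >-> U}).
Hypothesis iid : iid_copies X Xs.
Let mu := distribution P X.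

Lemma probability_inhabited : inhabited T.
Proof.
apply: contrapT => nT; have : P setT = 0%E.
  by rewrite (_ : setT = set0) ?measure0 //; apply/seteqP; split => // w _; case: nT; constructor.
by rewrite probability_setT => /eqP; rewrite onee_eq0.
Qed.

Lemma law_copy (f : U -> R) k : measurable_fun setT f -> (forall x, 0 <= f x) ->
  (\int[P]_w (f (Xs k w))%:E = \int[mu]_x (f x)%:E)%E.
Proof.
move=> mf f0.
have -> : (\int[P]_w (f (Xs k w))%:E = \int[distribution P (Xs k)]_x (f x)%:E)%E.
  rewrite ge0_integral_distribution //; exact/measurable_EFinP.
by apply: eq_measure_integral => A mA _; have [_ /(_ k A mA)] := iid.
Qed.

Lemma measurable_copy (f : U -> R) k : measurable_fun setT f ->
  measurable_fun setT (fun w => f (Xs k w)).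
Proof. by move=> mf; apply: measurableT_comp => //; exact: measurable_funPT. Qed.

Lemma nnint_copy f k : nnint mu f ->
  nnint P (fun w => f (Xs k w)) /\ Ex P (fun w => f (Xs k w)) = Ex mu f.
Proof.
move=> [mf f0 ff]; split; last by rewrite /Ex law_copy.
by split; [exact: measurable_copy|move=> w|rewrite law_copy].
Qed.

Lemma exp_sum_copies (h : U -> R) : measurable_fun setT h ->
  (\int[mu]_x (expR (h x))%:E <= 1%:E)%E ->
  nnint P (fun w => expR (\sum_i h (Xs i w))) /\ Ex P (fun w => expR (\sum_i h (Xs i w))) <= 1.
Proof.
move=> mh h1; have [w0] := probability_inhabited.
have mexp : measurable_fun setT (fun x => expR (h x)) by exact: measurableT_comp.
apply: nnint_bound.
- apply: measurableT_comp => //; apply: measurable_sum => i; exact: measurable_copy.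
- by move=> w; exact: expR_ge0.
have := @integral_prod_le _ _ _ _ _ _ _ _ _ iid (X w0) finset.setT (fun _ _ x => expR (h x)) (fun=> 1).
rewrite big1 // => H; apply: le_trans (H _ _ _ _ _) => //.
- rewrite le_eqVlt; apply/orP; left; apply/eqP; apply: eq_integral => w _.
  by rewrite expR_sum; congr (_%:E); apply: eq_bigl => i; rewrite inE.
- by move=> k; exact: (measurableT_comp mexp measurable_snd).
Qed.

Lemma sum_copies_sqr (f : U -> R) : nnint mu f -> nnint mu (fun x => f x ^+ 2) ->
  nnint P (fun w => (\sum_i f (Xs i w)) ^+ 2) /\
  Ex P (fun w => (\sum_i f (Xs i w)) ^+ 2) <=
    n%:R * Ex mu (fun x => f x ^+ 2) + n%:R ^+ 2 * Ex mu f ^+ 2.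
Proof.
move=> nf nf2; have [w0] := probability_inhabited; have [mf f0 _] := nf.
have c2 i j : nnint P (fun w => f (Xs i w) * f (Xs j w)) /\
    Ex P (fun w => f (Xs i w) * f (Xs j w)) <=
    (if i == j then Ex mu (fun x => f x ^+ 2) else Ex mu f ^+ 2).
  case: eqVneq => [<-|ij].
    rewrite (_ : (fun w => _) = fun w => f (Xs i w) ^+ 2); last by apply/funext.
    by have [? ->] := nnint_copy i nf2.
  apply: nnint_bound.
  - by apply: measurable_funM; exact: measurable_copy.
  - by move=> w; exact: mulr_ge0.
  have := @integral_prod_le _ _ _ _ _ _ _ _ _ iid (X w0) [set i; j]%SET (fun _ _ x => f x) (fun=> Ex mu f).
  move=> H; apply: le_trans (le_trans (H _ _ _ _ _) _).
  - rewrite le_eqVlt; apply/orP; left; apply/eqP; apply: eq_integral => w _.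
    by rewrite finset.big_setU1 ?finset.big_set1 // inE.
  - by move=> k; exact: (measurableT_comp mf measurable_snd).
  - by move=> *.
  - by move=> *; exact: Ex_ge0.
  - by [].
  - by move=> k z _; rewrite ExE.
  - by rewrite finset.big_setU1 ?finset.big_set1 ?inE // expr2.
have E (w : T) : (\sum_i f (Xs i w)) ^+ 2 = \sum_i \sum_j f (Xs i w) * f (Xs j w).
  by rewrite expr2 mulr_suml; apply: eq_bigr => i _; rewrite mulr_sumr.
rewrite (_ : (fun w => _) = fun w => \sum_i \sum_j f (Xs i w) * f (Xs j w)); last exact/funext.
have n1 i := @Ex_sum _ _ _ P _ (index_enum 'I_n) (fun j w => f (Xs i w) * f (Xs j w)) (fun j => (c2 i j).1).
have [n2 ->] := @Ex_sum _ _ _ P _ (index_enum 'I_n) _ (fun i => (n1 i).1); split=> //.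
apply: (@le_trans _ _ (\sum_i \sum_j (if i == j then Ex mu (fun x => f x ^+ 2) else Ex mu f ^+ 2))).
  by apply: ler_sum => i _; rewrite (n1 i).2; apply: ler_sum => j _; exact: (c2 i j).2.
apply: (@le_trans _ _ (\sum_(i < n) (Ex mu (fun x => f x ^+ 2) + n%:R * Ex mu f ^+ 2))).
  apply: ler_sum => i _; rewrite (bigD1 i) //= eqxx lerD2l.
  apply: (@le_trans _ _ (\sum_(j < n) Ex mu f ^+ 2)); last by rewrite sumr_const card_ord mulr_natl.
  rewrite [leLHS]big_mkcond /=; apply: ler_sum => j _.
  by rewrite eq_sym; case: eqVneq => //= _; exact: sqr_ge0.
by rewrite sumr_const card_ord -[_ *+ n]mulr_natl mulrDr mulrA expr2.
Qed.

Context (d : nat) (nv : U -> 'cV[R]_d).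
Hypothesis mnv : forall j, measurable_fun setT (fun x => nv x j 0).
Context (Q : 'cV[R]_d -> R) (r K : R).
Hypothesis r1 : 1 <= r.
Hypothesis EQ : forall u, nnint mu (fun x => dotp (nv x) u ^+ 2) /\ Ex mu (fun x => dotp (nv x) u ^+ 2) = Q u.
Hypothesis E4 : forall u, nnint mu (fun x => dotp (nv x) u ^+ 4).
Hypothesis E4le : forall u, norm2 u = 1 -> Ex mu (fun x => dotp (nv x) u ^+ 4) <= K.
Hypothesis En2 : nnint mu (fun x => dotp (nv x) (nv x)) /\ Ex mu (fun x => dotp (nv x) (nv x)) = r.
Hypothesis En4 : nnint mu (fun x => dotp (nv x) (nv x) ^+ 2) /\ Ex mu (fun x => dotp (nv x) (nv x) ^+ 2) <= K * r ^+ 2.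
Context (q : R) (N : nat).
Hypothesis (q0 : 0 < q) (rN : r < N%:R).
Let B := 4 * q ^+ 2.
Let lam := B^-1.
Let phi := trunc_sqr B.
Let x (w : T) (i : 'I_n) := nv (Xs i w).
Let Z (y : 'cV[R]_d) := r^-1 * dotp y y.

Let B0 : 0 < B. Proof. by rewrite mulr_gt0 // exprn_gt0. Qed.
Let lam0 : 0 < lam. Proof. by rewrite invr_gt0. Qed.
Let r0 : 0 < r. Proof. exact: lt_le_trans r1. Qed.
Let NR : 0 < N%:R :> R. Proof. exact: lt_trans rN. Qed.
Let N0 : (0 < N)%N. Proof. by rewrite -(ltr0n R). Qed.

(** The solution of the three equations of [rates]: endpoint of mean v, noise |x|^2 / r, entropy r.
    Only N remains free. *)
Let delta := (Num.sqrt r * Num.sqrt N%:R)^-1.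
Let sigma := Num.sqrt r / Num.sqrt N%:R.
Let sr : 0 < Num.sqrt r. Proof. by rewrite sqrtr_gt0. Qed.
Let sN : 0 < Num.sqrt (N%:R : R). Proof. by rewrite sqrtr_gt0. Qed.
Let sigma0 : 0 <= sigma. Proof. by rewrite divr_ge0 // ltW. Qed.
Let sigma1 : sigma < 1.
Proof. by rewrite ltr_pdivrMr // mul1r ltr_sqrt. Qed.
Let rates : [/\ N%:R * delta * sigma = 1, N%:R * delta ^+ 2 = r^-1 & N%:R * sigma ^+ 2 = r].
Proof.
have aux (b m : R) : 0 < b -> 0 < m -> b ^+ 2 = r -> m ^+ 2 = N%:R ->
    [/\ N%:R * (b * m)^-1 * (b / m) = 1, N%:R * (b * m)^-1 ^+ 2 = r^-1 & N%:R * (b / m) ^+ 2 = r].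
  by move=> b0 m0 <- <-; split; field; rewrite !gt_eqF.
by apply: aux => //; rewrite sqr_sqrtr // ltW.
Qed.
Let Nds : N%:R * delta * sigma = 1. Proof. by case: rates. Qed.
Let Ndd : N%:R * delta ^+ 2 = r^-1. Proof. by case: rates. Qed.
Let Nss : N%:R * sigma ^+ 2 = r. Proof. by case: rates. Qed.

Let L (v : 'cV[R]_d) := smooth N delta sigma v.

Let mphi u : measurable_fun setT (fun y => phi (dotp (nv y) u)).
Proof.
apply: measurable_minr; last exact: measurable_cst.
apply: measurable_funX; exact: measurable_dotp.
Qed.

Let phi_bounds y : 0 <= phi y <= y ^+ 2.
Proof. by rewrite trunc_sqr_ge0 ?(ltW B0) //= /phi /trunc_sqr ge_min lexx. Qed.

Let nphi u : nnint mu (fun y => phi (dotp (nv y) u)) /\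
  Ex mu (fun y => phi (dotp (nv y) u)) <= Q u.
Proof.
have [n2 <-] := EQ u; apply: Ex_le => //.
  by move=> y; have /andP[] := phi_bounds (dotp (nv y) u).
by move=> y; have /andP[] := phi_bounds (dotp (nv y) u).
Qed.

Let phiB y : lam * phi y <= 1.
Proof. by rewrite mulrC ler_pdivrMr // mul1r /phi /trunc_sqr ge_min lexx orbT. Qed.

Let e1 u := Ex mu (fun y => phi (dotp (nv y) u)).
Let e4 u := Ex mu (fun y => dotp (nv y) u ^+ 4).

Let pow4_ge0 (y : R) : 0 <= y ^+ 4.
Proof. by rewrite pow4E sqr_ge0. Qed.

Let phi_sqr y : phi y ^+ 2 <= y ^+ 4.
Proof.
have /andP[p0 p1] := phi_bounds y.
by rewrite pow4E lerXn2r ?nnegrE ?sqr_ge0.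
Qed.

(** Squaring exp(z/2) (1 - z/2) <= 1 gives a bound valid for all z <= 1, negative ones included. *)
Lemma expR_le_quad (z : R) : z <= 1 -> expR z <= 1 + z + 2 * z ^+ 2.
Proof.
move=> z1; pose u := z / 2; have zE : z = u + u by rewrite /u; lra.
have u1 : u <= 1 / 2 by rewrite /u; lra.
have u0 : 0 < 1 - u by lra.
have h : expR u * (1 - u) <= 1.
  rewrite -[leRHS](expRxMexpNx_1 u) ler_pM2l ?expR_gt0 //; exact: expR_ge1Dx.
have e0 := expR_ge0 u.
have h2 : expR z * (1 - u) ^+ 2 <= 1.
  have -> : expR z * (1 - u) ^+ 2 = (expR u * (1 - u)) ^+ 2 by rewrite zE expRD; ring.
  by rewrite -[leRHS](expr1n _ 2) lerXn2r ?nnegrE ?mulr_ge0 ?(ltW u0).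
rewrite -(ler_pM2r (exprn_gt0 2 u0)); apply: (le_trans h2).
have -> : (1 + z + 2 * z ^+ 2) * (1 - u) ^+ 2 = 1 + u ^+ 2 * ((1 - 2 * u) * (5 - 4 * u)).
  by rewrite zE; ring.
by rewrite lerDl mulr_ge0 ?sqr_ge0 // mulr_ge0 //; lra.
Qed.

(** The constants are bounds for the logarithm of the Laplace transform: lam * phi is at most 1 and
    phi^2 is at most the fourth power, so the quadratic bound on the exponential applies. Hence the
    exponential of either tilt has mean at most 1 for each fixed u, which the average over the
    unbiased walk preserves. *)
Let tilt_up u y := lam * phi (dotp (nv y) u) - (lam * e1 u + 2 * lam ^+ 2 * e4 u).
Let tilt_down u y := - (lam * phi (dotp (nv y) u)) + (lam * e1 u - 2 * lam ^+ 2 * e4 u).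

Let l2 : 0 <= 2 * lam ^+ 2. Proof. by rewrite mulr_ge0 // sqr_ge0. Qed.

Let quartic u : nnint mu (fun y => 1 + 2 * lam ^+ 2 * dotp (nv y) u ^+ 4) /\
  Ex mu (fun y => 1 + 2 * lam ^+ 2 * dotp (nv y) u ^+ 4) = 1 + 2 * lam ^+ 2 * e4 u.
Proof.
have [n1 E1] := @Ex_cst _ _ _ mu 1 ler01.
have [n2 E2] := ExZ l2 (E4 u).
by have [n3 E3] := ExD n1 n2; split=> //; rewrite E3 E1 E2.
Qed.

Let mtilt_up u : measurable_fun setT (tilt_up u).
Proof.
apply: measurable_funB; last exact: measurable_cst.
by apply: measurable_funM => //; exact: measurable_cst.
Qed.

Let mtilt_down u : measurable_fun setT (tilt_down u).
Proof.
apply: measurable_funD; last exact: measurable_cst.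
by apply: measurableT_comp => //; apply: measurable_funM => //; exact: measurable_cst.
Qed.

Let tilt_up_le1 u : (\int[mu]_y (expR (tilt_up u y))%:E <= 1%:E)%E.
Proof.
have [n4 Eq4] := quartic u; have [np _] := nphi u.
have [n5 Eq5] := ExZ (ltW lam0) np; have [n6 Eq6] := ExD n4 n5.
set Lam := lam * e1 u + 2 * lam ^+ 2 * e4 u.
have [n7 Eq7] := ExZ (expR_ge0 (- Lam)) n6.
have mt : measurable_fun setT (fun y => expR (tilt_up u y)) by exact: measurableT_comp.
have [||nt Et] := Ex_le n7 mt; first by move=> y; exact: expR_ge0.
  move=> y; rewrite /tilt_up -/Lam expRD mulrC ler_wpM2l ?expR_ge0 //.
  apply: (le_trans (expR_le_quad (phiB _))).
  have := phi_sqr (dotp (nv y) u); rewrite exprMn.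
  by move=> /(ler_wpM2l l2); lra.
rewrite -ExE // lee_fin; apply: (le_trans Et); rewrite Eq7 Eq6 Eq4 Eq5 -/(e1 u).
rewrite expRN mulrC ler_pdivrMr ?expR_gt0 // mul1r.
by apply: le_trans (expR_ge1Dx _); rewrite /Lam; lra.
Qed.

Let tilt_down_le1 u : (\int[mu]_y (expR (tilt_down u y))%:E <= 1%:E)%E.
Proof.
have [n4 Eq4] := quartic u; have [np _] := nphi u.
set Lam := lam * e1 u - 2 * lam ^+ 2 * e4 u.
have mt : measurable_fun setT (fun y => expR (- (lam * phi (dotp (nv y) u)))).
  by apply: measurableT_comp => //; apply: measurableT_comp => //; apply: measurable_funM => //; exact: measurable_cst.
have pl y : 0 <= lam * phi (dotp (nv y) u).
  by rewrite mulr_ge0 ?(ltW lam0) //; have /andP[] := phi_bounds (dotp (nv y) u).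
have [n5 Eq5] := ExZ (ltW lam0) np.
(* The linear term is moved to the left so that both sides are nonnegative, as [Ex_le] requires. *)
have [|||n8 E8] := Ex_le (f := fun y => expR (- (lam * phi (dotp (nv y) u))) + lam * phi (dotp (nv y) u)) n4.
- by apply: measurable_funD => //; case: n5.
- by move=> y; rewrite addr_ge0 ?expR_ge0.
- move=> y; have := @expR_le_quad (- (lam * phi (dotp (nv y) u))) _.
  have := pl y => h1 h2; have {}h2 := h2 ltac:(lra); move: h2; rewrite sqrrN exprMn.
  by have := ler_wpM2l l2 (phi_sqr (dotp (nv y) u)); lra.
have [n9 E9] : nnint mu (fun y => expR (- (lam * phi (dotp (nv y) u)))) /\ True.
  split=> //; have [mm _ fin] := n8; split=> //.
  apply: le_lt_trans fin; apply: ge0_le_integral => //.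
  - exact/measurable_EFinP.
  - exact/measurable_EFinP.
  - by move=> y _; rewrite lee_fin lerDl.
have [n10 E10] := ExD n9 n5; rewrite Eq5 in E10.
have [n11 E11] := ExZ (expR_ge0 Lam) n9.
rewrite (eq_integral (fun y => (expR Lam * expR (- (lam * phi (dotp (nv y) u))))%:E)).
  rewrite -ExE // lee_fin E11.
  have h : Ex mu (fun y => expR (- (lam * phi (dotp (nv y) u)))) <= 1 - Lam.
    by move: E8; rewrite E10 Eq4 -/(e1 u) /Lam; lra.
  apply: (le_trans (ler_wpM2l (expR_ge0 _) h)).
  rewrite -[leRHS](expRxMexpNx_1 Lam) ler_pM2l ?expR_gt0 //; exact: expR_ge1Dx.
by move=> y _; rewrite /tilt_down -/Lam expRD mulrC.
Qed.

Let L0_ok : bias_ok (L 0).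
Proof. by rewrite /L -(unbias_smooth N delta sigma 0); exact: bias_ok_unbias. Qed.

Let Xi (tilt : 'cV[R]_d -> U -> R) w :=
  walk (L 0) (fun u => expR (\sum_i tilt u (Xs i w))) 0.

Let Xi_gt0 tilt w : 0 < Xi tilt w.
Proof. by apply: walk_gt0 => // u; exact: expR_gt0. Qed.

Let Xi_Ex tilt : (forall u, measurable_fun setT (tilt u)) ->
  (forall u, (\int[mu]_y (expR (tilt u y))%:E <= 1%:E)%E) ->
  nnint P (Xi tilt) /\ Ex P (Xi tilt) <= 1.
Proof.
move=> mt t1; have nE u := exp_sum_copies (mt u) (t1 u).
have [n1 E1] := Ex_walk 0 L0_ok (fun u => (nE u).1).
split=> //; rewrite /Xi E1 -(walk_cst (L 0) 1 0); apply: walk_le => // u.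
exact: (nE u).2.
Qed.

Section Direction.
Context (v : 'cV[R]_d) (v1 : norm2 v = 1).

Let L_ok : bias_ok (L v). Proof. exact: smooth_ok. Qed.

Lemma entropy_bound tilt w :
  walk (L v) (fun u => \sum_i tilt u (Xs i w)) 0 <= ln (Xi tilt w) + r.
Proof.
apply: le_trans (walk_entropy _ _ L_ok) _.
by rewrite /Xi /L unbias_smooth (smooth_entropy _ v1 Nss).
Qed.

Lemma walk_phi_le y : walk (L v) (fun u => phi (dotp y u)) 0 <= dotp y v ^+ 2 + Z y.
Proof.
apply: (@le_trans _ _ (walk (L v) (fun u => (dotp y u - 0) ^+ 2) 0)).
  by apply: walk_le => // u; rewrite subr0; have /andP[] := phi_bounds (dotp y u).
rewrite (smooth_moment2 v N0 Nds Ndd y 0) subr0 lerD2l.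
by have /andP[] := noise_bounds v1 N0 sigma0 sigma1 Nds Ndd y.
Qed.

Let nZ : nnint mu (fun y => Z (nv y)) /\ Ex mu (fun y => Z (nv y)) = 1.
Proof.
have [n2 E2] := En2; have r00 : 0 <= r^-1 by rewrite invr_ge0 ltW.
by have [nz Ez] := ExZ r00 n2; split=> //; rewrite Ez E2 mulVf // gt_eqF.
Qed.

Let nZ2 : nnint mu (fun y => Z (nv y) ^+ 2) /\ Ex mu (fun y => Z (nv y) ^+ 2) <= K.
Proof.
have [n4 E4'] := En4; have r00 : 0 <= r^-1 ^+ 2 by exact: sqr_ge0.
have [nz Ez] := ExZ r00 n4.
rewrite (_ : (fun y => _) = fun y => r^-1 ^+ 2 * dotp (nv y) (nv y) ^+ 2); last first.
  by apply/funext => y; rewrite /Z exprMn.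
split=> //; rewrite Ez; apply: (le_trans (ler_wpM2l r00 E4')).
by rewrite mulrCA -exprMn mulVf ?gt_eqF // expr1n mulr1.
Qed.

Lemma walk_e4_le : walk (L v) e4 0 <= 40 * K.
Proof.
have [nw Ew] := Ex_walk 0 L_ok E4; rewrite -Ew.
have [n8 E8] := ExZ (ler0n R 8) (E4 v); have [n32 E32] := ExZ (ler0n R 32) nZ2.1.
have [nD ED] := ExD n8 n32.
have [|||_ h] := Ex_le nD (_ : measurable_fun setT (fun y => walk (L v) (fun u => dotp (nv y) u ^+ 4) 0)).
- by case: nw.
- by case: nw.
- by move=> y; exact: (smooth_moment4 v1 sigma0 sigma1 Nds Ndd).
apply: (le_trans h); rewrite ED E8 E32.
by have := E4le v1; have := nZ2.2; lra.
Qed.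

Lemma walk_e1_le : walk (L v) e1 0 <= Q v + 1.
Proof.
have [nw Ew] := Ex_walk 0 L_ok (fun u => (nphi u).1); rewrite -Ew.
have [nq Eq] := EQ v; have [nD ED] := ExD nq nZ.1.
have [|||_ h] := Ex_le nD (_ : measurable_fun setT (fun y => walk (L v) (fun u => phi (dotp (nv y) u)) 0)).
- by case: nw.
- by case: nw.
- by move=> y; exact: walk_phi_le.
by apply: (le_trans h); rewrite ED Eq nZ.2.
Qed.

(** Truncation loses at most a quartic term: z^2 <= phi z + lam z^4, because lam z^2 > 1 once z^2
    exceeds B. The loss r / N is the defect of the noise. *)
Lemma walk_e1_ge : Q v + 1 - r / N%:R - 40 * K * lam <= walk (L v) e1 0.
Proof.
have [n2 E2] := Ex_walk 0 L_ok (fun u => (EQ u).1).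
have [n4 Ew4] := Ex_walk 0 L_ok E4.
have [n1 Ew1] := Ex_walk 0 L_ok (fun u => (nphi u).1).
have [nl El] := ExZ (ltW lam0) n4; have [nD ED] := ExD n1 nl.
have up : walk (L v) (fun u => Ex mu (fun y => dotp (nv y) u ^+ 2)) 0 <=
    walk (L v) e1 0 + lam * walk (L v) e4 0.
  rewrite -E2 -Ew1 -Ew4 -El -ED.
  apply: (Ex_le nD _ _ _).2; [by case: n2|by case: n2|] => y.
  rewrite -walkZ -walkD; apply: walk_le => // u; rewrite /phi /trunc_sqr.
  set z := dotp _ _; have [zB|Bz] := leP (z ^+ 2) B.
    by rewrite lerDl mulr_ge0 ?pow4_ge0 // ltW.
  apply: ler_wpDl; first exact: ltW.
  by rewrite mulrC ler_pdivlMr // pow4E [leRHS]expr2 ler_wpM2l ?sqr_ge0 // ltW.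
have rN0 : 0 <= r^-1 - N%:R^-1 by rewrite subr_ge0 lef_pV2 ?posrE // ltW.
have [nr Er] := ExZ rN0 En2.1; have [nD2 ED2] := ExD (EQ v).1 nr.
have lo : Q v + (r^-1 - N%:R^-1) * r <= walk (L v) (fun u => Ex mu (fun y => dotp (nv y) u ^+ 2)) 0.
  rewrite -E2 -{1}(EQ v).2 -{2}En2.2 -Er -ED2.
  apply: (Ex_le n2 _ _ _).2; [by case: nD2|by case: nD2|] => y.
  rewrite (_ : (fun u => _) = fun u => (dotp (nv y) u - 0) ^+ 2); last by apply/funext => u; rewrite subr0.
  rewrite (smooth_moment2 v N0 Nds Ndd _ 0) subr0 lerD2l mulrBl.
  exact: (noise_ge _ _ v1).
have := walk_e4_le => h4; have := ler_wpM2l (ltW lam0) h4.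
rewrite (_ : (r^-1 - N%:R^-1) * r = 1 - r / N%:R) in lo; last by rewrite mulrBl mulVf ?gt_eqF // [_^-1 * r]mulrC.
by move: (le_trans lo up); lra.
Qed.

Let W y := Num.min (Z y) (4 * Z y ^+ 2 / q ^+ 2).

Lemma walk_phi_ge y :
  trunc_sqr (q ^+ 2) (dotp y v) + Z y - r / N%:R * Z y - 400 * W y <=
  walk (L v) (fun u => phi (dotp y u)) 0.
Proof.
have [m hm] := trunc_sqr_lower (dotp y v) q0.
set a := dotp y v in hm *.
(* Completing the square absorbs the linear term 2 m g, with g = <y, u> - a, so that the second
   moment about the centre a - m can be used; the slope m then disappears. *)
pose F u := trunc_sqr (q ^+ 2) a - m ^+ 2 + (dotp y u - (a - m)) ^+ 2
  - 400 * Num.min ((dotp y u - a) ^+ 2) ((dotp y u - a) ^+ 4 / q ^+ 2).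
apply: (@le_trans _ _ (walk (L v) F 0)); last first.
  apply: walk_le => // u; have := hm (dotp y u - a).
  have -> : a + (dotp y u - a) = dotp y u by ring.
  apply: le_trans; rewrite /F lerD2r; set z := dotp y u; lra.
have q2 : 0 < q ^+ 2 by rewrite exprn_gt0.
have -> : walk (L v) F 0 = trunc_sqr (q ^+ 2) a - m ^+ 2 + (m ^+ 2 + noise N r v y)
   - 400 * walk (L v) (fun u => Num.min ((dotp y u - a) ^+ 2) ((dotp y u - a) ^+ 4 / q ^+ 2)) 0.
  rewrite /F walkD walkD walk_cst (smooth_moment2 v N0 Nds Ndd) -/a.
  rewrite (_ : (fun y0 => _) = fun y0 => (- 400) * Num.min ((dotp y y0 - a) ^+ 2) ((dotp y y0 - a) ^+ 4 / q ^+ 2)); last first.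
    by apply/funext => u; rewrite mulNr.
  by rewrite walkZ; congr (_ + _ + _); [congr (_ + _); ring|rewrite mulNr].
have err : walk (L v) (fun u => Num.min ((dotp y u - a) ^+ 2) ((dotp y u - a) ^+ 4 / q ^+ 2)) 0 <= W y.
  apply: (le_trans (walk_min_le _ _ _ L_ok)); rewrite /W le_min !ge_min; apply/andP; split.
    apply/orP; left; rewrite (smooth_moment2 v N0 Nds Ndd y a) subrr expr0n add0r.
    by have /andP[] := noise_bounds v1 N0 sigma0 sigma1 Nds Ndd y.
  apply/orP; right.
  rewrite (_ : (fun u => _) = fun u => (q ^+ 2)^-1 * (dotp y u - a) ^+ 4); last by apply/funext => u; rewrite mulrC.
  rewrite walkZ mulrC ler_wpM2r ?invr_ge0 ?(ltW q2) //.
  exact: (smooth_moment4_centered v1 sigma0 sigma1 Nds Ndd).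
have := noise_ge N r v1 y; rewrite -/(Z y).
have -> : N%:R^-1 * dotp y y = r / N%:R * Z y by rewrite /Z; field; rewrite !gt_eqF.
move: err; lra.
Qed.

End Direction.

(** The difference between n and the sum of the Z is what remains of the smoothing: every smoothed
    sample gains about Z, and every smoothed expectation at most 1. *)
Lemma bulk_upper : exists Xi : T -> R, [/\ nnint P Xi, Ex P Xi <= 1, forall w, 0 < Xi w &
  forall w v, norm2 v = 1 ->
    \sum_i trunc_sqr (q ^+ 2) (dotp (x w i) v) <=
    n%:R * Q v + n%:R - \sum_i Z (x w i) + r / N%:R * \sum_i Z (x w i)
    + 400 * \sum_i Num.min (Z (x w i)) (4 * Z (x w i) ^+ 2 / q ^+ 2)
    + n%:R * (80 * K * lam) + (ln (Xi w) + r) / lam].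
Proof.
have [nX EX] := Xi_Ex mtilt_up tilt_up_le1.
exists (Xi tilt_up); split=> // w v v1.
have := entropy_bound v1 tilt_up w.
rewrite walk_sum.
have tE i : walk (L v) (fun u => tilt_up u (Xs i w)) 0 =
    lam * walk (L v) (fun u => phi (dotp (x w i) u)) 0 - (lam * walk (L v) e1 0 + 2 * lam ^+ 2 * walk (L v) e4 0).
  rewrite /tilt_up walkD walkZ; congr (_ + _).
  rewrite (_ : (fun u => _) = fun u => (- 1) * (lam * e1 u + 2 * lam ^+ 2 * e4 u)); last first.
    by apply/funext => u; rewrite mulN1r.
  by rewrite walkZ mulN1r walkD !walkZ.
under eq_bigr do rewrite tE.
rewrite sumrB -mulr_sumr sumr_const card_ord -[_ *+ n]mulr_natl => h.
have h1 : \sum_i (trunc_sqr (q ^+ 2) (dotp (x w i) v) + Z (x w i) - r / N%:R * Z (x w i)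
     - 400 * Num.min (Z (x w i)) (4 * Z (x w i) ^+ 2 / q ^+ 2)) <=
     \sum_i walk (L v) (fun u => phi (dotp (x w i) u)) 0.
  by apply: ler_sum => i _; exact: (walk_phi_ge v1).
have {}h1 : \sum_i trunc_sqr (q ^+ 2) (dotp (x w i) v) + \sum_i Z (x w i) - r / N%:R * \sum_i Z (x w i)
    - 400 * \sum_i Num.min (Z (x w i)) (4 * Z (x w i) ^+ 2 / q ^+ 2) <=
    \sum_i walk (L v) (fun u => phi (dotp (x w i) u)) 0.
  apply: le_trans h1; rewrite [X in _ - X - _]mulr_sumr [X in _ - X]mulr_sumr.
  by rewrite -big_split /= -!sumrB.
have h2 := walk_e1_le v1; have h3 := walk_e4_le v1.
have n0 : 0 <= n%:R :> R by rewrite ler0n.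
have h4 : n%:R * (lam * walk (L v) e1 0 + 2 * lam ^+ 2 * walk (L v) e4 0) <=
    n%:R * (lam * (Q v + 1) + 2 * lam ^+ 2 * (40 * K)).
  apply: ler_wpM2l => //; apply: lerD; apply: ler_wpM2l => //; exact: ltW.
have h5 : \sum_i walk (L v) (fun u => phi (dotp (x w i) u)) 0 <=
    (n%:R * (lam * (Q v + 1) + 2 * lam ^+ 2 * (40 * K)) + (ln (Xi tilt_up w) + r)) / lam.
  by rewrite ler_pdivlMr //; move: h h4; lra.
have E : n%:R * (80 * K * lam) + (ln (Xi tilt_up w) + r) / lam =
   (n%:R * (lam * (Q v + 1) + 2 * lam ^+ 2 * (40 * K)) + (ln (Xi tilt_up w) + r)) / lam - n%:R * (Q v + 1).
  by field; rewrite gt_eqF.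
move: h1 h5 E; lra.
Qed.

Lemma bulk_lower : exists Xi : T -> R, [/\ nnint P Xi, Ex P Xi <= 1, forall w, 0 < Xi w &
  forall w v, norm2 v = 1 ->
    n%:R * Q v <= \sum_i dotp (x w i) v ^+ 2 + \sum_i Z (x w i) - n%:R + n%:R * (r / N%:R)
    + n%:R * (120 * K * lam) + (ln (Xi w) + r) / lam].
Proof.
have [nX EX] := Xi_Ex mtilt_down tilt_down_le1.
exists (Xi tilt_down); split=> // w v v1.
have := entropy_bound v1 tilt_down w.
rewrite walk_sum.
have tE i : walk (L v) (fun u => tilt_down u (Xs i w)) 0 =
    - lam * walk (L v) (fun u => phi (dotp (x w i) u)) 0 + (lam * walk (L v) e1 0 - 2 * lam ^+ 2 * walk (L v) e4 0).
  rewrite /tilt_down walkD.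
  rewrite (_ : (fun u => - _) = fun u => - lam * phi (dotp (x w i) u)); last first.
    by apply/funext => u; rewrite mulNr.
  rewrite walkZ; congr (_ + _).
  rewrite (_ : (fun u => _) = fun u => lam * e1 u + (- (2 * lam ^+ 2)) * e4 u); last first.
    by apply/funext => u; rewrite mulNr.
  by rewrite walkD !walkZ mulNr.
under eq_bigr do rewrite tE.
rewrite big_split /= -mulr_sumr sumr_const card_ord -[_ *+ n]mulr_natl => h.
have h1 : \sum_i walk (L v) (fun u => phi (dotp (x w i) u)) 0 <=
    \sum_i (dotp (x w i) v ^+ 2 + Z (x w i)).
  by apply: ler_sum => i _; exact: (walk_phi_le v1).
rewrite big_split /= in h1.
have h2 := walk_e1_ge v1; have h3 := walk_e4_le v1.
have n0 : 0 <= n%:R :> R by rewrite ler0n.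
have h4 : n%:R * (lam * (Q v + 1 - r / N%:R - 40 * K * lam) - 2 * lam ^+ 2 * (40 * K)) <=
    n%:R * (lam * walk (L v) e1 0 - 2 * lam ^+ 2 * walk (L v) e4 0).
  apply: ler_wpM2l => //; apply: lerB; apply: ler_wpM2l => //; exact: ltW.
have h6 := ler_wpM2l (ltW lam0) h1.
have -> : (ln (Xi tilt_down w) + r) / lam = lam^-1 * (ln (Xi tilt_down w) + r) by rewrite mulrC.
have h7 : n%:R * (lam * (Q v + 1 - r / N%:R - 40 * K * lam) - 2 * lam ^+ 2 * (40 * K))
   - lam * (\sum_i dotp (x w i) v ^+ 2 + \sum_i Z (x w i)) <= ln (Xi tilt_down w) + r.
  by move: h h4 h6; lra.
have li : 0 <= lam^-1 by rewrite invr_ge0 ltW.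
have := ler_wpM2l li h7.
have -> : lam^-1 * (n%:R * (lam * (Q v + 1 - r / N%:R - 40 * K * lam) - 2 * lam ^+ 2 * (40 * K))
   - lam * (\sum_i dotp (x w i) v ^+ 2 + \sum_i Z (x w i))) =
   n%:R * (Q v + 1 - r / N%:R - 120 * K * lam) - (\sum_i dotp (x w i) v ^+ 2 + \sum_i Z (x w i)).
  by field; rewrite !gt_eqF.
lra.
Qed.

End Bulk.

(** * Counting the hits *)

Section Multiplicities.
Context (n : nat).

Lemma sum_count (V : nmodType) (s : seq 'I_n) (F : 'I_n -> V) :
  \sum_(j <- s) F j = \sum_j F j *+ count_mem j s.
Proof.
elim: s => [|i s IH]; first by rewrite big_nil big1 // => j _; rewrite mulr0n.
rewrite big_cons IH [in RHS](eq_bigr (fun j => F j *+ (i == j) + F j *+ count_mem j s)).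
  rewrite big_split /= [X in _ = X + _](bigD1 i) //= eqxx [X in _ = _ + X + _]big1 ?addr0 // => j.
  by rewrite eq_sym => /negbTE ->.
by move=> j _; rewrite -mulrnDr.
Qed.

Lemma expr_count (R : comPzRingType) (x : R) (s : seq 'I_n) :
  x ^+ size s = \prod_j x ^+ count_mem j s.
Proof.
elim: s => [|i s IH]; first by rewrite big1.
rewrite /= exprS IH [in RHS](eq_bigr (fun j => x ^+ (i == j) * x ^+ count_mem j s)).
  rewrite big_split /= [X in _ = X * _](bigD1 i) //= eqxx [X in _ = _ * X * _]big1 ?mulr1 // => j.
  by rewrite eq_sym => /negbTE ->.
by move=> j _; rewrite -exprD.
Qed.

End Multiplicities.

Section Hit_count.
Context (R : realType) (d n : nat).

(* [xi j] holds separate multiplicities of [x j] and [- x j], so that the sum over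
   [xi] in [hit_sum] factors over [j]. *)
Definition combine (xi : {ffun 'I_n -> 'I_n.+1 * 'I_n.+1}) (x : 'I_n -> 'cV[R]_d) : 'cV[R]_d :=
  \sum_j ((xi j).1%:R - (xi j).2%:R) *: x j.

(** Equal nonzero multiplicities would also cancel in [combine]; asking for both to vanish
    corresponds to an index that was never drawn. *)
Definition unused (xi : {ffun 'I_n -> 'I_n.+1 * 'I_n.+1}) : {set 'I_n} :=
  [set j | xi j == (ord0, ord0)]%SET.

Definition hit (tau : R) (u y : 'cV[R]_d) : bool := tau * norm2 u < `|dotp y u|.

(** A generating function in place of a union bound over all signed sequences: z weighs a draw and K
    a hit. It dominates each of its terms, while its expectation factors. *)
Definition hit_sum (z K tau : R) (x : 'I_n -> 'cV[R]_d) : R :=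
  \sum_(xi : {ffun 'I_n -> 'I_n.+1 * 'I_n.+1}) (\prod_j z ^+ ((xi j).1 + (xi j).2)) *
    \prod_(i in unused xi) (1 + K * (hit tau (combine xi x) (x i))%:R).

Lemma hit_sum_ge (z K tau : R) x (s : seq 'I_n) sg : 0 <= z -> 1 <= K ->
  (size s <= n)%N -> z ^+ size s * K ^+ #|large_set x tau s sg| <= hit_sum z K tau x.
Proof.
move=> z0 K1 sn; have cn j : (count_mem j s < n.+1)%N.
  by rewrite ltnS (leq_trans (count_size _ _)).
have K0 : 0 <= K by apply: le_trans K1.
pose xi : {ffun 'I_n -> 'I_n.+1 * 'I_n.+1} :=
  [ffun j => if sg j then (ord0, Ordinal (cn j)) else (Ordinal (cn j), ord0)].
have uE : combine xi x = signed_sum x s sg.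
  rewrite /signed_sum sum_count; apply: eq_bigr => j _.
  rewrite ffunE; case: (sg j) => /=; rewrite ?sub0r ?subr0 ?expr0 ?expr1.
    by rewrite scaleN1r mulNrn scaleNr scaler_nat.
  by rewrite scale1r scaler_nat.
have term0 (xi' : {ffun 'I_n -> 'I_n.+1 * 'I_n.+1}) : 0 <= (\prod_j z ^+ ((xi' j).1 + (xi' j).2)) *
    \prod_(i in unused xi') (1 + K * (hit tau (combine xi' x) (x i))%:R).
  apply: mulr_ge0; apply: prodr_ge0 => j _; first exact: exprn_ge0.
  by rewrite addr_ge0 // mulr_ge0.
rewrite /hit_sum (bigD1 xi) //=; apply: ler_wpDr; first exact: sumr_ge0.
have -> : \prod_j z ^+ ((xi j).1 + (xi j).2) = z ^+ size s.
  by rewrite expr_count; apply: eq_bigr => j _; rewrite ffunE; case: (sg j); rewrite ?add0n ?addn0.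
apply: ler_wpM2l; first exact: exprn_ge0.
have sub : large_set x tau s sg \subset unused xi.
  apply/fintype.subsetP => i; rewrite !inE => /andP[si _].
  have c0 : Ordinal (cn i) = ord0 by apply/val_inj/count_memPn.
  by rewrite ffunE c0; case: (sg i).
rewrite (finset.big_setID (large_set x tau s sg)) /= (finset.setIidPr sub).
rewrite -[leLHS]mulr1; apply: ler_pM; rewrite ?exprn_ge0 //.
  rewrite -prodr_const; apply: ler_prod => i; rewrite inE uE => /andP[_ hi].
  by rewrite K0 /hit hi mulr1 lerDr ler01.
apply: (big_ind (fun y => 1 <= y)) => // [a b a1 b1|i _]; last by rewrite lerDl mulr_ge0.
by rewrite -[leLHS]mulr1 ler_pM.
Qed.

Lemma sum_expr_le (z : R) N : 0 <= z -> z <= 1 / 2 -> \sum_(k < N) z ^+ k <= expR (2 * z).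
Proof.
move=> z0 z1; have h : (\sum_(k < N) z ^+ k) * (1 - z) <= 1.
  have := subrX1 z N; have := exprn_ge0 N z0; set S := \sum_(k < N) _; lra.
apply: le_trans (expR_ge1Dx _); have s0 : 0 <= \sum_(k < N) z ^+ k by apply: sumr_ge0 => k _; exact: exprn_ge0.
nra.
Qed.

End Hit_count.

Lemma measurable_natr_bool d0 (U : measurableType d0) (R : realType) (b : U -> bool) :
  measurable_fun setT b -> measurable_fun setT (fun x => (b x)%:R : R).
Proof.
move=> mb; rewrite (_ : (fun x => _) = fun x => if b x then 1 else 0); first exact: measurable_fun_ifT.
by apply/funext => x; case: (b x).
Qed.

Section Hit_expectation.
Context d0 d1 (T : measurableType d0) (U : measurableType d1) (R : realType).
Context (P : probability T R) (n : nat) (X : {RV P >-> U}) (Xs : 'I_n -> {RV P >-> U}).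
Hypothesis iid : iid_copies X Xs.
Let mu := distribution P X.
Context (d : nat) (nv : U -> 'cV[R]_d).
Hypothesis mnv : forall j, measurable_fun setT (fun x => nv x j 0).
Context (p Kp : R).
Hypothesis (p0 : 0 < p) (Kp0 : 0 <= Kp).
Hypothesis EP : forall u, (\int[mu]_x (`|dotp (nv x) u| `^ p)%:E <= (Kp * norm2 u `^ p)%:E)%E.

(** Markov's inequality for the p-th power. For u = 0 the strict inequality in [hit] rules out a
    hit. *)
Lemma hit_probability (u : 'cV[R]_d) (tau K : R) : 0 < tau -> 0 <= K ->
  (\int[mu]_x (1 + K * (hit tau u (nv x))%:R)%:E <= (1 + K * Kp * tau `^ (- p))%:E)%E.
Proof.
move=> t0 K0; have [u0|u0] := eqVneq (norm2 u) 0.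
  rewrite (eq_integral (fun=> 1%E)) => [|y _]; last first.
    by rewrite /hit (norm2_eq0 u0) dotp0r normr0 /norm2 dotp0l sqrtr0 mulr0 ltxx mulr0 addr0.
  rewrite (integral_cst mu measurableT 1%:E) mul1e; apply: (@le_trans _ _ 1%E).
    exact: probability_le1.
  by rewrite lee_fin lerDl mulr_ge0 ?powR_ge0 // mulr_ge0.
have u1 : 0 < norm2 u by rewrite lt_def u0 norm2_ge0.
pose c := K * (tau * norm2 u) `^ (- p).
have c0 : 0 <= c by rewrite mulr_ge0 ?powR_ge0.
have mp : measurable_fun setT (fun x => `|dotp (nv x) u| `^ p).
  apply: (measurableT_comp (measurable_powR p)).
  by apply: measurableT_comp => //; exact: measurable_dotp.
have [n1 E1] := nnint_bound mp (fun x => powR_ge0 _ _) (EP u).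
have [n2 E2] := ExZ c0 n1; have [n3 E3] := @Ex_cst _ _ _ mu 1 ler01.
have [n4 E4] := ExD n3 n2.
apply: (@le_trans _ _ (\int[mu]_x (1 + c * `|dotp (nv x) u| `^ p)%:E)%E).
  apply: ge0_le_integral => //.
  - by move=> x _; rewrite lee_fin addr_ge0 // mulr_ge0.
  - apply/measurable_EFinP; apply: measurable_funD => //; apply: measurable_funM => //.
    apply: measurable_natr_bool; apply: measurable_fun_ltr; first exact: measurable_cst.
    by apply: measurableT_comp => //; exact: measurable_dotp.
  - by apply/measurable_EFinP; case: n4.
  move=> x _; rewrite lee_fin lerD2l /c -mulrA ler_wpM2l //.
  rewrite /hit; case: ltP => h /=; last by rewrite mulr_ge0 ?powR_ge0.
  rewrite powRN mulrC ler_pdivlMr ?powR_gt0 ?mulr_gt0 // mul1r.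
  by rewrite ge0_ler_powR ?nnegrE ?(ltW p0) ?(ltW h) // mulr_ge0 // ltW.
rewrite -ExE // lee_fin E4 E3 E2 lerD2l /c -!mulrA ler_wpM2l //.
apply: (le_trans (ler_wpM2l (powR_ge0 _ _) E1)).
rewrite powRM ?(ltW t0) ?(ltW u1) //.
rewrite mulrC -!mulrA ler_wpM2l // [leLHS]mulrCA [norm2 u `^ p * _]mulrC.
by rewrite [norm2 u `^ (- p)]powRN mulVf ?mulr1 // gt_eqF // powR_gt0.
Qed.

Let feature (z : n.-tuple U) (i : 'I_n) := nv (tnth z i).

Lemma measurable_combine xi j :
  measurable_fun setT (fun z : n.-tuple U => combine xi (feature z) j 0).
Proof.
rewrite (_ : (fun z => _) = fun z => \sum_i ((xi i).1%:R - (xi i).2%:R) * feature z i j 0); last first.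
  by apply/funext => z; rewrite summxE; apply: eq_bigr => i _; rewrite mxE.
apply: measurable_sum => i; apply: measurable_funM; first exact: measurable_cst.
by apply: (measurableT_comp (mnv j)); exact: measurable_tnth.
Qed.

Lemma measurable_hit xi tau (K : R) :
  measurable_fun setT (fun q : n.-tuple U * U => 1 + K * (hit tau (combine xi (feature q.1)) (nv q.2))%:R).
Proof.
have mc j : measurable_fun setT (fun q : n.-tuple U * U => combine xi (feature q.1) j 0).
  exact: (measurableT_comp (measurable_combine xi j) measurable_fst).
apply: measurable_funD => //; apply: measurable_funM => //.
apply: measurable_natr_bool; apply: measurable_fun_ltr.
  apply: measurable_funM => //; rewrite /norm2 /=.
  apply: measurableT_comp; first exact: continuous_measurable_fun (@sqrt_continuous R).
  by apply: measurable_sum => j; apply: measurable_funM.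
apply: measurableT_comp => //; apply: measurable_sum => j; apply: measurable_funM => //.
exact: (measurableT_comp (mnv j) measurable_snd).
Qed.

Lemma hit_sum_expectation (z K tau : R) : 0 <= z -> z <= 1 / 2 -> 0 <= K -> 0 < tau ->
  let Xi w := hit_sum z K tau (fun i => nv (Xs i w)) in
  nnint P Xi /\ Ex P Xi <= expR (n%:R * (4 * z + K * Kp * tau `^ (- p))).
Proof.
move=> z0 z1 K0 t0 Xi; have [w0] := probability_inhabited P.
pose W (xi : {ffun 'I_n -> 'I_n.+1 * 'I_n.+1}) : R := \prod_j z ^+ ((xi j).1 + (xi j).2).
have W0 xi : 0 <= W xi by apply: prodr_ge0 => j _; exact: exprn_ge0.
pose c := K * Kp * tau `^ (- p).
have c0 : 0 <= c by rewrite mulr_ge0 ?powR_ge0 // mulr_ge0.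
pose G xi w : R := \prod_(i in unused xi) (1 + K * (hit tau (combine xi (fun i => nv (Xs i w))) (nv (Xs i w)))%:R).
have fE w i : feature (sample Xs w) i = nv (Xs i w) by rewrite /feature tnth_mktuple.
have combE xi w : combine xi (feature (sample Xs w)) = combine xi (fun i => nv (Xs i w)).
  by apply: eq_bigr => i _; rewrite fE.
have nG xi : nnint P (G xi) /\ Ex P (G xi) <= expR (n%:R * c).
  have GE : G xi = fun w => \prod_(i in unused xi) (1 + K * (hit tau (combine xi (feature (sample Xs w))) (nv (Xs i w)))%:R).
    by apply/funext => w; apply: eq_bigr => i _; rewrite combE.
  apply: nnint_bound.
  - rewrite GE; apply: measurable_prod_pred => k.
    apply: (@measurableT_comp _ _ _ _ _ _ (fun q : n.-tuple U * U => 1 + K * (hit tau (combine xi (feature q.1)) (nv q.2))%:R) _ (fun w => (sample Xs w, Xs k w))).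
      exact: measurable_hit.
    by apply: measurable_fun_pair; [exact: measurable_sample|exact: measurable_funPT].
  - by move=> w; apply: prodr_ge0 => i _; rewrite addr_ge0 // mulr_ge0.
  have := @integral_prod_le _ _ _ _ _ _ _ _ _ iid (X w0) (unused xi)
    (fun _ z x => 1 + K * (hit tau (combine xi (feature z)) (nv x))%:R) (fun=> 1 + c).
  rewrite GE => H; apply: le_trans (le_trans (H _ _ _ _ _) _).
  - by [].
  - by move=> k; exact: measurable_hit.
  - by move=> k y x; rewrite addr_ge0 // mulr_ge0.
  - by move=> k; rewrite addr_ge0.
  - move=> k j y x _ ju; congr (1 + K * (hit _ _ _)%:R); apply: eq_bigr => i _.
    rewrite /feature tnth_mktuple; case: (eqVneq i j) => // ->.
    by move: ju; rewrite inE => /eqP -> /=; rewrite subrr !scale0r.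
  - by move=> k y _; exact: hit_probability.
  rewrite lee_fin prodr_const; apply: (@le_trans _ _ ((1 + c) ^+ n)).
    rewrite ler_weXn2l ?lerDl //; apply: leq_trans (max_card _) _; by rewrite card_ord.
  rewrite expRM_natl lerXn2r ?nnegrE ?expR_ge0 ?addr_ge0 //; exact: expR_ge1Dx.
have nWG xi : nnint P (fun w => W xi * G xi w) /\ Ex P (fun w => W xi * G xi w) = W xi * Ex P (G xi).
  exact: ExZ (W0 xi) (nG xi).1.
have [nX EX] := @Ex_sum _ _ _ P _ (index_enum _) (fun xi w => W xi * G xi w) (fun xi => (nWG xi).1).
split=> //; rewrite EX; apply: (@le_trans _ _ (\sum_xi W xi * expR (n%:R * c))).
  by apply: ler_sum => xi _; rewrite (nWG xi).2 ler_wpM2l // (nG xi).2.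
rewrite -mulr_suml mulrDr expRD ler_wpM2r ?expR_ge0 //.
(* Each j contributes two truncated geometric series, one for each sign and each at most exp(2 z):
   hence the exponent 4 z. *)
have -> : \sum_xi W xi = \prod_(j < n) \sum_(q : 'I_n.+1 * 'I_n.+1) z ^+ (q.1 + q.2).
  by rewrite bigA_distr_bigA.
rewrite prodr_const card_ord expRM_natl lerXn2r ?nnegrE ?expR_ge0 //.
  by apply: sumr_ge0 => q _; exact: exprn_ge0.
rewrite -(pair_bigA _ (fun a b : 'I_n.+1 => z ^+ (a + b))) /=.
have -> : 4 * z = 2 * z + 2 * z by ring.
rewrite expRD; apply: (@le_trans _ _ ((\sum_(k < n.+1) z ^+ k) * \sum_(k < n.+1) z ^+ k)).
  rewrite mulr_suml; apply: ler_sum => a _; rewrite mulr_sumr; apply: ler_sum => b _.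
  by rewrite exprD.
by apply: ler_pM; rewrite ?sum_expr_le //; apply: sumr_ge0 => k _; exact: exprn_ge0.
Qed.

End Hit_expectation.

Section Mixture.
Context d0 (T : measurableType d0) (R : realType) (P : probability T R).

Lemma sum_halves k : \sum_(0 <= j < k) (2 ^+ j.+1)^-1 = 1 - (2 ^+ k)^-1 :> R.
Proof.
elim: k => [|k IH]; first by rewrite big_geq // expr0 invr1 subrr.
rewrite big_nat_recr //= IH exprS; field.
by rewrite expf_neq0.
Qed.

(** The weights add up to 1, so one variable of mean at most 1 serves all levels, at the price of a
    factor 2^(j+1). It has extended values, since the series may diverge at some points. *)
Lemma mixture (f : nat -> T -> R) : (forall j, nnint P (f j) /\ Ex P (f j) <= 1) ->
  exists Xi : T -> \bar R, [/\ measurable_fun setT Xi, forall w, (0 <= Xi w)%E,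
    (\int[P]_w Xi w <= 1)%E & forall j w, (((2 ^+ j.+1)^-1 * f j w)%:E <= Xi w)%E].
Proof.
move=> nf; pose g j w := (2 ^+ j.+1)^-1 * f j w.
have c0 j : 0 <= (2 ^+ j.+1)^-1 :> R by rewrite invr_ge0 exprn_ge0.
have ng j : nnint P (g j) /\ Ex P (g j) <= (2 ^+ j.+1)^-1.
  have [n1 E1] := nf j; have [n2 E2] := ExZ (c0 j) n1; split=> //.
  by rewrite E2 ler_piMr.
have g0 j w : (0 <= (g j w)%:E)%E by rewrite lee_fin; have [[_ ? _] _] := ng j.
have mg j : measurable_fun setT (EFin \o g j) by apply/measurable_EFinP; have [[]] := ng j.
exists (fun w => \sum_(0 <= j <oo) (g j w)%:E)%E; split.
- apply: (ge0_emeasurable_sum (P := xpredT)); first by move=> j w _ _; exact: g0.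
  by move=> j _; exact: mg.
- by move=> w; apply: nneseries_ge0.
- rewrite integral_nneseries //; apply: lime_le; first by apply: is_cvg_nneseries => j _ _; exact: integral_ge0.
  apply: nearW => k; apply: (@le_trans _ _ (\sum_(0 <= j < k) (2 ^+ j.+1)^-1)%:E).
    rewrite -sumEFin; apply: lee_sum => j _; rewrite -ExE ?lee_fin; [exact: (ng j).2|exact: (ng j).1].
  by rewrite lee_fin sum_halves gerBl invr_ge0 exprn_ge0.
move=> j w; apply: le_trans (nneseries_lim_ge j.+1 _) => //.
by rewrite big_nat_recr //= leeDr // sume_ge0.
Qed.

End Mixture.

Section Few_hits.
Context d0 d1 (T : measurableType d0) (U : measurableType d1) (R : realType).
Context (P : probability T R) (n : nat) (X : {RV P >-> U}) (Xs : 'I_n -> {RV P >-> U}).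
Hypothesis iid : iid_copies X Xs.
Let mu := distribution P X.
Context (d : nat) (nv : U -> 'cV[R]_d).
Hypothesis mnv : forall j, measurable_fun setT (fun x => nv x j 0).
Context (p Kp : R).
Hypothesis (p4 : 4 < p) (Kp0 : 0 <= Kp).
Hypothesis EP : forall u, (\int[mu]_x (`|dotp (nv x) u| `^ p)%:E <= (Kp * norm2 u `^ p)%:E)%E.

Lemma half_le_ln2 : 1 / 2 <= ln 2 :> R.
Proof.
have h : (-1 : R) < - (1 / 2) by lra.
have := le_ln1Dx h; have -> : 1 - 1 / 2 = 2^-1 :> R by field.
by rewrite lnV ?posrE //; lra.
Qed.

Lemma few_hits (t0 : R) : 2 <= t0 ->
  let C1 := 4 + Kp * 192 `^ p in
  exists Xi : T -> \bar R, [/\ measurable_fun setT Xi, forall w, (0 <= Xi w)%E,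
    (\int[P]_w Xi w <= 1)%E & forall w y, Xi w = y%:E -> forall j s sg, (size s <= n)%N ->
    #|large_set (fun i => nv (Xs i w)) (32^-1 * (t0 * 2 ^+ j) / 6) s sg|%:R <=
    4 / (p - 4) * (size s)%:R +
    (1 + 2 * ln (1 + y) + 2 * C1 * n%:R * (t0 * 2 ^+ j) ^- 4) / (p - 4)].
Proof.
move=> t02 C1; have p0 : 0 < p by apply: lt_trans p4.
have C10 : 0 <= C1 by rewrite addr_ge0 // mulr_ge0 // powR_ge0.
pose t j := t0 * 2 ^+ j.
have t2 j : 2 ^+ j.+1 <= t j by rewrite exprS ler_wpM2r // exprn_ge0.
have t0' j : 0 < t j by apply: lt_le_trans (t2 j); rewrite exprn_gt0.
have tge2 j : 2 <= t j by apply: le_trans (t2 j); rewrite exprS ler_peMr // exprn_ege1 // ler1n.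
have t1 j : 1 <= t j by apply: le_trans (tge2 j); rewrite ler1n.
pose z j := (t j) ^- 4; pose K j := t j `^ (p - 4); pose tau j := 32^-1 * t j / 6.
have tau0 j : 0 < tau j by rewrite divr_gt0 // mulr_gt0.
have z0 j : 0 <= z j by rewrite invr_ge0 exprn_ge0 // ltW.
have z1 j : z j <= 1 / 2.
  rewrite div1r lef_pV2 ?posrE ?exprn_gt0 //; apply: le_trans (tge2 j) _.
  by rewrite -[leLHS]expr1 ler_weXn2l.
have K1 j : 1 <= K j.
  by rewrite -(powRr0 (t j)) ler_powR // subr_ge0 ltW.
pose A j := C1 * n%:R * z j.
have AE j : n%:R * (4 * z j + K j * Kp * tau j `^ (- p)) = A j.
  have -> : tau j `^ (- p) = 192 `^ p * t j `^ (- p).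
    have -> : tau j = 192^-1 * t j by rewrite /tau; field.
    by rewrite powRM ?invr_ge0 ?(ltW (t0' j)) // -powR_inv1 // -powRrM mulrNN mul1r.
  have zE : z j = K j * t j `^ (- p).
    rewrite /z /K -powRD ?(gt_eqF (t0' j)) ?implybT //.
    have -> : p - 4 - p = - 4%:R by lra.
    by rewrite powRN powR_mulrn // ltW.
  rewrite /A /C1 zE; ring.
pose f j w := expR (- A j) * hit_sum (z j) (K j) (tau j) (fun i => nv (Xs i w)).
have nf j : nnint P (f j) /\ Ex P (f j) <= 1.
  have [n1 E1] := hit_sum_expectation iid mnv p0 Kp0 EP (z0 j) (z1 j) (le_trans ler01 (K1 j)) (tau0 j).
  have [n2 E2] := ExZ (expR_ge0 (- A j)) n1; split=> //; rewrite E2.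
  apply: (le_trans (ler_wpM2l (expR_ge0 _) E1)).
  by rewrite AE -expRD addNr expR0.
have [Xi [mX X0 X1 Xf]] := mixture nf; exists Xi; split=> // w y yE j s sg sn.
set L := large_set _ _ _ _; rewrite -/(t j).
have y0 : 0 <= y by rewrite -lee_fin -yE.
have hy : hit_sum (z j) (K j) (tau j) (fun i => nv (Xs i w)) <= expR (A j) * (2 ^+ j.+1 * (1 + y)).
  have := Xf j w; rewrite yE lee_fin /f mulrCA => h.
  have e0 := expR_gt0 (A j); have c0 : 0 < 2 ^+ j.+1 :> R by rewrite exprn_gt0.
  rewrite -ler_pdivrMl // -ler_pdivrMl //.
  by rewrite mulrCA -expRN (le_trans h) // lerDr.
have := le_trans (hit_sum_ge (tau j) (fun i => nv (Xs i w)) sg (z0 j) (K1 j) sn) hy.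
rewrite -/L; set a := ln (t j).
have tE : t j = expR a by rewrite lnK // posrE.
have -> : z j = expR (- (4 * a)) by rewrite /z tE -expRM_natl expRN.
have -> : K j = expR ((p - 4) * a) by rewrite /K /powR gt_eqF.
rewrite -!expRM_natl -expRD.
have pos : 0 < 2 ^+ j.+1 * (1 + y) by rewrite mulr_gt0 ?exprn_gt0 // ltr_pwDl.
rewrite -[_ * (1 + y)]lnK ?posrE // -expRD ler_expR lnM ?posrE ?exprn_gt0 ?ltr_pwDl //.
(* After division by a = ln t the mixture weight contributes at most 1, because t >= 2^(j+1), and a
   >= 1/2 accounts for the factors 2. *)
have l2 : ln (2 ^+ j.+1) <= a by rewrite ler_ln ?posrE ?exprn_gt0.
have a2 : 1 / 2 <= a by apply: le_trans half_le_ln2 _; rewrite ler_ln ?posrE.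
have A0 : 0 <= A j by rewrite /A !mulr_ge0.
have y1 : 0 <= ln (1 + y) by rewrite ln_ge0 // lerDl.
have p40 : 0 < p - 4 by rewrite subr_gt0.
move=> h; rewrite mulrAC -mulrDl ler_pdivlMr //.
have a0 : 0 < a by lra.
rewrite -(ler_pM2r a0).
have h3 := mulr_ge0 (addr_ge0 A0 y1) (_ : 0 <= 2 * a - 1).
have {}h3 := h3 ltac:(lra).
have -> : 2 * C1 * n%:R * t j ^- 4 = 2 * A j by rewrite /A /z; ring.
lra.
Qed.

End Few_hits.

(** * Sum over the dyadic levels *)

Section Logarithm_bounds.
Context (R : realType).

Lemma ln1p_sqr_le (y : R) : 0 <= y -> ln (1 + y) ^+ 2 <= 4 * y.
Proof.
move=> y0; have y1 : 0 < 1 + y by rewrite ltr_pwDl.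
have u0 : 0 <= ln (1 + y) by rewrite ln_ge0 // lerDl.
have E : 1 + y = expR (ln (1 + y)) by rewrite lnK.
move: u0 E; set u := ln _ => u0 E.
have h : (1 + u / 2) ^+ 2 <= expR (u / 2) ^+ 2.
  by rewrite lerXn2r ?nnegrE ?expR_ge0 ?addr_ge0 ?divr_ge0 //; exact: expR_ge1Dx.
have e2 : expR (u / 2) ^+ 2 = 1 + y by rewrite -expRM_natl mulrC divfK // -E.
by move: h (sqr_ge0 u); rewrite e2; lra.
Qed.

Lemma ln1p_powR (b y : R) : 0 < b -> b <= 1 -> 0 <= y ->
  (1 + ln (1 + y)) ^+ 2 <= 4 / b ^+ 2 * (1 + y) `^ b.
Proof.
move=> b0 b1 y0; have y1 : 0 < 1 + y by rewrite ltr_pwDl.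
have u0 : 0 <= ln (1 + y) by rewrite ln_ge0 // lerDl.
rewrite /powR gt_eqF //; move: u0; set u := ln _ => u0.
have -> : 4 / b ^+ 2 * expR (b * u) = (2 / b * expR (b * u / 2)) ^+ 2.
  rewrite exprMn expr_div_n -expRM_natl [2%:R * _]mulrC divfK //.
  by congr (_ / _ * _); lra.
rewrite lerXn2r ?nnegrE ?mulr_ge0 ?expR_ge0 ?invr_ge0 ?addr_ge0 ?(ltW b0) //.
apply: (@le_trans _ _ (2 / b * (1 + b * u / 2))); last first.
  by rewrite ler_wpM2l ?divr_ge0 ?(ltW b0) //; exact: expR_ge1Dx.
have -> : 2 / b * (1 + b * u / 2) = 2 / b + u by field; rewrite gt_eqF.
by rewrite lerD2r ler_pdivlMr //; lra.
Qed.

(* Young's inequality with the conjugate exponents [p / 4] and [p / (p - 4)]. *)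
Lemma powR_young (p a B : R) : 4 < p -> 0 <= a -> 0 < B ->
  a ^+ 2 * B `^ (1 - 4 / p) <= a `^ (p / 2) + B.
Proof.
move=> p4 a0 B0; have p0 : 0 < p by apply: lt_trans p4.
have b0 : 0 <= 1 - 4 / p by rewrite subr_ge0 ler_pdivrMr // mul1r ltW.
have a2 : a ^+ 2 = (a `^ (p / 2)) `^ (4 / p).
  rewrite -powRrM -(powR_mulrn 2 a0); congr (_ `^ _); field; by rewrite gt_eqF.
have g0 := powR_ge0 a (p / 2).
have [aB|Ba] := leP (a `^ (p / 2)) B.
  apply: ler_wpDl => //; rewrite a2.
  apply: (@le_trans _ _ (B `^ (4 / p) * B `^ (1 - 4 / p))).
    rewrite ler_wpM2r ?powR_ge0 // ge0_ler_powR ?nnegrE ?(ltW B0) //.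
    by rewrite divr_ge0 // ltW.
  by rewrite -powRD ?(gt_eqF B0) ?implybT // addrC subrK powRr1 // ltW.
apply: ler_wpDr; first exact: ltW.
have A0 : 0 < a `^ (p / 2) by apply: lt_trans Ba.
rewrite a2; apply: (@le_trans _ _ ((a `^ (p / 2)) `^ (4 / p) * (a `^ (p / 2)) `^ (1 - 4 / p))).
  by rewrite ler_wpM2l ?powR_ge0 // ge0_ler_powR ?nnegrE ?(ltW B0) ?(ltW Ba).
by rewrite -powRD ?(gt_eqF A0) ?implybT // addrC subrK powRr1 // ltW.
Qed.

End Logarithm_bounds.

Section Dyadic_levels.
Context (R : realType).

Lemma sum_sqr_levels (t0 : R) k :
  \sum_(0 <= j < k) (t0 * 2 ^+ j) ^+ 2 <= (t0 * 2 ^+ k) ^+ 2 / 3.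
Proof.
elim: k => [|k IH]; first by rewrite big_geq // divr_ge0 ?sqr_ge0.
rewrite big_nat_recr //= [2 ^+ k.+1]exprS; have -> : t0 * (2 * 2 ^+ k) = 2 * (t0 * 2 ^+ k) by ring.
move: IH; rewrite [(2 * _) ^+ 2]exprMn; set s := \sum_(_ <= _ < _) _; lra.
Qed.

Lemma sum_inv_sqr_levels (t0 : R) k : 0 < t0 ->
  \sum_(0 <= j < k) (t0 * 2 ^+ j) ^- 2 <= 4 / 3 * t0 ^- 2.
Proof.
move=> t00; suff -> : \sum_(0 <= j < k) (t0 * 2 ^+ j) ^- 2 = 4 / 3 * t0 ^- 2 - 4 / 3 * (t0 * 2 ^+ k) ^- 2.
  by rewrite gerBl mulr_ge0 ?divr_ge0 // invr_ge0 sqr_ge0.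
elim: k => [|k IH]; first by rewrite big_geq // expr0 mulr1 subrr.
rewrite big_nat_recr //= IH [2 ^+ k.+1]exprS; have : (2 : R) ^+ k != 0 by rewrite expf_neq0.
have : t0 != 0 by rewrite gt_eqF.
by set w := 2 ^+ k => h1 h2; field; rewrite h1 h2.
Qed.

Lemma exists_level (t0 M2 : R) : 0 < t0 -> exists m, M2 < (t0 * 2 ^+ m) ^+ 2 /\
  forall j, (j < m)%N -> (t0 * 2 ^+ j) ^+ 2 <= M2.
Proof.
move=> t00; have ex : exists m, M2 < (t0 * 2 ^+ m) ^+ 2.
  have [k hk] : exists k : nat, M2 / t0 ^+ 2 < k%:R.
    by exists (Num.bound `|M2 / t0 ^+ 2|); apply: le_lt_trans (ler_norm _) (archi_boundP (normr_ge0 _)).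
  exists k; rewrite exprMn mulrC -ltr_pdivrMr ?exprn_gt0 //; apply: lt_le_trans hk _.
  rewrite -exprM -natrX ler_nat; apply: leq_trans (ltnW (ltn_expl k (ltnSn 1))) _.
  by rewrite leq_exp2l // leq_pmulr.
exists (ex_minn ex); case: ex_minnP => m hm mmin; split=> // j jm.
by rewrite leNgt; apply/negP => /mmin; rewrite leqNgt jm.
Qed.

(** The quantifiers make A0 independent of dimension, sample and scale. The coefficient of |I| is
    explicit because it has to match the truncation height exactly. *)
Definition levels_control (p C1 A0 : R) : Prop :=
  forall d n (x : 'I_n -> 'cV[R]_d) (M2 t0 Y : R) (I : {set 'I_n}),
  0 <= M2 -> (forall i, dotp (x i) (x i) <= M2) -> 0 < t0 -> 0 <= Y ->
  (forall j s sg, (size s <= n)%N ->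
    #|large_set x (32^-1 * (t0 * 2 ^+ j) / 6) s sg|%:R <= 4 / (p - 4) * (size s)%:R +
      (1 + 2 * Y + 2 * C1 * n%:R * (t0 * 2 ^+ j) ^- 4) / (p - 4)) ->
  opnorm (\sum_(i in I) x i *m (x i)^T) <=
    A0 * ((1 + Y) * M2 + n%:R * t0 ^- 2) + 128 * t0 ^+ 2 * #|I|%:R.

(** The levels stop at the first one exceeding M2, so the squares t_j^2 sum to at most 4/3 M2,
    dominated by the top level; the t_j^-2 left by the t_j^-4 terms are dominated by the bottom
    one. *)
Lemma sparse_opnorm_levels (p C1 : R) : 4 < p -> 0 <= C1 ->
  exists2 A0 : R, 0 <= A0 & levels_control p C1 A0.
Proof.
move=> p4 C10; pose g := (p - 4)^-1; have g0 : 0 <= g by rewrite invr_ge0 subr_ge0 ltW.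
pose e0 := 4 / (p - 4); have e00 : 0 <= e0 by rewrite mulr_ge0.
have r0 := rate_gt0 e00; have s0 := snr_ge0 e00.
have ri0 : 0 <= (rate e0)^-1 by rewrite invr_ge0 ltW.
exists (snr e0 + 128 * 4 * (4 / 3) * (4 * g + (rate e0)^-1) + 128 * 4 * (4 / 3) * (4 * g * C1)).
  by rewrite !addr_ge0 // !mulr_ge0 // ?addr_ge0 // mulr_ge0.
move=> d n x M2 t0 Y I M20 xM t00 Y0 hits.
have [m [Mm mM]] := exists_level M2 t00.
pose t j := t0 * 2 ^+ j; have tp j : 0 < t j by rewrite mulr_gt0 // exprn_gt0.
pose e1 j := (1 + 2 * Y + 2 * C1 * n%:R * t j ^- 4) / (p - 4).
have e10 j : 0 <= e1 j.
  by rewrite mulr_ge0 // !addr_ge0 ?mulr_ge0 // invr_ge0 exprn_ge0 // ltW.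
have := @sparse_opnorm R d n x I M2 e0 t0 m e1 M20 xM e00 t00 e10 Mm.
move=> H; apply: le_trans (H _) _; first by move=> j s sg _; exact: hits.
set rho := (rate e0)^-1; set S := \sum_(0 <= j < m) _.
have sum2 : \sum_(0 <= j < m) t j ^+ 2 <= 4 / 3 * M2.
  case: m mM {Mm S H} => [|m] mM; first by rewrite big_geq // mulr_ge0 // divr_ge0.
  have := sum_sqr_levels t0 m.+1; have := mM m (ltnSn m).
  rewrite [2 ^+ m.+1]exprS; have -> : t0 * (2 * 2 ^+ m) = 2 * (t0 * 2 ^+ m) by ring.
  by rewrite [(2 * _) ^+ 2]exprMn -/(t m); set s := \sum_(_ <= _ < _) _; lra.
have SE : S = (2 * g * (1 + 2 * Y) + rho) * \sum_(0 <= j < m) t j ^+ 2 +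
    4 * g * C1 * n%:R * \sum_(0 <= j < m) t j ^- 2.
  rewrite !mulr_sumr -big_split /=; apply: eq_bigr => j _; rewrite /e1 -/g -/(t j) -/rho.
  by have := gt_eqF (tp j); set u := t j => u0; field; rewrite u0.
have hS : S <= 4 / 3 * (4 * g + rho) * ((1 + Y) * M2) + 4 / 3 * (4 * g * C1) * (n%:R * t0 ^- 2).
  rewrite SE; apply: lerD.
    apply: (@le_trans _ _ ((4 * g + rho) * (1 + Y) * (4 / 3 * M2))); last by lra.
    apply: ler_pM; rewrite ?sumr_ge0 // ?addr_ge0 ?mulr_ge0 ?addr_ge0 ?mulr_ge0 //.
      by move=> j _; exact: sqr_ge0.
    by have := mulr_ge0 ri0 Y0; rewrite -/rho; lra.
  have := ler_wpM2l (_ : 0 <= 4 * g * C1 * n%:R) (sum_inv_sqr_levels m t00) => /(_ _).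
  by move=> h; apply: le_trans (h _) _; rewrite ?mulr_ge0 //; lra.
have V0 : M2 <= (1 + Y) * M2 by rewrite ler_peMl // lerDl.
have W0 : 0 <= n%:R * t0 ^- 2 by rewrite mulr_ge0 // invr_ge0 sqr_ge0.
move: hS V0 W0; set V := (1 + Y) * M2; set W := n%:R * t0 ^- 2 => hS V0 W0.
set a := 4 * g + rho in hS *; set b := 4 * g * C1 in hS *.
have a0 : 0 <= a by rewrite addr_ge0 // mulr_ge0.
have b0 : 0 <= b by rewrite !mulr_ge0.
have := mulr_ge0 a0 W0; have := mulr_ge0 b0 (le_trans M20 V0); have := mulr_ge0 s0 W0.
have := ler_wpM2l s0 V0; lra.
Qed.

(** Truncation changes only the indices above B = 128 t0^2 and removes the excess over B there; the
    subtracted B |I| cancels the |I| term of the operator norm bound. *)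
Lemma truncated_gram_le (p C1 A0 : R) d n (x : 'I_n -> 'cV[R]_d) (M2 t0 Y : R) v :
  levels_control p C1 A0 -> 0 <= M2 -> (forall i, dotp (x i) (x i) <= M2) -> 0 < t0 -> 0 <= Y ->
  (forall j s sg, (size s <= n)%N ->
    #|large_set x (32^-1 * (t0 * 2 ^+ j) / 6) s sg|%:R <= 4 / (p - 4) * (size s)%:R +
      (1 + 2 * Y + 2 * C1 * n%:R * (t0 * 2 ^+ j) ^- 4) / (p - 4)) ->
  norm2 v = 1 ->
  \sum_i dotp (x i) v ^+ 2 <= \sum_i trunc_sqr (128 * t0 ^+ 2) (dotp (x i) v) +
    A0 * ((1 + Y) * M2 + n%:R * t0 ^- 2).
Proof.
move=> A0P M20 xM t00 Y0 hits v1; set B := 128 * t0 ^+ 2.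
pose I := [set i | B < dotp (x i) v ^+ 2]%SET.
have h1 : \sum_(i in I) dotp (x i) v ^+ 2 <= A0 * ((1 + Y) * M2 + n%:R * t0 ^- 2) + B * #|I|%:R.
  rewrite -dotp_gram; apply: (le_trans (quad_le_opnorm _ _)).
  by rewrite -sqr_norm2 v1 expr1n mulr1; exact: A0P.
have h2 : \sum_i dotp (x i) v ^+ 2 - \sum_i trunc_sqr B (dotp (x i) v) <=
    \sum_(i in I) dotp (x i) v ^+ 2 - B * #|I|%:R.
  rewrite -sumrB mulr_natr -sumr_const -sumrB [leRHS]big_mkcond /=.
  apply: ler_sum => i _; rewrite inE /trunc_sqr.
  have [a|a] := ltP B _; first by rewrite lexx.
  by rewrite subrr.
lra.
Qed.

End Dyadic_levels.

(** * The normalised deviation *)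

Section Deviation.
Context d0 d1 (T : measurableType d0) (U : measurableType d1) (R : realType).
Context (P : probability T R) (n : nat) (X : {RV P >-> U}) (Xs : 'I_n -> {RV P >-> U}).
Hypothesis iid : iid_copies X Xs.
Let mu := distribution P X.
Context (d : nat) (nv : U -> 'cV[R]_d).
Hypothesis mnv : forall j, measurable_fun setT (fun x => nv x j 0).
Context (p Kp : R) (Q : 'cV[R]_d -> R) (r : R).
Hypothesis (p4 : 4 < p) (Kp0 : 0 <= Kp) (Q0 : forall u, 0 <= Q u) (Q1 : forall u, Q u <= dotp u u).
Hypothesis EQ : forall u, nnint mu (fun x => dotp (nv x) u ^+ 2) /\ Ex mu (fun x => dotp (nv x) u ^+ 2) = Q u.
Hypothesis EP : forall u, (\int[mu]_x (`|dotp (nv x) u| `^ p)%:E <= (Kp * Q u `^ (p / 2))%:E)%E.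
Hypothesis (r1 : 1 <= r) (rE : r = \sum_j Q (delta_mx j 0)) (rn : r <= n%:R).
Context (A0 : R).
Hypothesis (A00 : 0 <= A0) (A0P : levels_control p (4 + Kp * 192 `^ p) A0).
Context (G : T -> R) (m : R).
Hypothesis (nG : nnint P G) (xG : forall w i, norm2 (nv (Xs i w)) `^ p <= G w).
Hypothesis (m0 : 0 <= m) (EG : Ex P G <= m `^ (p / 2)).

Let K := 4 * (1 + Kp).
Let eps := Num.sqrt (r / n%:R).
(** After normalisation, n times the bound to be proved: m stands for the maximum term. All errors
    are measured in units of s. *)
Let s := m + n%:R * eps.
Let b := 1 - 4 / p.
Let B1 := 50 * 100 + K + A0.
Let Z (y : 'cV[R]_d) := r^-1 * dotp y y.

Let p0 : 0 < p. Proof. exact: lt_trans p4. Qed.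
Let r0 : 0 < r. Proof. exact: lt_le_trans r1. Qed.
Let n0 : 0 < n%:R :> R. Proof. exact: lt_le_trans rn. Qed.
Let K0 : 0 <= K. Proof. by rewrite mulr_ge0 // addr_ge0. Qed.
Let eps0 : 0 < eps. Proof. by rewrite sqrtr_gt0 divr_gt0. Qed.
Let eps2 : eps ^+ 2 = r / n%:R. Proof. by rewrite sqr_sqrtr // divr_ge0 ?ltW. Qed.
Let eps1 : eps <= 1.
Proof. by rewrite -(sqrtr1 R) ler_wsqrtr // ler_pdivrMr // mul1r. Qed.
Let neps : n%:R * eps ^+ 2 = r. Proof. by rewrite eps2 mulrC divfK // gt_eqF. Qed.
Let reps : r / eps = n%:R * eps.
Proof. by rewrite -neps expr2 mulrA mulfK // gt_eqF. Qed.
Let s0 : 0 < s. Proof. by rewrite ltr_wpDl // mulr_gt0. Qed.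
Let b0 : 0 < b. Proof. by rewrite subr_gt0 ltr_pdivrMr // mul1r. Qed.
Let b1 : b <= 1. Proof. by rewrite gerBl divr_ge0 // ltW. Qed.
Let B1p : 0 < B1.
Proof. by rewrite ltr_wpDr // ltr_wpDr // mulr_gt0. Qed.

Let E4 u : nnint mu (fun x => dotp (nv x) u ^+ 4).
Proof.
have q1 : 0 < 1 + Q u by rewrite ltr_pwDl.
have h : Q u <= (1 + Q u) ^+ 2 by have := Q0 u; have := sqr_ge0 (Q u); lra.
exact: (moment4 mnv p4 Kp0 Q0 EP q1 h).1.
Qed.

Let E4le u : norm2 u = 1 -> Ex mu (fun x => dotp (nv x) u ^+ 4) <= K.
Proof.
move=> u1; have h : Q u <= 1 ^+ 2 by rewrite -u1 sqr_norm2.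
apply: le_trans (moment4 mnv p4 Kp0 Q0 EP ltr01 h).2 _.
by have := Kp0; rewrite /K expr1n mulr1; lra.
Qed.

Let En2 := moment2_norm EQ rE.
Let En4 := moment4_norm mnv p4 Kp0 Q0 EP r1 rE.

Let Z0 y : 0 <= Z y. Proof. by rewrite mulr_ge0 ?dotpvv_ge0 // invr_ge0 ltW. Qed.

Let nZ : nnint mu (fun y => Z (nv y)) /\ Ex mu (fun y => Z (nv y)) = 1.
Proof.
have [n2 E2] := En2; have r00 : 0 <= r^-1 by rewrite invr_ge0 ltW.
by have [nz Ez] := ExZ r00 n2; split=> //; rewrite Ez E2 mulVf // gt_eqF.
Qed.

Let nZ2 : nnint mu (fun y => Z (nv y) ^+ 2) /\ Ex mu (fun y => Z (nv y) ^+ 2) <= K.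
Proof.
have [n4 E4'] := En4; have r00 : 0 <= r^-1 ^+ 2 by exact: sqr_ge0.
have [nz Ez] := ExZ r00 n4.
rewrite (_ : (fun y => _) = fun y => r^-1 ^+ 2 * dotp (nv y) (nv y) ^+ 2); last first.
  by apply/funext => y; rewrite /Z exprMn.
split=> //; rewrite Ez; apply: (le_trans (ler_wpM2l r00 E4')).
by rewrite mulrCA -exprMn mulVf ?gt_eqF // expr1n mulr1.
Qed.

Let n1 : 1 <= n%:R :> R. Proof. exact: le_trans rn. Qed.

Let trace_deviation : nnint P (fun w => (\sum_i Z (nv (Xs i w)) - n%:R) ^+ 2) /\
  Ex P (fun w => (\sum_i Z (nv (Xs i w)) - n%:R) ^+ 2) <= n%:R * K.
Proof.
have [nS ES] := sum_copies_sqr iid nZ.1 nZ2.1; rewrite nZ.2 in ES.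
have [nL EL] := @Ex_sum _ _ _ P _ (index_enum 'I_n) (fun i w => Z (nv (Xs i w)))
  (fun i => (nnint_copy iid i nZ.1).1).
have n2 : 0 <= 2 * n%:R :> R by rewrite mulr_ge0.
have [nL2 EL2] := ExZ n2 nL.
have [nc Ec] := @Ex_cst _ _ _ P (n%:R ^+ 2) (sqr_ge0 _).
have [nSc ESc] := ExD nS nc.
have mD : measurable_fun setT (fun w => (\sum_i Z (nv (Xs i w)) - n%:R) ^+ 2).
  by apply: measurable_funX; apply: measurable_funB => //; case: nL.
have hD w : (\sum_i Z (nv (Xs i w)) - n%:R) ^+ 2 <= (\sum_i Z (nv (Xs i w))) ^+ 2 + n%:R ^+ 2.
  have h : 0 <= \sum_i Z (nv (Xs i w)) by apply: sumr_ge0 => i _; exact: Z0.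
  by have := mulr_ge0 (ltW n0) h; lra.
have [nD _] := Ex_le nSc mD (fun w => sqr_ge0 _) hD.
split=> //; have [nDL EDL] := ExD nD nL2.
(* The cross term of the square is moved to the left, so that only nonnegative functions are
   integrated. *)
have : Ex P (fun w => (\sum_i Z (nv (Xs i w)) - n%:R) ^+ 2 + 2 * n%:R * \sum_i Z (nv (Xs i w))) =
    Ex P (fun w => (\sum_i Z (nv (Xs i w))) ^+ 2 + n%:R ^+ 2).
  by congr Ex; apply/funext => w; ring.
rewrite EDL ESc Ec EL2 EL.
rewrite (eq_bigr (fun=> 1)) => [|i _]; last by rewrite (nnint_copy iid i nZ.1).2 nZ.2.
rewrite sumr_const card_ord; have := ler_wpM2l (ltW n0) nZ2.2; lra.
Qed.

(** This is 128 t0^2 for t0^2 = 4 / eps: the truncation heights of the bulk and of the sparse bound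
    coincide. *)
Let q2 := 8 * 64 / eps.
Let q20 : 0 < q2. Proof. by rewrite divr_gt0 // mulr_gt0. Qed.
Let W (y : 'cV[R]_d) := Num.min (Z y) (4 * Z y ^+ 2 / q2).

Let tail_square : nnint P (fun w => (\sum_i W (nv (Xs i w))) ^+ 2) /\
  Ex P (fun w => (\sum_i W (nv (Xs i w))) ^+ 2) <= n%:R * K + n%:R ^+ 2 * (eps * K) ^+ 2.
Proof.
have W0 y : 0 <= W y.
  by rewrite /W le_min Z0 /= divr_ge0 ?(ltW q20) // mulr_ge0 // sqr_ge0.
have WZ y : W y <= Z y by rewrite /W ge_min lexx.
have WZ2 y : W y <= eps * Z y ^+ 2.
  rewrite /W ge_min; apply/orP; right.
  have -> : 4 * Z y ^+ 2 / q2 = (2 * 64)^-1 * (eps * Z y ^+ 2).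
    by rewrite /q2; field; rewrite gt_eqF.
  have : 0 <= eps * Z y ^+ 2 by rewrite mulr_ge0 ?sqr_ge0 // ltW.
  lra.
have mW : measurable_fun setT (fun y => W (nv y)).
  apply: measurable_minr; first by case: nZ => -[].
  by apply: measurable_funM => //; apply: measurable_funM => //; case: nZ2 => -[].
have [neZ EeZ] := ExZ (ltW eps0) nZ2.1.
have [nW EW] := Ex_le neZ mW (fun y => W0 (nv y)) (fun y => WZ2 (nv y)).
have [nW2 EW2] := Ex_le nZ2.1 (measurable_funX 2 mW) (fun y => sqr_ge0 _)
  (fun y => lerXn2r 2 (W0 (nv y)) (Z0 (nv y)) (WZ (nv y))).
have [nS ES] := sum_copies_sqr iid nW nW2; split=> //; apply: (le_trans ES); apply: lerD.
  by rewrite ler_wpM2l ?(ltW n0) // (le_trans EW2) // nZ2.2.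
rewrite ler_wpM2l ?sqr_ge0 // lerXn2r ?nnegrE ?Ex_ge0 ?(mulr_ge0 (ltW eps0) K0) //.
by apply: (le_trans EW); rewrite EeZ ler_wpM2l ?(ltW eps0) // nZ2.2.
Qed.

Let t0 := 2 / Num.sqrt eps.

Let t0_sqr : t0 ^+ 2 = 4 / eps.
Proof. by rewrite expr_div_n sqr_sqrtr ?(ltW eps0) //; lra. Qed.

Let t02 : 2 <= t0.
Proof.
have se1 : Num.sqrt eps <= 1 by rewrite -[leRHS]sqrtr1 ler_wsqrtr.
have se0 : 0 < Num.sqrt eps by rewrite sqrtr_gt0.
by rewrite /t0 (ler_pdivlMr _ _ se0) ler_piMr.
Qed.

Let M2 w := G w `^ (2 / p).

Let xM2 w i : dotp (nv (Xs i w)) (nv (Xs i w)) <= M2 w.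
Proof.
rewrite -sqr_norm2 -(powR_mulrn 2 (norm2_ge0 _)).
have -> : 2%:R = p * (2 / p) :> R by field; rewrite gt_eqF.
rewrite powRrM ge0_ler_powR ?nnegrE ?powR_ge0 ?divr_ge0 ?(ltW p0) //.
by case: nG => _ /(_ w).
Qed.

Let EPn u : (\int[mu]_x (`|dotp (nv x) u| `^ p)%:E <= (Kp * norm2 u `^ p)%:E)%E.
Proof.
apply: (le_trans (EP u)); rewrite lee_fin ler_wpM2l //.
have -> : norm2 u `^ p = (norm2 u ^+ 2) `^ (p / 2).
  by rewrite -(powR_mulrn 2 (norm2_ge0 u)) -powRrM mulrC divfK.
by rewrite ge0_ler_powR ?nnegrE ?divr_ge0 ?(ltW p0) ?sqr_ge0 // sqr_norm2.
Qed.

Lemma sqr_sum6_le (a1 a2 a3 a4 a5 a6 : R) : (a1 + a2 + a3 + a4 + a5 + a6) ^+ 2 <=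
  6 * (a1 ^+ 2 + a2 ^+ 2 + a3 ^+ 2 + a4 ^+ 2 + a5 ^+ 2 + a6 ^+ 2).
Proof.
have := sqr_ge0 (a1 - a2); have := sqr_ge0 (a1 - a3); have := sqr_ge0 (a1 - a4).
have := sqr_ge0 (a1 - a5); have := sqr_ge0 (a1 - a6); have := sqr_ge0 (a2 - a3).
have := sqr_ge0 (a2 - a4); have := sqr_ge0 (a2 - a5); have := sqr_ge0 (a2 - a6).
have := sqr_ge0 (a3 - a4); have := sqr_ge0 (a3 - a5); have := sqr_ge0 (a3 - a6).
have := sqr_ge0 (a4 - a5); have := sqr_ge0 (a4 - a6); have := sqr_ge0 (a5 - a6).
lra.
Qed.

Let smoothing_level : exists N : nat, r / eps < N%:R.
Proof.
exists (Num.bound `|r / eps|).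
by apply: le_lt_trans (ler_norm _) (archi_boundP (normr_ge0 _)).
Qed.

Let D w := `|\sum_i Z (nv (Xs i w)) - n%:R|.
Let SW w := \sum_i W (nv (Xs i w)).
Let error w (l1 l2 Y : R) := n%:R * eps + l1 / eps + l2 / eps + D w + SW w + (1 + Y) * M2 w.

Let few := few_hits iid mnv p4 Kp0 EPn t02.

Lemma pointwise_error : exists X1 X2 : T -> R, exists Xi : T -> \bar R,
  [/\ nnint P X1 /\ Ex P X1 <= 1, nnint P X2 /\ Ex P X2 <= 1,
    measurable_fun setT Xi /\ forall w, (0 <= Xi w)%E, (\int[P]_w Xi w <= 1)%E &
    forall w y v, Xi w = y%:E -> norm2 v = 1 ->
      `|\sum_i dotp (nv (Xs i w)) v ^+ 2 - n%:R * Q v| <=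
      B1 * error w (ln (1 + X1 w)) (ln (1 + X2 w)) (ln (1 + y))].
Proof.
have [N rN] := smoothing_level.
have rN' : r < N%:R by apply: le_lt_trans rN; rewrite ler_pdivlMr // ler_piMr // ltW.
have N0 : 0 < N%:R :> R by apply: lt_trans rN'.
have rNe : r / N%:R <= eps.
  by rewrite ler_pdivrMr // mulrC -ler_pdivrMr // ltW.
have q0 : 0 < Num.sqrt q2 by rewrite sqrtr_gt0.
have qq : Num.sqrt q2 ^+ 2 = q2 by rewrite sqr_sqrtr // ltW.
have [X1 [nX1 EX1 X10 up]] := bulk_upper iid mnv r1 EQ E4 E4le En2 En4 q0 rN'.
have [X2 [nX2 EX2 X20 lo]] := bulk_lower iid mnv r1 EQ E4 E4le En2 En4 q0 rN'.
have [Xi [mXi Xi0 Xi1 hits]] := few.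
exists X1, X2, Xi; split=> // w y v yE v1.
have y0 : 0 <= y by rewrite -lee_fin -yE.
have := up w v v1; have := lo w v v1; rewrite qq => {up lo}.
have lnx (x : R) : 0 < x -> ln x <= ln (1 + x).
  move=> x0; have x1 : 0 < 1 + x by rewrite ltr_pwDl // ltW.
  by rewrite ler_ln ?posrE // lerDr.
have l1 := lnx _ (X10 w); have l2 := lnx _ (X20 w).
have Y0 : 0 <= ln (1 + y) by rewrite ln_ge0 // lerDl.
have ln0 (x : R) : 0 < x -> 0 <= ln (1 + x) by move=> x0; rewrite ln_ge0 // lerDl ltW.
have t00 : 0 < t0 by apply: lt_le_trans t02.
have tr := truncated_gram_le A0P (powR_ge0 _ _ : 0 <= M2 w) (xM2 w) t00 Y0 (hits w y yE) v1.
have q2E : 128 * t0 ^+ 2 = q2 by rewrite t0_sqr /q2; field; rewrite gt_eqF.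
have t0i : n%:R * t0 ^- 2 = n%:R * eps / 4 by rewrite t0_sqr; field; rewrite gt_eqF.
have lamE : (4 * q2)^-1 = eps / (32 * 64) by rewrite /q2; field; rewrite gt_eqF.
move: tr; rewrite q2E t0i lamE.
rewrite -/(\sum_i Z (nv (Xs i w))) -/(\sum_i W (nv (Xs i w))).
have l1e (l : R) : (l + r) / (eps / (32 * 64)) = 32 * 64 * (l / eps) + 32 * 64 * (n%:R * eps).
  by rewrite -reps; field; rewrite gt_eqF.
rewrite !l1e => h1 h2 h3.
have SZn : \sum_i Z (nv (Xs i w)) - n%:R <= D w by exact: ler_norm.
have nSZ : n%:R - \sum_i Z (nv (Xs i w)) <= D w by rewrite /D distrC; exact: ler_norm.
have D0 : 0 <= D w by exact: normr_ge0.
have SZ0 : 0 <= \sum_i Z (nv (Xs i w)) by apply: sumr_ge0 => i _; exact: Z0.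
have rN1 : 0 <= r / N%:R by rewrite divr_ge0 // ltW.
have hN : r / N%:R * \sum_i Z (nv (Xs i w)) <= D w + n%:R * eps.
  apply: (@le_trans _ _ (eps * (n%:R + D w))).
    by apply: ler_pM => //; lra.
  by have := ler_wpM2r D0 eps1; lra.
have hN2 : n%:R * (r / N%:R) <= n%:R * eps by rewrite ler_wpM2l // ltW.
have ne0 : 0 <= n%:R * eps by rewrite mulr_ge0 // ltW.
have SW0 : 0 <= SW w.
  by apply: sumr_ge0 => i _; rewrite /W le_min Z0 /= divr_ge0 ?(ltW q20) // mulr_ge0 // sqr_ge0.
have k1 : n%:R * (80 * K * (eps / (32 * 64))) <= K * (n%:R * eps).
  by have := mulr_ge0 K0 ne0; lra.
have k2 : n%:R * (120 * K * (eps / (32 * 64))) <= K * (n%:R * eps).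
  by have := mulr_ge0 K0 ne0; lra.
have ei : 0 <= eps^-1 by rewrite invr_ge0 ltW.
have e1 := ler_wpM2r ei l1; have e2 := ler_wpM2r ei l2.
have p1 := mulr_ge0 (ln0 _ (X10 w)) ei; have p2 := mulr_ge0 (ln0 _ (X20 w)) ei.
have YM0 : 0 <= (1 + ln (1 + y)) * M2 w by rewrite mulr_ge0 ?powR_ge0 // addr_ge0.
rewrite /error.
move: h1 h2 h3 e1 e2 p1 p2 YM0 hN hN2 k1 k2 SZn nSZ D0 ne0 SW0; rewrite -/(D w) -/(SW w).
set ne := n%:R * eps; set a1 := _ / eps; set a2 := _ / eps; set a3 := _ / eps; set a4 := _ / eps.
set YM := (1 + _) * _; set rS := r / N%:R * _; set nr := n%:R * (r / N%:R).
set S := \sum_i dotp _ _ ^+ 2; set Tr := \sum_i trunc_sqr _ _; set SZ := \sum_i Z _.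
set nQ := n%:R * Q v; move=> h1 h2 h3 e1 e2 p1 p2 YM0 hN hN2 k1 k2 SZn nSZ D0 ne0 SW0.
have K1 := mulr_ge0 K0 p1; have K2 := mulr_ge0 K0 p2; have K3 := mulr_ge0 K0 YM0.
have K4 := mulr_ge0 K0 D0; have K5 := mulr_ge0 K0 SW0.
have L1 := mulr_ge0 A00 p1; have L2 := mulr_ge0 A00 p2; have L3 := mulr_ge0 A00 D0.
have L4 := mulr_ge0 A00 SW0; have L5 := mulr_ge0 A00 ne0; have K6 := mulr_ge0 K0 ne0.
have L6 := mulr_ge0 A00 YM0.
by rewrite ler_norml /B1; apply/andP; split; lra.
Qed.

(** Bounds for the squares of the six error terms, linear in the exponential variables. The
    contribution of Xi is added separately, since Xi may be infinite. *)
Let F X1 X2 w := (n%:R * eps) ^+ 2 + 4 * eps ^- 2 * X1 w + 4 * eps ^- 2 * X2 w + D w ^+ 2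
  + SW w ^+ 2 + 4 / b ^+ 2 * s ^+ 2 * ((s `^ (p / 2))^-1 * G w + 1).

Let nF X1 X2 : nnint P X1 /\ Ex P X1 <= 1 -> nnint P X2 /\ Ex P X2 <= 1 ->
  nnint P (F X1 X2) /\ Ex P (F X1 X2) <= (9 + 2 * K + K ^+ 2 + 8 / b ^+ 2) * s ^+ 2.
Proof.
move=> [nX1 EX1] [nX2 EX2].
have c0 : 0 <= 4 * eps ^- 2 by rewrite mulr_ge0 // invr_ge0 sqr_ge0.
have cb : 0 <= 4 / b ^+ 2 * s ^+ 2 by rewrite mulr_ge0 ?sqr_ge0 // divr_ge0 // sqr_ge0.
have sp : 0 <= (s `^ (p / 2))^-1 by rewrite invr_ge0 powR_ge0.
have [m1 F1] := @Ex_cst _ _ _ P ((n%:R * eps) ^+ 2) (sqr_ge0 _).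
have [m2 F2] := ExZ c0 nX1; have [m3 F3] := ExZ c0 nX2.
have [m4 F4] : nnint P (fun w => D w ^+ 2) /\ Ex P (fun w => D w ^+ 2) <= n%:R * K.
  rewrite (_ : (fun w => _) = fun w => (\sum_i Z (nv (Xs i w)) - n%:R) ^+ 2) //.
  by apply/funext => w; rewrite /D real_normK ?num_real.
have [m5 F5] := tail_square.
have [g1 E1] := ExZ sp nG; have [g2 E2] := @Ex_cst _ _ _ P 1 ler01.
have [g3 E3] := ExD g1 g2; have [m6 F6] := ExZ cb g3.
have [k1 H1] := ExD m1 m2; have [k2 H2] := ExD k1 m3; have [k3 H3] := ExD k2 m4.
have [k4 H4] := ExD k3 m5; have [k5 H5] := ExD k4 m6.
split; first exact: k5.
rewrite H5 H4 H3 H2 H1 F1 F2 F3 F6 E3 E2 E1.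
(* Since r >= 1, both 1 / eps <= r / eps = n eps and n <= n r = (n eps)^2 hold, so every scale that
   occurs is bounded by s. *)
have ei : eps^-1 <= n%:R * eps by rewrite -reps ler_peMl // invr_ge0 ltW.
have ns : (n%:R * eps) ^+ 2 <= s ^+ 2.
  by rewrite lerXn2r ?nnegrE ?(ltW s0) ?mulr_ge0 ?(ltW eps0) // lerDr.
have es : eps ^- 2 <= s ^+ 2.
  apply: le_trans ns; rewrite -exprVn lerXn2r ?nnegrE ?invr_ge0 ?(ltW eps0) //.
  by rewrite mulr_ge0 // ltW.
have nn : n%:R <= s ^+ 2.
  apply: le_trans ns; rewrite exprMn expr2 -mulrA -[leLHS]mulr1 ler_wpM2l //.
  by rewrite neps.
have gs : (s `^ (p / 2))^-1 * Ex P G <= 1.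
  rewrite mulrC ler_pdivrMr ?powR_gt0 // mul1r (le_trans EG) //.
  by rewrite ge0_ler_powR ?nnegrE ?divr_ge0 ?(ltW p0) ?(ltW s0) // lerDl mulr_ge0 // ltW.
have h2 : 4 * eps ^- 2 * Ex P X1 <= 4 * s ^+ 2.
  by apply: le_trans (ler_wpM2l c0 EX1) _; rewrite mulr1 ler_wpM2l.
have h3 : 4 * eps ^- 2 * Ex P X2 <= 4 * s ^+ 2.
  by apply: le_trans (ler_wpM2l c0 EX2) _; rewrite mulr1 ler_wpM2l.
have h4 : n%:R * K <= s ^+ 2 * K by rewrite ler_wpM2r.
have h5 : n%:R ^+ 2 * (eps * K) ^+ 2 <= s ^+ 2 * K ^+ 2.
  have -> : n%:R ^+ 2 * (eps * K) ^+ 2 = (n%:R * eps) ^+ 2 * K ^+ 2 by ring.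
  by rewrite ler_wpM2r ?sqr_ge0.
have h6 : 4 / b ^+ 2 * s ^+ 2 * ((s `^ (p / 2))^-1 * Ex P G + 1) <= 4 / b ^+ 2 * s ^+ 2 * 2.
  by rewrite ler_wpM2l //; lra.
have {}F5 := le_trans F5 (lerD h4 h5).
move: F4 F5 h2 h3 h6 ns h4.
have -> : 8 / b ^+ 2 = 4 / b ^+ 2 * 2 by rewrite mulrAC; congr (_ / _); lra.
set u := 4 / b ^+ 2; set S2 := s ^+ 2; set e5 := Ex P _; set e4 := Ex P _.
set e2 := 4 * _ * Ex P X1; set e3 := 4 * _ * Ex P X2; set ee := _ * _ + 1.
lra.
Qed.

(** One measurable H dominates all directions, so the measurability of a supremum over v never
    arises. *)
Lemma deviation : exists H : T -> \bar R, [/\ measurable_fun setT H, forall w, (0 <= H w)%E,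
  (\int[P]_w H w <= (6 * B1 ^+ 2 * (9 + 2 * K + K ^+ 2 + 12 / b ^+ 2) * s ^+ 2)%:E)%E &
  forall w v, norm2 v = 1 ->
    (((\sum_i dotp (nv (Xs i w)) v ^+ 2 - n%:R * Q v) ^+ 2)%:E <= H w)%E].
Proof.
have [X1 [X2 [Xi [nX1 nX2 [mXi Xi0] Xi1 err]]]] := pointwise_error.
have [nFF EF] := nF nX1 nX2.
have cF : 0 <= 6 * B1 ^+ 2 by rewrite mulr_ge0 // sqr_ge0.
pose cX := 6 * B1 ^+ 2 * (4 / b ^+ 2 * s ^+ 2).
have cX0 : 0 < cX by rewrite !mulr_gt0 ?exprn_gt0 ?invr_gt0 ?exprn_gt0.
have [nH1 EH1] := ExZ cF nFF.
have F0 w : 0 <= 6 * B1 ^+ 2 * F X1 X2 w by case: nH1.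
exists (fun w => (6 * B1 ^+ 2 * F X1 X2 w)%:E + cX%:E * Xi w)%E; split.
- apply: emeasurable_funD; first by apply/measurable_EFinP; case: nH1.
  by apply: measurable_funeM.
- by move=> w; rewrite adde_ge0 ?lee_fin // mule_ge0 // lee_fin ltW.
- have f1 w : [set: T] w -> (0 <= (6 * B1 ^+ 2 * F X1 X2 w)%:E)%E by rewrite lee_fin.
  have f2 w : [set: T] w -> (0 <= cX%:E * Xi w)%E by rewrite mule_ge0 // lee_fin ltW.
  have mf1 : measurable_fun setT (fun w => (6 * B1 ^+ 2 * F X1 X2 w)%:E).
    by apply/measurable_EFinP; case: nH1.
  have mf2 : measurable_fun setT (fun w => cX%:E * Xi w)%E by apply: measurable_funeM.
  rewrite ge0_integralD //.
  rewrite ge0_integralZl_EFin //; last exact: ltW.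
  rewrite -ExE // EH1.
  apply: (@le_trans _ _ ((6 * B1 ^+ 2 * Ex P (F X1 X2))%:E + cX%:E * 1)%E).
    by rewrite leeD2l // lee_wpmul2l // lee_fin ltW.
  rewrite mule1 -EFinD lee_fin /cX -mulrDr -[leRHS]mulrA ler_wpM2l //.
  apply: (le_trans (lerD EF (lexx _))); rewrite le_eqVlt; apply/orP; left; apply/eqP.
  by field; rewrite gt_eqF.
move=> w v v1; case Ey : (Xi w) (Xi0 w) => [y| |] // y0; last by rewrite gt0_muley ?lte_fin // addey // leey.
rewrite lee_fin in y0; rewrite -EFinM -EFinD lee_fin.
have := sqr_le_norm (err w y v Ey v1); rewrite exprMn => h; apply: (le_trans h).
have -> : 6 * B1 ^+ 2 * F X1 X2 w + cX * y = B1 ^+ 2 * (6 * (F X1 X2 w + 4 / b ^+ 2 * s ^+ 2 * y)).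
  by rewrite /cX; ring.
rewrite ler_wpM2l ?sqr_ge0 //; apply: (le_trans (sqr_sum6_le _ _ _ _ _ _)); rewrite ler_wpM2l //.
have x10 : 0 <= X1 w by case: nX1 => -[].
have x20 : 0 <= X2 w by case: nX2 => -[].
have e20 : 0 <= eps ^- 2 by rewrite invr_ge0 sqr_ge0.
have h2 (x : R) : 0 <= x -> (ln (1 + x) / eps) ^+ 2 <= 4 * eps ^- 2 * x.
  move=> x0; rewrite expr_div_n; have := ler_wpM2r e20 (ln1p_sqr_le x0); lra.
(* The squared logarithm is bounded by a multiple of (1 + y)^b. As b = 1 - 4 / p, Young's inequality
   with a = M2 / s leaves G / s^(p/2), of mean at most 1, and 1 + y. *)
have h6 : ((1 + ln (1 + y)) * M2 w) ^+ 2 <=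
    4 / b ^+ 2 * s ^+ 2 * ((s `^ (p / 2))^-1 * G w + 1) + 4 / b ^+ 2 * s ^+ 2 * y.
  have G0 : 0 <= G w by case: nG.
  have a0 : 0 <= M2 w / s by rewrite divr_ge0 ?powR_ge0 // ltW.
  have y1 : 0 < 1 + y by rewrite ltr_pwDl.
  have := powR_young p4 a0 y1; rewrite -/b.
  have -> : (M2 w / s) `^ (p / 2) = (s `^ (p / 2))^-1 * G w.
    rewrite powRM ?powR_ge0 ?invr_ge0 ?(ltW s0) // mulrC -powR_inv1 ?(ltW s0) // -powRrM mulN1r.
    rewrite powRN; congr (_ * _); rewrite /M2 -powRrM.
    have -> : 2 / p * (p / 2) = 1 by field; rewrite gt_eqF.
    by rewrite powRr1.
  move=> /(ler_wpM2l (_ : 0 <= 4 / b ^+ 2 * s ^+ 2)) hy.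
  have cb : 0 <= 4 / b ^+ 2 * s ^+ 2 by rewrite mulr_ge0 ?sqr_ge0 // divr_ge0 // sqr_ge0.
  have {}hy := hy cb.
  have hl := ler_wpM2r (sqr_ge0 (M2 w)) (ln1p_powR b0 b1 y0).
  rewrite exprMn; apply: (le_trans hl).
  apply: (@le_trans _ _ (4 / b ^+ 2 * s ^+ 2 * ((M2 w / s) ^+ 2 * (1 + y) `^ b))).
    rewrite le_eqVlt; apply/orP; left; apply/eqP.
    by field; rewrite !gt_eqF.
  by apply: (le_trans hy); rewrite -mulrDr addrA.
have := h2 _ x10; have := h2 _ x20; rewrite /F; move: h6; lra.
Qed.

End Deviation.

(** * Covariance matrices *)

(* [f] is not assumed measurable: it will be built from an operator norm. *)
Lemma le_integral_nonneg d0 (T : measurableType d0) (R : realType) (mu : {measure set T -> \bar R})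
    (f g : T -> \bar R) : (forall x, 0 <= f x)%E -> (forall x, f x <= g x)%E ->
  (\int[mu]_x f x <= \int[mu]_x g x)%E.
Proof.
move=> f0 fg; have g0 x : (0 <= g x)%E by apply: le_trans (fg x).
rewrite !ge0_integralTE //; apply: ereal_sup_le => _ [h hf <-]; exists h => // x.
exact: le_trans (hf x) (fg x).
Qed.

(** * Moments determined by the covariance matrix *)

Section Second_moment.
Context d0 (T : measurableType d0) (R : realType) (P : probability T R) (d : nat).
Context (X : {RV P >-> d.-tuple R}) (S : 'M[R]_d).
Hypothesis XS : has_second_moment X S.
Let mu := distribution P X.

Lemma measurable_vec j : measurable_fun setT (fun x : d.-tuple R => vec x j 0).
Proof.
rewrite (_ : (fun x => _) = fun x => tnth x j); first exact: measurable_tnth.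
by apply/funext => x; rewrite mxE.
Qed.

Lemma measurable_vecX j : measurable_fun setT (fun w => vec (X w) j 0).
Proof. by apply: (measurableT_comp (measurable_vec j)); exact: measurable_funPT. Qed.

Lemma outerE (x : d.-tuple R) i j : (vec x *m (vec x)^T) i j = vec x i 0 * vec x j 0.
Proof. by rewrite mxE big_ord1 [X in _ * X]mxE. Qed.

Lemma second_momentE i j : (\int[P]_w (vec (X w) i 0 * vec (X w) j 0)%:E = (S i j)%:E)%E.
Proof.
have := XS i j; rewrite unlock => <-; apply: eq_integral => w _; by rewrite outerE.
Qed.

Lemma second_moment_sym : S^T = S.
Proof.
apply/matrixP => i j; rewrite mxE; apply: EFin_inj; rewrite -!second_momentE.
by apply: eq_integral => w _; rewrite mulrC.
Qed.

Lemma coord_sqr i : nnint P (fun w => vec (X w) i 0 ^+ 2).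
Proof.
split; [exact/measurable_funX/measurable_vecX|by move=> w; exact: sqr_ge0|].
by rewrite (eq_integral (fun w => (vec (X w) i 0 * vec (X w) i 0)%:E)) ?second_momentE ?ltry.
Qed.

Lemma coord_integrable i j : P.-integrable setT (fun w => (vec (X w) i 0 * vec (X w) j 0)%:E).
Proof.
have [[mij _ fin] _] := ExD (coord_sqr i) (coord_sqr j).
apply: (@le_integrable _ _ _ _ _ measurableT _ (fun w => (vec (X w) i 0 ^+ 2 + vec (X w) j 0 ^+ 2)%:E)).
- by apply/measurable_EFinP; apply: measurable_funM; exact: measurable_vecX.
- move=> w _; rewrite !abse_EFin lee_fin [leRHS]ger0_norm ?addr_ge0 ?sqr_ge0 //.
  set a := vec _ i 0; set b := vec _ j 0; rewrite ler_norml.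
  by have := sqr_ge0 (a + b); have := sqr_ge0 (a - b); have := sqr_ge0 a; have := sqr_ge0 b; lra.
apply/integrableP; split; first exact/measurable_EFinP.
apply: le_lt_trans fin; rewrite le_eqVlt; apply/orP; left; apply/eqP; apply: eq_integral => w _.
by rewrite abse_EFin ger0_norm // addr_ge0 ?sqr_ge0.
Qed.

Lemma quadratic_moment u : nnint mu (fun x => dotp (vec x) u ^+ 2) /\
  Ex mu (fun x => dotp (vec x) u ^+ 2) = dotp u (S *m u).
Proof.
have E : (\int[mu]_x (dotp (vec x) u ^+ 2)%:E = (dotp u (S *m u))%:E)%E.
  rewrite ge0_integral_distribution; first last.
  - by move=> x; rewrite lee_fin sqr_ge0.
  - by apply/measurable_EFinP/measurable_funX/measurable_dotp; exact: measurable_vec.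
  pose f (ij : 'I_d * 'I_d) w : \bar R :=
    ((u ij.1 0 * u ij.2 0)%:E * (vec (X w) ij.1 0 * vec (X w) ij.2 0)%:E)%E.
  rewrite (eq_integral (fun w => \sum_(ij <- index_enum ('I_d * 'I_d)%type) f ij w)%E).
    rewrite integral_sum //; last by move=> ij; apply: integrableZl => //; exact: coord_integrable.
    rewrite (eq_bigr (fun ij => (u ij.1 0 * S ij.1 ij.2 * u ij.2 0)%:E)) => [|ij _].
      rewrite sumEFin dotp_mulmx -(pair_bigA _ (fun i j => u i 0 * S i j * u j 0)) //.
    rewrite /f integralZl //; last exact: coord_integrable.
    by rewrite second_momentE -EFinM mulrAC.
  move=> w _; rewrite /= sumEFin; congr (_%:E).
  rewrite expr2 mulr_suml -(pair_bigA _ (fun i j => u i 0 * u j 0 * (vec (X w) i 0 * vec (X w) j 0))) /=.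
  apply: eq_bigr => i _; rewrite mulr_sumr; apply: eq_bigr => j _; ring.
split; last by rewrite /Ex E.
split; [|by move=> x; exact: sqr_ge0|by rewrite E ltry].
by apply/measurable_funX/measurable_dotp; exact: measurable_vec.
Qed.

(** The source of r >= 1: by Cauchy-Schwarz <X, v>^2 <= |X|^2 pointwise, and the mean of |X|^2 is
    the trace. *)
Lemma opnorm_le_trace : opnorm S <= \tr S.
Proof.
have [n2 E2] := moment2_norm quadratic_moment (erefl _).
have trE : \tr S = Ex mu (fun x => dotp (vec x) (vec x)).
  by rewrite E2 sum_quad_delta.
have tr0 : 0 <= \tr S by rewrite trE Ex_ge0.
apply: opnorm_sym_le => //; first exact: second_moment_sym.
move=> v v1; have [nv <-] := quadratic_moment v; rewrite ger0_norm ?Ex_ge0 // trE.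
have [mv v0 _] := nv; apply: (Ex_le n2 mv v0 _).2 => x.
by rewrite (le_trans (cauchy_schwarz_sqr _ _)) // -(sqr_norm2 v) v1 expr1n mulr1.
Qed.

End Second_moment.

Section Sample_covariance.
Context (R : realType) (d n : nat) (x : 'I_n -> d.-tuple R) (S : 'M[R]_d).
Hypothesis symS : S^T = S.

Lemma dotp_sample_cov v : dotp v ((sample_cov x - S) *m v) =
  n%:R^-1 * (\sum_k dotp (vec (x k)) v ^+ 2) - dotp v (S *m v).
Proof.
rewrite mulmxBl dotpBr /sample_cov -scalemxAl dotpZr mulmx_suml dotp_sumr.
congr (_ * _ - _); apply: eq_bigr => k _.
by rewrite mulmx_outer dotpZr (dotpC v) expr2.
Qed.

Lemma opnorm_sample_cov_le (c : R) : 0 <= c ->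
  (forall v, norm2 v = 1 ->
     `|n%:R^-1 * (\sum_k dotp (vec (x k)) v ^+ 2) - dotp v (S *m v)| <= c) ->
  opnorm (sample_cov x - S) <= c.
Proof.
move=> c0 h; apply: opnorm_sym_le => // [|v v1]; last by rewrite dotp_sample_cov; exact: h.
rewrite linearB /= symS; congr (_ - _); rewrite /sample_cov linearZ /= linear_sum; congr (_ *: _).
by apply: eq_bigr => k _; rewrite /= trmx_mul trmxK.
Qed.

End Sample_covariance.

Section Degenerate.
Context d0 (T : measurableType d0) (R : realType) (P : probability T R) (d n : nat).
Context (X : {RV P >-> d.-tuple R}) (Xs : 'I_n -> {RV P >-> d.-tuple R}) (S : 'M[R]_d).
Hypothesis (XS : has_second_moment X S) (iid : iid_copies X Xs) (S0 : opnorm S = 0).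

(** Here the rescaling by the operator norm is impossible. But X vanishes almost surely, and the
    operator norm of the sample covariance is at most the mean of the |X_k|^2, whose second moment
    is 0. *)
Lemma degenerate_error :
  (\int[P]_w (opnorm (sample_cov (fun k => Xs k w) - S) ^+ 2)%:E = 0)%E.
Proof.
have Sv (v : 'cV[R]_d) : S *m v = 0.
  by apply: norm2_eq0; apply/eqP; rewrite eq_le norm2_ge0 andbT (le_trans (norm2_mulmx_le_opnorm _ _)) // S0 mul0r.
pose mu := distribution P X.
have [n2 E2] := moment2_norm (quadratic_moment XS) (erefl _).
have {}E2 : Ex mu (fun x => dotp (vec x) (vec x)) = 0.
  by rewrite E2 big1 // => j _; rewrite Sv dotp0r.
have mf := measurable_dotp_self (@measurable_vec R d).
have I2 : (\int[mu]_x (dotp (vec x) (vec x) ^+ 2)%:E = 0)%E.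
  have ae : ae_eq mu setT (fun x : d.-tuple R => (dotp (vec x) (vec x))%:E) (cst 0%E).
    apply/ae_eq_integral_abs => //; first exact/measurable_EFinP.
    rewrite -[RHS]/(0%:E) -E2 ExE //; apply: eq_integral => x _.
    by rewrite abse_EFin ger0_norm // dotpvv_ge0.
  rewrite (ae_eq_integral (cst 0%E)) ?integral0 //.
  - exact/measurable_EFinP/measurable_funX.
  - by apply: filterS ae => x /= h xT; have [->] := h xT; rewrite expr0n.
have n4 : nnint mu (fun x => dotp (vec x) (vec x) ^+ 2).
  by split; [exact: measurable_funX|move=> x; exact: sqr_ge0|rewrite I2 ltry].
have [nS ES] := sum_copies_sqr iid n2 n4.
have ES0 : Ex P (fun w => (\sum_i dotp (vec (Xs i w)) (vec (Xs i w))) ^+ 2) = 0.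
  apply/eqP; rewrite eq_le Ex_ge0 // andbT; apply: (le_trans ES).
  by rewrite -/mu E2 /Ex I2 /= expr0n /= !mulr0 addr0.
have [nZ EZ] := ExZ (sqr_ge0 (n%:R^-1)) nS; rewrite ES0 mulr0 in EZ.
apply/eqP; rewrite eq_le; apply/andP; split; last by apply: integral_ge0 => w _; rewrite lee_fin sqr_ge0.
rewrite -[leRHS]/(0%:E) -EZ ExE //; apply: le_integral_nonneg => w; rewrite lee_fin ?sqr_ge0 //.
rewrite -exprMn lerXn2r ?nnegrE ?opnorm_ge0 //; first by rewrite mulr_ge0 ?invr_ge0 ?ler0n ?sumr_ge0 // => i _; exact: dotpvv_ge0.
apply: opnorm_sample_cov_le => [||v v1]; first exact: second_moment_sym XS.
  by rewrite mulr_ge0 ?invr_ge0 ?ler0n ?sumr_ge0 // => i _; exact: dotpvv_ge0.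
rewrite Sv dotp0r subr0 ger0_norm ?mulr_ge0 ?invr_ge0 ?ler0n ?sumr_ge0 // => [|i _]; last exact: sqr_ge0.
rewrite ler_wpM2l ?invr_ge0 ?ler0n //; apply: ler_sum => i _.
by rewrite (le_trans (cauchy_schwarz_sqr _ _)) // -(sqr_norm2 v) v1 expr1n mulr1.
Qed.

End Degenerate.

Lemma poweR_ratio_le (R : realType) (I : \bar R) (q kappa p : R) : (0 <= I)%E -> 0 < q -> 0 < p ->
  (I `^ p^-1 / (q%:E `^ 2^-1) <= kappa%:E -> I <= (kappa `^ p * q `^ (p / 2))%:E)%E.
Proof.
move=> I0 q0 p0; have pn0 : p != 0 by rewrite gt_eqF.
rewrite poweR_EFin; have sq0 : 0 < q `^ 2^-1 by rewrite powR_gt0.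
rewrite inver gt_eqF // lee_pdivrMr // -EFinM => hI.
have k0 : 0 <= kappa.
  have : (0 <= (kappa * q `^ 2^-1)%:E)%E by apply: le_trans hI; exact: poweR_ge0.
  by rewrite lee_fin pmulr_lge0.
have -> : I = ((I `^ p^-1) `^ p)%E by rewrite -poweRrM mulVf // poweRe1.
have -> : (kappa `^ p * q `^ (p / 2))%:E = ((kappa * q `^ 2^-1)%:E `^ p)%E.
  by rewrite poweR_EFin powRM ?powR_ge0 // -powRrM [p / 2]mulrC.
apply: gt0_ler_poweR; rewrite ?(ltW p0) // in_itv /= ?poweR_ge0 ?leey //.
by rewrite lee_fin mulr_ge0 // powR_ge0.
Qed.

Section Moment_ratio.
Context d0 (T : measurableType d0) (R : realType) (P : probability T R) (d : nat).
Context (X : {RV P >-> d.-tuple R}) (S : 'M[R]_d) (p kappa : R).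
Hypothesis (XS : has_second_moment X S) (p4 : 4 < p).
Hypothesis Xk : sup_moment_ratio p X = kappa%:E.
Let mu := distribution P X.

Lemma moment_ratio_bound u :
  (\int[mu]_x (`|dotp (vec x) u| `^ p)%:E <= (kappa `^ p * dotp u (S *m u) `^ (p / 2))%:E)%E.
Proof.
have p0 : 0 < p by apply: lt_trans p4.
have pn0 : p != 0 by rewrite gt_eqF.
have md v : measurable_fun setT (fun x : d.-tuple R => dotp (vec x) v).
  by apply: measurable_dotp => j; exact: measurable_vec.
have mp v : measurable_fun setT (fun x : d.-tuple R => `|dotp (vec x) v| `^ p).
  by apply: (measurableT_comp (measurable_powR p)); exact: measurableT_comp.
have [nq qE] := quadratic_moment XS u; rewrite -qE.
(* The ratio carries no information in a direction of variance 0, but there <X, u> = 0 almost surely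
   and the p-th moment vanishes. All other directions are reduced to unit vectors by homogeneity. *)
have [q0|q0] := eqVneq (Ex mu (fun x => dotp (vec x) u ^+ 2)) 0.
  have ae : ae_eq mu setT (fun x : d.-tuple R => (dotp (vec x) u ^+ 2)%:E) (cst 0%E).
    apply/ae_eq_integral_abs => //; first exact/measurable_EFinP/measurable_funX.
    rewrite -[RHS]/(0%:E) -q0 ExE //; apply: eq_integral => x _.
    by rewrite abse_EFin ger0_norm // sqr_ge0.
  rewrite (ae_eq_integral (cst 0%E)) ?integral0 ?lee_fin ?mulr_ge0 ?powR_ge0 //.
  - exact/measurable_EFinP.
  - apply: filterS ae => x /= h xT; have [/eqP] := h xT.
    by rewrite sqrf_eq0 => /eqP ->; rewrite normr0 powR0.
have u0 : norm2 u != 0.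
  apply/eqP => u0; move: q0; rewrite qE (norm2_eq0 u0) dotp0l eqxx //.
have up : 0 < norm2 u by rewrite lt_def u0 norm2_ge0.
pose v := (norm2 u)^-1 *: u.
have v1 : norm2 v = 1 by rewrite norm2Z ger0_norm ?invr_ge0 ?norm2_ge0 // mulVf.
have uE : u = norm2 u *: v by rewrite scalerA mulfV // scale1r.
have [nqv qvE] := quadratic_moment XS v.
set qv := Ex mu (fun x => dotp (vec x) v ^+ 2) in qvE.
have quE : Ex mu (fun x => dotp (vec x) u ^+ 2) = norm2 u ^+ 2 * qv.
  by rewrite qE qvE {1 2}uE -scalemxAr dotpZl dotpZr mulrA expr2.
have qv0 : 0 < qv.
  by rewrite lt_def Ex_ge0 // andbT; apply: contraNneq q0 => e; rewrite quE e mulr0.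
set Iv := (\int[mu]_x (`|dotp (vec x) v| `^ p)%:E)%E.
have Iv0 : (0 <= Iv)%E by apply: integral_ge0 => x _; rewrite lee_fin powR_ge0.
have IvE : ('E_P[fun w => (`|dotp (vec (X w)) v| `^ p)%R] = Iv)%E.
  by rewrite unlock /Iv ge0_integral_distribution //; exact/measurable_EFinP.
have qvP : ('E_P[fun w => (dotp (vec (X w)) v ^+ 2)%R] = qv%:E)%E.
  rewrite unlock ExE // ge0_integral_distribution //; first exact/measurable_EFinP/measurable_funX.
  by move=> x; rewrite lee_fin sqr_ge0.
have : (moment_ratio p X v <= kappa%:E)%E by rewrite -Xk; apply: ereal_sup_ubound; exists v.
rewrite /moment_ratio IvE qvP => /(poweR_ratio_le Iv0 qv0 p0) hI.
have -> : (\int[mu]_x (`|dotp (vec x) u| `^ p)%:E = (norm2 u `^ p)%:E * Iv)%E.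
  have mE : measurable_fun setT (fun x : d.-tuple R => (`|dotp (vec x) v| `^ p)%:E).
    exact/measurable_EFinP.
  have pE (x : d.-tuple R) : [set: d.-tuple R] x -> (0 <= (`|dotp (vec x) v| `^ p)%:E)%E.
    by rewrite lee_fin powR_ge0.
  rewrite -ge0_integralZl_EFin ?powR_ge0 //.
  apply: eq_integral => x _; rewrite {1}uE dotpZr normrM (ger0_norm (norm2_ge0 u)) -EFinM.
  by rewrite powRM ?norm2_ge0.
apply: (@le_trans _ _ ((norm2 u `^ p)%:E * (kappa `^ p * qv `^ (p / 2))%:E)%E).
  by rewrite lee_wpmul2l // lee_fin powR_ge0.
rewrite -EFinM lee_fin quE powRM ?sqr_ge0 ?(ltW qv0) //.
rewrite -(powR_mulrn 2 (norm2_ge0 u)) -powRrM.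
have -> : 2%:R * (p / 2) = p by field.
by rewrite mulrCA.
Qed.

End Moment_ratio.

Section Maximum.
Context d0 (T : measurableType d0) (R : realType) (n : nat) (f : 'I_n -> T -> R).

Lemma measurable_bigmax : (forall k, measurable_fun setT (f k)) ->
  measurable_fun setT (fun w => \big[Num.max/0]_(k < n) f k w).
Proof.
move=> mf; elim: (index_enum _) => [|k s IH].
  by rewrite (_ : (fun w => _) = cst 0) //; apply/funext => w; rewrite big_nil.
rewrite (_ : (fun w => _) = fun w => Num.max (f k w) (\big[Num.max/0]_(k <- s) f k w)).
  exact: measurable_maxr.
by apply/funext => w; rewrite big_cons.
Qed.

End Maximum.

(** * Rescaling to operator norm 1 and conclusion *)

Theorem theorem3p1 (R : realType) :
  exists2 c : R, 0 < c &
  forall p kappa : R, 4 < p ->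
  exists C : R,
  forall (disp : measure_display) (T : measurableType disp)
    (P : probability T R) (d n : nat) (X : {RV P >-> d.-tuple R})
    (Xs : 'I_n -> {RV P >-> d.-tuple R}) (Sigma : 'M[R]_d),
    (0 < n)%N ->
    centered X ->
    has_second_moment X Sigma ->
    iid_copies X Xs ->
    effrank Sigma / n%:R <= c ->
    sup_moment_ratio p X = kappa%:E ->
    (('E_P[fun w => (opnorm (sample_cov (fun k => Xs k w) - Sigma) ^+ 2)%R])
       `^ 2^-1 <=
     C%:E * ((opnorm Sigma * Num.sqrt (effrank Sigma / n%:R))%:E
       + ('E_P[fun w =>
             (\big[Num.max/0]_(k < n) (norm2 (vec (Xs k w)) `^ p))%R])
           `^ (2 / p) * (n%:R^-1)%:E))%E.
Proof.
(* With c = 1 the assumption reads r <= n, which keeps eps at most 1. *)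
exists 1 => // p kappa p4; pose Kp := kappa `^ p.
have Kp0 : 0 <= Kp by exact: powR_ge0.
have p0 : 0 < p by apply: lt_trans p4.
have [A0 A00 A0P] := @sparse_opnorm_levels R p (4 + Kp * 192 `^ p) p4
  (addr_ge0 (ler0n R 4) (mulr_ge0 Kp0 (powR_ge0 _ _))).
set B := 6 * (50 * 100 + 4 * (1 + Kp) + A0) ^+ 2 *
  (9 + 2 * (4 * (1 + Kp)) + (4 * (1 + Kp)) ^+ 2 + 12 / (1 - 4 / p) ^+ 2).
(* The summand 1 makes the constant strictly positive, so that the right-hand side is infinite when
   the maximum term is. *)
exists (Num.sqrt B + 1) => disp T P d n X Xs S n0 _ XS iid rn1 Xk.
have C0 : 0 < Num.sqrt B + 1 by rewrite ltr_wpDl // sqrtr_ge0.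
have nR : 0 < n%:R :> R by rewrite ltr0n.
have ni : 0 < n%:R^-1 :> R by rewrite invr_gt0.
set Mx := fun w => \big[Num.max/0]_(k < n) (norm2 (vec (Xs k w)) `^ p).
have Mx0 w : 0 <= Mx w.
  by apply: (big_ind (fun y => 0 <= y)) => // [a b a0 b0|i _]; rewrite ?le_max ?a0 ?powR_ge0.
have mMx : measurable_fun setT Mx.
  apply: measurable_bigmax => k; apply: (measurableT_comp (measurable_powR p)).
  apply: measurableT_comp; first exact: continuous_measurable_fun (@sqrt_continuous R).
  apply: (measurableT_comp (f := fun x : d.-tuple R => dotp (vec x) (vec x))); last exact: measurable_funPT.
  by apply: measurable_dotp_self => j; exact: measurable_vec.
have ExpM : ('E_P[fun w => Mx w] = \int[P]_w (Mx w)%:E)%E by rewrite unlock.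
have Exp2 : ('E_P[fun w => (opnorm (sample_cov (fun k => Xs k w) - S) ^+ 2)%R] =
   \int[P]_w (opnorm (sample_cov (fun k => Xs k w) - S) ^+ 2)%:E)%E by rewrite unlock.
rewrite ExpM Exp2.
have rhs0 : (0 <= (opnorm S * Num.sqrt (effrank S / n%:R))%:E
       + (\int[P]_w (Mx w)%:E) `^ (2 / p) * (n%:R^-1)%:E)%E.
  by rewrite adde_ge0 ?mule_ge0 ?lee_fin ?poweR_ge0 ?mulr_ge0 ?opnorm_ge0 ?sqrtr_ge0 // ltW.
have [L0|L0] := eqVneq (opnorm S) 0.
  by rewrite (degenerate_error XS iid L0) poweR0r ?invr_eq0 // mule_ge0 // lee_fin ltW.
have L : 0 < opnorm S by rewrite lt_def L0 opnorm_ge0.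
have [Moo|Mfin] := eqVneq (\int[P]_w (Mx w)%:E)%E +oo%E.
  by rewrite Moo poweRyr ?gt_eqF ?divr_gt0 // gt0_mulye ?lte_fin // addey // gt0_muley ?leey ?lte_fin.
have nM : nnint P Mx by split=> //; rewrite ltey.
set r := effrank S.
have rE : \tr S = opnorm S * r by rewrite mulrC /r /effrank divfK.
have r1 : 1 <= r by rewrite ler_pdivlMr // mul1r; exact: opnorm_le_trace XS.
have rn : r <= n%:R by move: rn1; rewrite ler_pdivrMr // mul1r.
(* Scaling X by a turns the covariance into a matrix of operator norm 1 and trace r. *)
pose a := (Num.sqrt (opnorm S))^-1.
have a0 : 0 < a by rewrite invr_gt0 sqrtr_gt0.
have a2 : a ^+ 2 = (opnorm S)^-1 by rewrite exprVn sqr_sqrtr // ltW.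
pose nv (x : d.-tuple R) := a *: vec x.
pose Q u := (opnorm S)^-1 * dotp u (S *m u).
have mnv j : measurable_fun setT (fun x : d.-tuple R => nv x j 0).
  rewrite (_ : (fun x => _) = fun x => a * vec x j 0); last by apply/funext => x; rewrite mxE.
  by apply: measurable_funM => //; exact: measurable_vec.
have Li : 0 <= (opnorm S)^-1 by rewrite invr_ge0 ltW.
have q0 u : 0 <= dotp u (S *m u) by have [? <-] := quadratic_moment XS u; exact: Ex_ge0.
have Q0 u : 0 <= Q u by rewrite mulr_ge0.
have Q1 u : Q u <= dotp u u by rewrite /Q mulrC ler_pdivrMr // mulrC; exact: quad_le_opnorm.
have EQ u : nnint (distribution P X) (fun x => dotp (nv x) u ^+ 2) /\
    Ex (distribution P X) (fun x => dotp (nv x) u ^+ 2) = Q u.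
  have [nq qE] := quadratic_moment XS u; rewrite /Q -qE.
  rewrite (_ : (fun x => dotp (nv x) u ^+ 2) = fun x => (opnorm S)^-1 * dotp (vec x) u ^+ 2); first exact: ExZ.
  by apply/funext => x; rewrite dotpZl exprMn a2.
have EP u : (\int[distribution P X]_x (`|dotp (nv x) u| `^ p)%:E <= (Kp * Q u `^ (p / 2))%:E)%E.
  have := moment_ratio_bound XS p4 Xk u.
  have ap0 : 0 <= a `^ p by exact: powR_ge0.
  have -> : (\int[distribution P X]_x (`|dotp (nv x) u| `^ p)%:E =
      (a `^ p)%:E * \int[distribution P X]_x (`|dotp (vec x) u| `^ p)%:E)%E.
    have mE : measurable_fun setT (fun x : d.-tuple R => (`|dotp (vec x) u| `^ p)%:E).
      apply/measurable_EFinP; apply: (measurableT_comp (measurable_powR p)).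
      by apply: measurableT_comp => //; apply: measurable_dotp => j; exact: measurable_vec.
    have pE (x : d.-tuple R) : [set: d.-tuple R] x -> (0 <= (`|dotp (vec x) u| `^ p)%:E)%E.
      by rewrite lee_fin powR_ge0.
    rewrite -ge0_integralZl_EFin //.
    apply: eq_integral => x _; rewrite dotpZl normrM (ger0_norm (ltW a0)) -EFinM.
    by rewrite powRM // ltW.
  move=> h; apply: (le_trans (lee_wpmul2l _ h)); first by rewrite lee_fin.
  rewrite -EFinM lee_fin /Q powRM // mulrCA ler_wpM2l // ler_wpM2r ?powR_ge0 //.
  rewrite -a2 -(powR_mulrn 2 (ltW a0)) -powRrM.
  by have -> : 2%:R * (p / 2) = p by field.
have rQ : r = \sum_j Q (delta_mx j 0).
  by rewrite -mulr_sumr sum_quad_delta rE mulKf.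
pose G w := a `^ p * Mx w.
have [nG EG] := ExZ (powR_ge0 a p) nM.
have xG w i : norm2 (nv (Xs i w)) `^ p <= G w.
  rewrite norm2Z (ger0_norm (ltW a0)) powRM ?norm2_ge0 ?(ltW a0) // ler_wpM2l ?powR_ge0 //.
  by rewrite /Mx (bigD1 i) //= le_max lexx.
pose m := a ^+ 2 * (Ex P Mx) `^ (2 / p).
have m0 : 0 <= m by rewrite mulr_ge0 ?sqr_ge0 ?powR_ge0.
have EGm : Ex P G <= m `^ (p / 2).
  rewrite /G EG /m powRM ?sqr_ge0 ?powR_ge0 // -powRrM -(powR_mulrn 2 (ltW a0)) -powRrM.
  have -> : 2%:R * (p / 2) = p by field.
  have -> : 2 / p * (p / 2) = 1 by field; rewrite gt_eqF.
  by rewrite powRr1 // Ex_ge0.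
have [H [mH H0 IH err]] := deviation iid mnv p4 Kp0 Q0 Q1 EQ EP r1 rQ rn A00 A0P nG xG m0 EGm.
set s := m + _ in IH; rewrite -/B in IH.
have s0 : 0 <= s by rewrite addr_ge0 // mulr_ge0 ?sqrtr_ge0 // ltW.
pose b := opnorm S / n%:R; have b0 : 0 < b by rewrite divr_gt0.
have pt w : ((opnorm (sample_cov (fun k => Xs k w) - S) ^+ 2)%:E <= (b ^+ 2)%:E * H w)%E.
  case Hw : (H w) (H0 w) (err w) => [h| |] // h0 hv; last by rewrite gt0_muley ?leey // lte_fin exprn_gt0.
  rewrite lee_fin in h0; rewrite -EFinM lee_fin -(sqr_sqrtr h0) -exprMn.
  have c0 : 0 <= b * Num.sqrt h by rewrite mulr_ge0 ?sqrtr_ge0 // ltW.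
  rewrite lerXn2r ?nnegrE ?opnorm_ge0 //.
  apply: opnorm_sample_cov_le => // [|v v1]; first exact: second_moment_sym XS.
  have hv' : `|\sum_i dotp (nv (Xs i w)) v ^+ 2 - n%:R * Q v| <= Num.sqrt h.
    by rewrite -sqrtr_sqr ler_wsqrtr // -lee_fin; exact: hv.
  have -> : n%:R^-1 * (\sum_k dotp (vec (Xs k w)) v ^+ 2) - dotp v (S *m v) =
      b * (\sum_i dotp (nv (Xs i w)) v ^+ 2 - n%:R * Q v).
    rewrite [X in _ = b * (X - _)](eq_bigr (fun i => (opnorm S)^-1 * dotp (vec (Xs i w)) v ^+ 2)) => [|i _]; last first.
      by rewrite dotpZl exprMn a2.
    by rewrite -mulr_sumr /b /Q; field; rewrite !gt_eqF.
  by rewrite normrM (ger0_norm (ltW b0)) ler_wpM2l // ltW.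
have B0 : 0 <= B by rewrite mulr_ge0 ?mulr_ge0 ?sqr_ge0 ?addr_ge0 ?sqr_ge0 ?mulr_ge0 ?addr_ge0 ?invr_ge0 ?sqr_ge0.
have I2 : (\int[P]_w (opnorm (sample_cov (fun k => Xs k w) - S) ^+ 2)%:E <= ((b * (Num.sqrt B * s)) ^+ 2)%:E)%E.
  apply: le_trans (le_integral_nonneg P _ pt) _; first by move=> w; rewrite lee_fin sqr_ge0.
  rewrite ge0_integralZl_EFin ?sqr_ge0 //.
  apply: (le_trans (lee_wpmul2l _ IH)); first by rewrite lee_fin sqr_ge0.
  have E : (b * (Num.sqrt B * s)) ^+ 2 = b ^+ 2 * (Num.sqrt B ^+ 2 * s ^+ 2) by ring.
  by rewrite -EFinM lee_fin E sqr_sqrtr.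
have c0 : 0 <= b * (Num.sqrt B * s) by rewrite mulr_ge0 ?(ltW b0) // mulr_ge0 ?sqrtr_ge0.
apply: (@le_trans _ _ (b * (Num.sqrt B * s))%:E).
  apply: (@le_trans _ _ (((b * (Num.sqrt B * s)) ^+ 2)%:E `^ 2^-1)%E).
    apply: gt0_ler_poweR; rewrite ?invr_ge0 // in_itv /= ?leey ?andbT ?lee_fin ?sqr_ge0 //.
    by apply: integral_ge0 => w _; rewrite lee_fin sqr_ge0.
  rewrite poweR_EFin -(powR_mulrn 2 c0) -powRrM mulfV // powRr1 //.
have -> : ((\int[P]_w (Mx w)%:E) `^ (2 / p) * (n%:R^-1)%:E = (Ex P Mx `^ (2 / p) / n%:R)%:E)%E.
  by rewrite -ExE // poweR_EFin -EFinM.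
rewrite -EFinD -EFinM lee_fin.
have -> : b * (Num.sqrt B * s) = Num.sqrt B *
    (opnorm S * Num.sqrt (r / n%:R) + Ex P Mx `^ (2 / p) / n%:R).
  by rewrite /s /m a2 /b; field; rewrite L0 gt_eqF.
rewrite ler_wpM2r ?lerDl //.
by rewrite addr_ge0 // ?mulr_ge0 ?opnorm_ge0 ?sqrtr_ge0 ?powR_ge0 // ltW.
Qed.
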